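(* Let $\mathbb{K}$ be a field of characteristic zero and let $L$ be a Leibniz algebra over $\mathbb{K}$ with $\dim_{\mathbb{K}} HL^2(L;L)<\infty$. Let $C=\varprojlim_k C_k$ and let $\eta$ be the formal deformation of $L$ with base $C$ obtained as the projective limit of the inductively constructed deformations $\eta_k$ of $L$ with bases $C_k$ (the construction is recalled in the context). Then $\eta$ is a versal deformation of $L$; that is: (i) for every formal deformation $\lambda$ of $L$ with base a complete local algebra $A$ there exists a homomorphism $f:C\to A$ such that $\lambda$ is equivalent to $f_*\eta$; and (ii) if the maximal ideal $\mathfrak{M}$ of $A$ satisfies $\mathfrak{M}^2=0$, then such an $f$ is unique.
   Context: **Leibniz algebras and cohomology.** A Leibniz algebra over a commutative ring $R$ is an $R$-module with an $R$-bilinear bracket satisfying $[x,[y,z]]=[[x,y],z]-[[x,z],y]$. For a Leibniz algebra $L$ over $\mathbb{K}$ put $CL^n(L;L)=\mathrm{Hom}_{\mathbb{K}}(L^{\otimes n},L)$ and $$\delta f(x_1,\dots,x_{n+1})=[x_1,f(x_2,\dots,x_{n+1})]+\sum_{i=2}^{n+1}(-1)^i[f(x_1,\dots,\hat x_i,\dots,x_{n+1}),x_i]+\sum_{1\le i<j\le n+1}(-1)^{j+1}f(x_1,\dots,x_{i-1},[x_i,x_j],x_{i+1},\dots,\hat x_j,\dots,x_{n+1}).$$ $HL^n(L;L)$ is the cohomology of this complex; $\mathbb{H}:=HL^2(L;L)$. A prime $V'$ denotes the $\mathbb{K}$-linear dual. **Deformations.** Bases are commutative unital $\mathbb{K}$-algebras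 $A$ with an augmentation $\varepsilon:A\to\mathbb{K}$ (unital algebra map), $\mathfrak{M}=\ker\varepsilon$, with $\dim(\mathfrak{M}^k/\mathfrak{M}^{k+1})<\infty$ for all $k$. Homomorphisms of bases are unital $\mathbb{K}$-algebra homomorphisms compatible with augmentations. A deformation $\lambda$ of $L$ with base $A$ is an $A$-Leibniz algebra structure $[,]_\lambda$ on $A\otimes_{\mathbb{K}}L$ such that $\varepsilon\otimes\mathrm{id}:A\otimes L\to\mathbb{K}\otimes L=L$ is a homomorphism of Leibniz algebras. Two deformations $\lambda_1,\lambda_2$ with base $A$ are equivalent if there is an isomorphism of $A$-Leibniz algebras $\rho:(A\otimes L,[,]_{\lambda_1})\to(A\otimes L,[,]_{\lambda_2})$ with $(\varepsilon\otimes\mathrm{id})\circ\rho=\varepsilon\otimes\mathrm{id}$. For a homomorphism $\phi:A\to A'$ of bases the push-out $\phi_*\lambda$ is the deformation with base $A'$ determined by $[1\otimes l_1,1\otimes l_2]_{\phi_*\lambda}=(\phi\otimes\mathrm{id})([1\otimes l_1,1\otimes l_2]_\lambda)$. If $A$ is a complete local algebra ($A=\varprojlim_n A/\mathfrak{M}^n$, $\mathfrak{M}$ its maximal ideal), a formal deformation of $L$ with base $A$ is an $A$-Leibniz algebra structure on $A\hat\otimes L=\varprojlim_n((A/\mathfrak{M}^n)\otimes L)$ which is the projective limit of deformations with bases $A/\mathfrak{M}^n$ and such that $\varepsilon\otimes\mathrm{id}:A\hat\otimes L\to L$ is a homomorphism; equivalence and push-out are defined likewise, with $A\hat\otimes L$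 in place of $A\otimes L$. **Harrison classes and extensions.** For a commutative local base $A$ and an $A$-module $M$ with $\mathfrak{M}M=0$, $H^2_{Harr}(A;M)$ is the space of symmetric bilinear maps $f:A\times A\to M$ with $a f(b,c)-f(ab,c)+f(a,bc)-f(a,b)c=0$, modulo maps $(a,b)\mapsto a g(b)-g(ab)+g(a)b$ with $g:A\to M$ linear. The class $[f]$ corresponds to the extension $0\to M\xrightarrow{i}B\xrightarrow{p}A\to0$ of commutative algebras with $B=A\oplus M$ and $(a_1,x_1)(a_2,x_2)=(a_1a_2,a_1x_2+a_2x_1+f(a_1,a_2))$. $\mathbb{K}$ is an $A$-module via $\varepsilon$. **Obstruction map.** Let $A$ be a finite-dimensional local base, $\lambda$ a deformation of $L$ with base $A$, $M$ a finite-dimensional $A$-module with $\mathfrak{M}M=0$, and $0\to M\xrightarrow{i}B\xrightarrow{p}A\to0$ an extension with class $[f]$. Choose a $B$-bilinear operation $\{,\}$ on $B\otimes L$ with $(p\otimes\mathrm{id})\{x,y\}=[(p\otimes\mathrm{id})x,(p\otimes\mathrm{id})y]_\lambda$ and $\{(i\otimes\mathrm{id})(x),y\}=(i\otimes\mathrm{id})[x,E(y)]$ for $x\in M\otimes L$, where $E=(\varepsilon\circ p)\otimes\mathrm{id}:B\otimes L\to L$ (and $[m\otimes l,l']=m\otimes[l,l']$). Put $\phi(x,y,z)=\{x,\{y,z\}\}-\{\{x,y\},z\}+\{\{x,z\},y\}$. Then $\phi(1\otimes l_1,1\otimes l_2,1\otimes l_3)=(i\otimes \mathrm{id})(\bar\phi(l_1,l_2,l_3))$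 for a cocycle $\bar\phi\in CL^3(L;M\otimes L)$, whose class depends only on $[f]$; set $\theta_\lambda([f])=[\bar\phi]\in HL^3(L;M\otimes L)=M\otimes HL^3(L;L)$. **Construction of $C$ and $\eta$.** $C_0=\mathbb{K}$; $C_1=\mathbb{K}\oplus\mathbb{H}'$ with $(k_1,h_1)(k_2,h_2)=(k_1k_2,k_1h_2+k_2h_1)$. Fix a linear map $\mu:\mathbb{H}\to CL^2(L;L)$ sending each class to a representing cocycle; with a basis $\{h_i\}$ of $\mathbb{H}$ and dual basis $\{g_i\}$, $\eta_1$ is the deformation with base $C_1$ given by $[1\otimes l_1,1\otimes l_2]_{\eta_1}=1\otimes[l_1,l_2]+\sum_i g_i\otimes\mu(h_i)(l_1,l_2)$. Given, for $k\ge1$, a finite-dimensional local algebra $C_k$ and a deformation $\eta_k$ with base $C_k$, choose a linear map sending each class in $H^2_{Harr}(C_k;\mathbb{K})$ to a representing cocycle; its dual is a 2-cocycle $f_{C_k}$ of $C_k$ with values in $H^2_{Harr}(C_k;\mathbb{K})'$, defining an extension $$0\to H^2_{Harr}(C_k;\mathbb{K})'\xrightarrow{\bar i_{k+1}}\bar C_{k+1}\xrightarrow{\bar p_{k+1}}C_k\to0 .$$ Its obstruction $\theta_{\eta_k}([f_{C_k}])\in H^2_{Harr}(C_k;\mathbb{K})'\otimes HL^3(L;L)$ is viewed as a linear map $\omega_k:H^2_{Harr}(C_k;\mathbb{K})\to HL^3(L;L)$, with dual $\omega_k'$. Set $C_{k+1}=\bar C_{k+1}/\bar i_{k+1}(\omega_k'(HL^3(L;L)'))$;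 since $\mathrm{coker}(\omega_k')\cong(\ker\omega_k)'$ this gives an extension $0\to(\ker\omega_k)'\xrightarrow{i_{k+1}}C_{k+1}\xrightarrow{p_{k+1}}C_k\to0$. Choose a deformation $\eta_{k+1}$ with base $C_{k+1}$ and $(p_{k+1})_*\eta_{k+1}=\eta_k$ (such exists). Then $C=\varprojlim_k C_k$ and $\eta$ is the projective limit of the $\eta_k$. *)

(* Defs.v *)
From HB Require Import structures.
From mathcomp Require Import all_boot all_algebra.
From mathcomp Require Import boolp functions.
From mathcomp.multinomials Require Import freeg.

Set Implicit Arguments.
Unset Strict Implicit.
Unset Printing Implicit Defensive.

Import GRing.Theory.
Local Open Scope ring_scope.
Local Open Scope quotient_scope.

Section Submodules.
Variables (R : pzRingType) (V : lmodType R).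

Record submod := Submod {
  smem :> V -> Prop;
  smem0 : smem 0;
  smemP : forall a u v, smem u -> smem v -> smem (a *: u + v) }.

Lemma smemD (W : submod) u v : W u -> W v -> W (u + v).
Proof. by move=> Wu Wv; rewrite -[u]scale1r; apply: smemP. Qed.
Lemma smemZ (W : submod) a u : W u -> W (a *: u).
Proof. by move=> Wu; rewrite -[_ *: u]addr0; apply: smemP => //; apply: smem0. Qed.
Lemma smemN (W : submod) u : W u -> W (- u).
Proof. by move=> Wu; rewrite -scaleN1r; apply: smemZ. Qed.

Definition full_submod : submod :=
  @Submod (fun=> True) I (fun _ _ _ _ _ => I).

Section Span.
Variable S : V -> Prop.

Definition span_mem (v : V) : Prop :=
  forall W : submod, (forall s, S s -> W s) -> W v.

Lemma span_mem0 : span_mem 0.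
Proof. by move=> W _; apply: smem0. Qed.
Lemma span_memP a u v : span_mem u -> span_mem v -> span_mem (a *: u + v).
Proof. by move=> Su Sv W SW; apply: smemP; [apply: Su | apply: Sv]. Qed.

Definition span : submod := Submod span_mem0 span_memP.

End Span.

Lemma span_sub (S : V -> Prop) v : S v -> span S v.
Proof. by move=> Sv W; apply. Qed.

Lemma span_min (S : V -> Prop) (W : submod) v :
  (forall s, S s -> W s) -> span S v -> W v.
Proof. by move=> SW; apply. Qed.

Section SubType.
Variable W : submod.

Record subm := Subm { subm_val :> V; subm_proof : `[< W subm_val >] }.

HB.instance Definition _ := [isSub for subm_val].
HB.instance Definition _ := [Choice of subm by <:].

Lemma subm_closed : subsemimod_closed (fun v : V => `[< W v >]).
Proof.
split; first split.
- by apply/asboolP; apply: smem0.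
- by move=> u v /asboolP Wu /asboolP Wv; apply/asboolP; apply: smemD.
- by move=> a u /asboolP Wu; apply/asboolP; apply: smemZ.
Qed.

HB.instance Definition _ :=
  GRing.SubChoice_isSubLmodule.Build R V (fun v : V => `[< W v >]) subm
    subm_closed.

Definition mksub (v : V) (Wv : W v) : subm := Subm (introT (asboolP _) Wv).

Lemma submP (w : subm) : W (subm_val w).
Proof. by case: w => v wv; apply/asboolP. Qed.

End SubType.

Section Quotient.
Variable B : submod.

Definition quot_rel (u v : V) := `[< B (u - v) >].

Lemma quot_refl : reflexive quot_rel.
Proof. by move=> u; apply/asboolP; rewrite subrr; apply: smem0. Qed.
Lemma quot_sym : symmetric quot_rel.
Proof.
by move=> u v; apply/asboolP/asboolP => /smemN; rewrite opprB.
Qed.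
Lemma quot_trans : transitive quot_rel.
Proof.
move=> v u w /asboolP uv /asboolP vw; apply/asboolP.
by rewrite -(subrKA v); apply: smemD.
Qed.

Canonical quot_equiv := EquivRel quot_rel quot_refl quot_sym quot_trans.
Canonical quot_equiv_direct := defaultEncModRel quot_rel.

Definition quot := {eq_quot quot_rel}.

HB.instance Definition _ := Choice.on quot.
HB.instance Definition _ := Quotient.on quot.
HB.instance Definition _ : EqQuotient _ quot_rel quot := EqQuotient.on quot.

Definition qpi : V -> quot := fun v => \pi_quot v.

Lemma qpiP u v : qpi u = qpi v <-> B (u - v).
Proof. by split=> [/eqmodP/asboolP|Buv]; last apply/eqmodP/asboolP. Qed.

Lemma qreprK (x : quot) : qpi (repr x) = x.
Proof. exact: reprK. Qed.

Lemma quot_ind (P : quot -> Prop) : (forall v, P (qpi v)) -> forall x, P x.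
Proof. by move=> Ppi x; rewrite -[x]qreprK. Qed.

Let qadd (x y : quot) : quot := qpi (repr x + repr y).
Let qopp (x : quot) : quot := qpi (- repr x).
Let qscale a (x : quot) : quot := qpi (a *: repr x).

Lemma repr_qpi v : B (repr (qpi v) - v).
Proof. by apply/qpiP; rewrite qreprK. Qed.

Let qaddE u v : qadd (qpi u) (qpi v) = qpi (u + v).
Proof.
apply/qpiP; rewrite opprD addrACA.
by apply: smemD; apply: repr_qpi.
Qed.
Let qoppE u : qopp (qpi u) = qpi (- u).
Proof. by apply/qpiP; rewrite -opprD; apply: smemN; apply: repr_qpi. Qed.
Let qscaleE a u : qscale a (qpi u) = qpi (a *: u).
Proof. by apply/qpiP; rewrite -scalerBr; apply: smemZ; apply: repr_qpi. Qed.

Let qaddA : associative qadd.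
Proof.
by elim/quot_ind=> u; elim/quot_ind=> v; elim/quot_ind=> w; rewrite !qaddE addrA.
Qed.
Let qaddC : commutative qadd.
Proof. by elim/quot_ind=> u; elim/quot_ind=> v; rewrite !qaddE addrC. Qed.
Let qadd0 : left_id (qpi 0) qadd.
Proof. by elim/quot_ind=> u; rewrite qaddE add0r. Qed.
Let qaddN : left_inverse (qpi 0) qopp qadd.
Proof. by elim/quot_ind=> u; rewrite qoppE qaddE addNr. Qed.

HB.instance Definition _ := GRing.isZmodule.Build quot qaddA qaddC qadd0 qaddN.

Let qscaleA a b v : qscale a (qscale b v) = qscale (a * b) v.
Proof. by elim/quot_ind: v => v; rewrite !qscaleE scalerA. Qed.
Let qscale1 : left_id 1 qscale.
Proof. by elim/quot_ind=> v; rewrite qscaleE scale1r. Qed.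
Let qscaleDr : right_distributive qscale +%R.
Proof.
move=> a; elim/quot_ind=> u; elim/quot_ind=> v.
by rewrite [qpi u + _]qaddE !qscaleE [RHS]qaddE scalerDr.
Qed.
Let qscaleDl v : {morph qscale^~ v : a b / a + b}.
Proof. by move=> a b; elim/quot_ind: v => v; rewrite !qscaleE [RHS]qaddE scalerDl. Qed.

HB.instance Definition _ :=
  GRing.Zmodule_isLmodule.Build R quot qscaleA qscale1 qscaleDr qscaleDl.

Lemma qpi_is_linear : linear qpi.
Proof. by move=> a u v; rewrite -qaddE -qscaleE. Qed.

HB.instance Definition _ := GRing.isLinear.Build R V quot _ qpi qpi_is_linear.

End Quotient.

End Submodules.

Section Subquotient.
Variables (R : pzRingType) (V : lmodType R) (Z B : submod V).

Let inside_mem (z : subm Z) : Prop := B (val z).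
Let inside0 : inside_mem 0.
Proof. exact: smem0. Qed.
Let insideP a u v : inside_mem u -> inside_mem v -> inside_mem (a *: u + v).
Proof. exact: smemP. Qed.

Definition inside : submod (subm Z) := Submod inside0 insideP.

Definition subquot := quot inside.

HB.instance Definition _ := GRing.Lmodule.on subquot.

Definition subpi : subm Z -> subquot := @qpi _ _ inside.

End Subquotient.

Section Tensor.
Variable K : fieldType.

Section TensorType.
Variables M L : lmodType K.

Definition fgen (m : M) (l : L) : {freeg (M * L)%type / K} :=
  Freeg [:: (1, (m, l))].

Inductive tens_rel : {freeg (M * L)%type / K} -> Prop :=
| TensLinL a m m' l :
    tens_rel (fgen (a *: m + m') l - (a *: fgen m l + fgen m' l))
| TensLinR a m l l' :
    tens_rel (fgen m (a *: l + l') - (a *: fgen m l + fgen m l')).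

Definition tens := quot (span tens_rel).

HB.instance Definition _ := GRing.Lmodule.on tens.

Definition pure (m : M) (l : L) : tens := @qpi _ _ (span tens_rel) (fgen m l).

Definition bilinear2 (V : lmodType K) (b : M -> L -> V) : Prop :=
  (forall l, linear (b^~ l)) /\ (forall m, linear (b m)).

Lemma pure_bilinear : bilinear2 pure.
Proof.
by split=> [l a m m'|m a l l']; rewrite -linearP; apply/qpiP; apply: span_sub;
  constructor.
Qed.

(* The linear map induced by a bilinear map b; it is computed on a
   representative, so it is meaningful only when b is bilinear (tliftE). *)
Definition tlift (V : lmodType K) (b : M -> L -> V) (t : tens) : V :=
  fglift (fun p => b p.1 p.2) (repr t).

Lemma fglift_linear (V : lmodType K) (T : choiceType) (f : T -> V) :
  linear (fglift f : {freeg T / K} -> V).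
Proof.
have fB : {morph fglift f : x y / x - y} by apply: lift_is_additive.
pose g : {freeg T / K} -> V := fglift f.
pose gm := GRing.isAdditive.Build _ _ g fB.
pose G : {additive {freeg T / K} -> V} := HB.pack g gm.
have fZ a D : g (a *: D) = a *: g D.
  have -> : g D = g (\sum_(z <- dom D) << (coeff z D) *g z >>) by rewrite freeg_sumE.
  have -> : a *: D = fgscale a D by [].
  rewrite /fgscale -![g _]/(G _) !raddf_sum /=.
  by apply: eq_bigr => x _; rewrite /g !liftU scalerA.
move=> a u v; rewrite -[LHS]/(G _) raddfD; congr (_ + _); exact: fZ.
Qed.

Lemma tliftP (V : lmodType K) (b : M -> L -> V) (D : {freeg (M * L)%type / K}) :
  bilinear2 b ->
  tlift b (@qpi _ _ (span tens_rel) D) = fglift (fun p => b p.1 p.2) D.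
Proof.
case=> bl br; have fl := fglift_linear (fun p : M * L => b p.1 p.2).
pose F : {linear {freeg (M * L)%type / K} -> V} :=
  HB.pack (fglift (fun p : M * L => b p.1 p.2)) (GRing.isLinear.Build _ _ _ _ _ fl).
have F0 : F 0 = 0 by apply: raddf0.
have FP a u v : F u = 0 -> F v = 0 -> F (a *: u + v) = 0.
  by move=> Fu Fv; rewrite linearP Fu Fv scaler0 addr0.
have := repr_qpi (span tens_rel) D.
move=> /(span_min (W := Submod F0 FP)) H.
apply/eqP; rewrite -subr_eq0 -[fglift _ D]/(F D) -[tlift _ _]/(F _) -raddfB.
apply/eqP/H => _ [a m m' l|a m l l'] /=;
  rewrite -[fglift _ _]/(F _) linearB linearP /= /fgen !liftU /= !scale1r.
- by rewrite bl subrr.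
- by rewrite br subrr.
Qed.

Lemma tliftE (V : lmodType K) (b : M -> L -> V) m l :
  bilinear2 b -> tlift b (pure m l) = b m l.
Proof. by move=> bb; rewrite tliftP // /fgen liftU scale1r. Qed.

Lemma tlift_linear (V : lmodType K) (b : M -> L -> V) :
  bilinear2 b -> linear (tlift b).
Proof.
move=> bb a; elim/quot_ind=> u; elim/quot_ind=> v.
by rewrite -linearP !tliftP // fglift_linear.
Qed.

Lemma tens_ind (P : tens -> Prop) :
    (forall m l, P (pure m l)) ->
    (forall a x y, P x -> P y -> P (a *: x + y)) ->
  forall x, P x.
Proof.
move=> Ppure Plin.
have P0 : P 0.
  by rewrite -[0](addNr (pure 0 0)) -scaleN1r; apply: Plin.
elim/quot_ind=> D; rewrite -[D]freeg_sumE.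
elim: (dom D) => [|x s IHs]; first by rewrite big_nil linear0.
rewrite big_cons.
have -> : << coeff x D *g x >> = coeff x D *: (<< x >> : {freeg (M * L)%type / K}).
  apply/eqP/freeg_eqP=> z; rewrite coeffZ !coeffU mul1r //.
by rewrite linearP; apply: Plin => //; case: x => m l; apply: Ppure.
Qed.

End TensorType.

Definition tmap (M N L : lmodType K) (f : M -> N) : tens M L -> tens N L :=
  tlift (fun m l => pure (f m) l).

Section TensorMap.
Variables (M N L : lmodType K) (f : M -> N).
Hypothesis fl : linear f.

Lemma tmap_bilinear : bilinear2 (fun m l => pure (f m) l : tens N L).
Proof.
have [pl pr] := pure_bilinear N L.
by split=> [l a m m'|m]; [rewrite fl pl | apply: pr].
Qed.

Lemma tmapE m l : tmap f (pure m l : tens M L) = pure (f m) l.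
Proof. exact: tliftE tmap_bilinear. Qed.

Lemma tmap_linear : linear (@tmap M N L f).
Proof. exact: tlift_linear tmap_bilinear. Qed.

End TensorMap.

Lemma tens_eq (M L V : lmodType K) (f g : tens M L -> V) :
  linear f -> linear g -> (forall m l, f (pure m l) = g (pure m l)) -> f =1 g.
Proof.
move=> fl gl fg; elim/tens_ind=> // a x y fgx fgy.
by rewrite fl gl fgx fgy.
Qed.

Lemma linear_comp (U V W : lmodType K) (f : V -> W) (g : U -> V) :
  linear f -> linear g -> linear (f \o g).
Proof. by move=> fl gl a u v /=; rewrite gl fl. Qed.

Lemma tmap_comp (M N P L : lmodType K) (f : N -> P) (g : M -> N) :
  linear f -> linear g -> @tmap M P L (f \o g) =1 tmap f \o tmap g.
Proof.
move=> fl gl; have fgl := linear_comp fl gl.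
apply: tens_eq.
- exact: tmap_linear.
- by apply: linear_comp; apply: tmap_linear.
- by move=> m l; rewrite /= !tmapE.
Qed.

Lemma eq_tmap (M N L : lmodType K) (f g : M -> N) :
  f =1 g -> @tmap M N L f =1 tmap g.
Proof. by move=> /funext ->. Qed.

End Tensor.

Arguments tlift {K M L V} b t.
Arguments tmap {K M N L} f _.

(* The K-algebra structure of A makes tens A L an A-module; atens is a separate
   name because tens A L already carries its K-module structure. *)
Section AlgebraTensor.
Variables (K : fieldType) (A : comAlgType K) (L : lmodType K).

Definition atens := tens A L.

HB.instance Definition _ := GRing.Zmodule.on atens.

Let mull (a : A) : A -> A := fun b => a * b.
Let mull_linear a : linear (mull a).
Proof. by move=> k b c; rewrite /mull mulrDr scalerAr. Qed.

Let ascale (a : A) (t : atens) : atens := tmap (mull a) t.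

Let ascaleE a b l : ascale a (pure b l) = pure (a * b) l.
Proof. exact: tmapE. Qed.

Let ascale_linear a : linear (ascale a : tens A L -> tens A L).
Proof. exact: tmap_linear. Qed.

Let ascaleA a b t : ascale a (ascale b t) = ascale (a * b) t.
Proof.
rewrite /ascale -[tmap _ (tmap _ _)]/((tmap _ \o tmap _) t) -tmap_comp //.
by apply: eq_tmap => c; rewrite /mull /= mulrA.
Qed.

Let ascale1 : left_id 1 ascale.
Proof.
apply: (@tens_eq _ A L (tens A L) (ascale 1) id).
- exact: ascale_linear.
- by [].
- by move=> m l; rewrite ascaleE mul1r.
Qed.

Let ascaleDr : right_distributive ascale +%R.
Proof.
by move=> a x y; have := ascale_linear a 1 x y; rewrite !scale1r.
Qed.

Let ascaleDl t : {morph ascale^~ t : a b / a + b}.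
Proof.
move=> a b; move: t.
apply: (@tens_eq _ A L (tens A L) (ascale (a + b)) (fun t => ascale a t + ascale b t)).
- exact: ascale_linear.
- by move=> k x y; rewrite !ascale_linear scalerDr addrACA.
- by move=> m l; rewrite !ascaleE mulrDl; have [pl _] := pure_bilinear A L;
    have := pl l 1 (a * m) (b * m); rewrite !scale1r.
Qed.

HB.instance Definition _ :=
  GRing.Zmodule_isLmodule.Build A atens ascaleA ascale1 ascaleDr ascaleDl.

Definition apure (a : A) (l : L) : atens := pure a l.

Lemma ascale_pure (a b : A) l : a *: apure b l = apure (a * b) l.
Proof. exact: ascaleE. Qed.

Lemma ascale_tmap (a : A) (t : atens) : a *: t = tmap (fun b => a * b) t.
Proof. by []. Qed.

End AlgebraTensor.

Record augalg (K : fieldType) := AugAlg {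
  aalg :> comAlgType K;
  aug : {rmorphism aalg -> K};
  augZ : forall k a, aug (k *: a) = k * aug a }.

Arguments aug {K _}.

Record aughom (K : fieldType) (A A' : augalg K) := AugHom {
  ahom :> {lrmorphism A -> A'};
  ahom_aug : forall a, aug (ahom a) = aug a }.

Section AugmentationPowers.
Variables (K : fieldType) (A : augalg K).

(* apow k is the k-th power of the augmentation ideal, apow 0 = A. *)
Fixpoint apow (k : nat) : @submod K A :=
  if k is k'.+1 then
    span (fun x : A => exists m y, [/\ aug m = 0, apow k' y & x = m * y])
  else full_submod A.

Lemma apow_mul k (a x : A) : apow k x -> apow k (a * x).
Proof.
elim: k a x => [//|k IHk] a x.
have W0 : apow k.+1 (a * 0) by rewrite mulr0; apply: smem0.
have WP b u v : apow k.+1 (a * u) -> apow k.+1 (a * v) ->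
    apow k.+1 (a * (b *: u + v)).
  by rewrite mulrDr -scalerAr; apply: smemP.
apply: (span_min (W := Submod W0 WP)) => _ [m [y [m0 ky ->]]] /=.
by apply: span_sub; exists m, (a * y); split; [| apply: IHk | rewrite mulrCA].
Qed.

Lemma apowS_aug k (x : A) : apow k.+1 x -> aug x = 0.
Proof.
have W0 : aug (0 : A) = 0 by apply: raddf0.
have WP b (u v : A) : aug u = 0 -> aug v = 0 -> aug (b *: u + v) = 0.
  by move=> u0 v0; rewrite rmorphD augZ u0 v0 mulr0 addr0.
apply: (span_min (W := Submod W0 WP)) => _ [m [y [m0 _ ->]]] /=.
by rewrite rmorphM m0 mul0r.
Qed.

Lemma apowSS k (x : A) : apow k.+1 x -> apow k x.
Proof.
elim: k x => [//|k IHk] x.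
apply: span_min => _ [m [y [m0 ky ->]]].
by apply: span_sub; exists m, y; split=> //; apply: IHk.
Qed.

End AugmentationPowers.

Arguments apow {K} A k.

Lemma ahom_apow (K : fieldType) (A A' : augalg K) (f : aughom A A') k (x : A) :
  apow A k x -> apow A' k (f x).
Proof.
elim: k x => [//|k IHk] x.
have W0 : apow A' k.+1 (f 0) by rewrite raddf0; apply: smem0.
have WP b (u v : A) : apow A' k.+1 (f u) -> apow A' k.+1 (f v) ->
    apow A' k.+1 (f (b *: u + v)).
  by rewrite linearP; apply: smemP.
apply: (span_min (W := Submod W0 WP)) => _ [m [y [m0 ky ->]]] /=.
apply: span_sub; exists (f m), (f y); split; last by rewrite rmorphM.
- by rewrite ahom_aug.
- exact: IHk.
Qed.

(* trunc A n is A/M^(n+1), with M the augmentation ideal: the exponent starts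
   at 1 so that the quotient is never the zero ring. *)
Section Truncation.
Variables (K : fieldType) (A : augalg K) (n : nat).

Definition trunc_alg := quot (apow A n.+1).

HB.instance Definition _ := GRing.Lmodule.on trunc_alg.

Definition tpi (a : A) : trunc_alg := @qpi _ _ (apow A n.+1) a.

Lemma tpiP a b : tpi a = tpi b <-> apow A n.+1 (a - b).
Proof. exact: qpiP. Qed.
Lemma tpi_ind (P : trunc_alg -> Prop) : (forall a, P (tpi a)) -> forall x, P x.
Proof. exact: quot_ind. Qed.
Lemma tpi_linear : linear tpi.
Proof. exact: linearP. Qed.

Let tmul (x y : trunc_alg) : trunc_alg := tpi (repr x * repr y).

Let tmulE a b : tmul (tpi a) (tpi b) = tpi (a * b).
Proof.
apply/tpiP; rewrite -[_ - _](subrKA (a * repr (tpi b))) -mulrBl -mulrBr.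
apply: smemD; last exact/apow_mul/repr_qpi.
by rewrite mulrC; apply/apow_mul/repr_qpi.
Qed.

Let tmulA : associative tmul.
Proof.
by elim/tpi_ind=> a; elim/tpi_ind=> b; elim/tpi_ind=> c; rewrite !tmulE mulrA.
Qed.
Let tmulC : commutative tmul.
Proof. by elim/tpi_ind=> a; elim/tpi_ind=> b; rewrite !tmulE mulrC. Qed.
Let tmul1 : left_id (tpi 1) tmul.
Proof. by elim/tpi_ind=> a; rewrite tmulE mul1r. Qed.
Let tpiD a b : tpi a + tpi b = tpi (a + b).
Proof. by rewrite -[a]scale1r tpi_linear !scale1r. Qed.
Let tmulDl : left_distributive tmul +%R.
Proof.
by elim/tpi_ind=> a; elim/tpi_ind=> b; elim/tpi_ind=> c;
  rewrite !(tmulE, tpiD) mulrDl.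
Qed.
Let tone_neq0 : tpi 1 != 0.
Proof.
apply/eqP=> /tpiP; rewrite subr0 => /apowS_aug/eqP.
by rewrite rmorph1 oner_eq0.
Qed.

HB.instance Definition _ :=
  GRing.Zmodule_isComNzRing.Build trunc_alg tmulA tmulC tmul1 tmulDl tone_neq0.

Let tpiZ k a : tpi (k *: a) = k *: tpi a.
Proof. by rewrite /tpi linearZ. Qed.

Let tscaleAl (k : K) (x y : trunc_alg) : k *: (x * y) = (k *: x) * y.
Proof.
elim/tpi_ind: x => a; elim/tpi_ind: y => b.
by rewrite [tpi a * tpi b]tmulE -!tpiZ [RHS]tmulE scalerAl.
Qed.

HB.instance Definition _ := GRing.Lmodule_isLalgebra.Build K trunc_alg tscaleAl.
HB.instance Definition _ := GRing.Lalgebra_isComAlgebra.Build K trunc_alg.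

Definition trunc_aug (x : trunc_alg) : K := aug (repr x : A).

Lemma trunc_augE a : trunc_aug (tpi a) = aug a.
Proof.
by apply/eqP; rewrite -subr_eq0 -raddfB; apply/eqP/(@apowS_aug _ _ n)/repr_qpi.
Qed.

Let trunc_augB : {morph trunc_aug : x y / x - y}.
Proof.
elim/tpi_ind=> a; elim/tpi_ind=> b.
by rewrite -raddfB !trunc_augE raddfB.
Qed.
Let trunc_aug_monoid : monoid_morphism trunc_aug.
Proof.
split; first by rewrite [1]/(tpi 1) trunc_augE rmorph1.
by elim/tpi_ind=> a; elim/tpi_ind=> b; rewrite [_ * _]tmulE !trunc_augE rmorphM.
Qed.

HB.instance Definition _ :=
  GRing.isZmodMorphism.Build trunc_alg K trunc_aug trunc_augB.
HB.instance Definition _ :=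
  GRing.isMonoidMorphism.Build trunc_alg K trunc_aug trunc_aug_monoid.

Let trunc_augZ k x : trunc_aug (k *: x) = k * trunc_aug x.
Proof. by elim/tpi_ind: x => a; rewrite -tpiZ !trunc_augE augZ. Qed.

Definition trunc : augalg K := @AugAlg K trunc_alg trunc_aug trunc_augZ.

Let tpi_monoid : monoid_morphism tpi.
Proof. by split=> // a b; rewrite -tmulE. Qed.

HB.instance Definition _ := GRing.isLinear.Build K A trunc_alg _ tpi tpi_linear.
HB.instance Definition _ := GRing.isMonoidMorphism.Build A trunc_alg tpi tpi_monoid.

End Truncation.

Section TruncationMaps.
Variable K : fieldType.

(* The map A/M^(n+2) -> A/M^(n+1). *)
Definition trunc_step (A : augalg K) n (x : trunc A n.+1) : trunc A n :=
  tpi n (repr x : A).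

Lemma trunc_stepE (A : augalg K) n (a : A) :
  @trunc_step A n (tpi n.+1 a) = tpi n a.
Proof. by apply/tpiP/apowSS/repr_qpi. Qed.

Lemma trunc_step_linear (A : augalg K) n : linear (@trunc_step A n).
Proof.
move=> k; elim/tpi_ind=> a; elim/tpi_ind=> b.
by rewrite -(tpi_linear n.+1) !trunc_stepE tpi_linear.
Qed.

Lemma trunc_stepM (A : augalg K) n (x y : trunc A n.+1) :
  trunc_step (x * y) = trunc_step x * trunc_step y.
Proof.
elim/tpi_ind: x => a; elim/tpi_ind: y => b.
by rewrite -rmorphM !trunc_stepE -rmorphM.
Qed.

(* The map A/M^(n+1) -> A'/M'^(n+1) induced by a homomorphism f : A -> A'. *)
Definition trunc_map (A A' : augalg K) (f : aughom A A') n (x : trunc A n) :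
  trunc A' n := tpi n (f (repr x)).

Lemma trunc_mapE (A A' : augalg K) (f : aughom A A') n (a : A) :
  trunc_map f (tpi n a) = tpi n (f a).
Proof. by apply/tpiP; rewrite -raddfB; apply/ahom_apow/repr_qpi. Qed.

Lemma trunc_map_linear (A A' : augalg K) (f : aughom A A') n :
  linear (@trunc_map A A' f n).
Proof.
move=> k; elim/tpi_ind=> a; elim/tpi_ind=> b.
by rewrite -(tpi_linear n) !trunc_mapE linearP tpi_linear.
Qed.

End TruncationMaps.

(* The completed tensor product of A and L, the limit of the A/M^(n+1) (x) L. *)
Section CompletedTensor.
Variables (K : fieldType) (A : augalg K) (L : lmodType K).

Record ctens := CTens {
  level :> forall n, atens (trunc A n) L;
  level_step : forall n, tmap (@trunc_step K A n) (level n.+1) = level n }.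

Lemma ctens_eq (s t : ctens) : (forall n, s n = t n) -> s = t.
Proof.
case: s t => [s sP] [t tP] /= st.
have e : s = t by apply: functional_extensionality_dep.
by rewrite -e in tP *; congr CTens; apply: Prop_irrelevance.
Qed.

HB.instance Definition _ := gen_eqMixin ctens.
HB.instance Definition _ := gen_choiceMixin ctens.

Let step_tmap n := @tmap_linear K _ _ L _ (@trunc_step_linear K A n).

Let czeroP n : tmap (@trunc_step K A n) (0 : tens _ L) = 0 :> tens _ L.
Proof.
have := @step_tmap n (-1) 0 0.
by rewrite !scaleN1r !addNr.
Qed.
Let czero := @CTens (fun n => 0 : atens (trunc A n) L) czeroP.

Let step_tmapD n (x y : tens _ L) : tmap (@trunc_step K A n) (x + y) =
  tmap (@trunc_step K A n) x + tmap (@trunc_step K A n) y.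
Proof. by have := @step_tmap n 1 x y; rewrite !scale1r. Qed.

Let caddP (s t : ctens) n :
  tmap (@trunc_step K A n) (s n.+1 + t n.+1) = s n + t n.
Proof. by rewrite step_tmapD !level_step. Qed.
Let cadd (s t : ctens) :=
  @CTens (fun n => s n + t n : atens (trunc A n) L) (caddP s t).

Let coppP (s : ctens) n : tmap (@trunc_step K A n) (- s n.+1) = - s n.
Proof.
have := @step_tmap n (-1) (s n.+1) 0.
by rewrite !scaleN1r czeroP !addr0 level_step.
Qed.
Let copp (s : ctens) := @CTens (fun n => - s n : atens (trunc A n) L) (coppP s).

Let caddA : associative cadd.
Proof. by move=> r s t; apply: ctens_eq => n; apply: addrA. Qed.
Let caddC : commutative cadd.
Proof. by move=> s t; apply: ctens_eq => n; apply: addrC. Qed.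
Let cadd0 : left_id czero cadd.
Proof. by move=> s; apply: ctens_eq => n; apply: add0r. Qed.
Let caddN : left_inverse czero copp cadd.
Proof. by move=> s; apply: ctens_eq => n; apply: addNr. Qed.

HB.instance Definition _ := GRing.isZmodule.Build ctens caddA caddC cadd0 caddN.

Lemma tmap_scale (B B' : comAlgType K) (f : B -> B') (b : B) (t : atens B L) :
    linear f -> {morph f : x y / x * y} ->
  tmap f (b *: t) = f b *: (tmap f t : atens B' L).
Proof.
move=> fl fM; rewrite !ascale_tmap.
rewrite -[LHS]/((tmap _ \o tmap _) t) -[RHS]/((tmap _ \o tmap _) t).
have ml (D : comAlgType K) (d : D) : linear (fun x => d * x).
  by move=> k x y; rewrite mulrDr scalerAr.
rewrite -(tmap_comp fl (ml _ b)) -(tmap_comp (ml _ (f b)) fl).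
by apply: eq_tmap => x /=; apply: fM.
Qed.

Let cscaleP (a : A) (s : ctens) n :
  tmap (@trunc_step K A n) (tpi n.+1 a *: s n.+1) = tpi n a *: s n.
Proof.
rewrite (tmap_scale _ _ (@trunc_step_linear K A n) (@trunc_stepM K A n)).
by rewrite trunc_stepE level_step.
Qed.
Let cscale (a : A) (s : ctens) :=
  @CTens (fun n => tpi n a *: s n : atens (trunc A n) L) (cscaleP a s).

Let cscaleA a b s : cscale a (cscale b s) = cscale (a * b) s.
Proof. by apply: ctens_eq => n /=; rewrite scalerA rmorphM. Qed.
Let cscale1 : left_id 1 cscale.
Proof. by move=> s; apply: ctens_eq => n /=; rewrite rmorph1 scale1r. Qed.
Let cscaleDr : right_distributive cscale +%R.
Proof. by move=> a s t; apply: ctens_eq => n; apply: scalerDr. Qed.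
Let cscaleDl s : {morph cscale^~ s : a b / a + b}.
Proof. by move=> a b; apply: ctens_eq => n /=; rewrite raddfD /= scalerDl. Qed.

HB.instance Definition _ :=
  GRing.Zmodule_isLmodule.Build A ctens cscaleA cscale1 cscaleDr cscaleDl.

Let completeP (t : atens A L) n :
  tmap (@trunc_step K A n) (tmap (@tpi K A n.+1) t) = tmap (@tpi K A n) t.
Proof.
rewrite -[LHS]/((tmap _ \o tmap _) t) -tmap_comp.
- by apply: eq_tmap => a; apply: trunc_stepE.
- exact: trunc_step_linear.
- exact: tpi_linear.
Qed.

Definition complete (t : atens A L) : ctens :=
  @CTens (fun n => tmap (@tpi K A n) t) (completeP t).

Definition cpure (a : A) (l : L) : ctens := complete (apure a l).

End CompletedTensor.

(* The map phi (x) id on completed tensor products. *)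
Section CompletedMap.
Variables (K : fieldType) (A A' : augalg K) (f : aughom A A') (L : lmodType K).

Let cmapP (t : ctens A L) n :
  tmap (@trunc_step K A' n) (tmap (@trunc_map K A A' f n.+1) (t n.+1)) =
  tmap (@trunc_map K A A' f n) (t n).
Proof.
rewrite -(level_step t n) -[LHS]/((tmap _ \o tmap _) _).
rewrite -[RHS]/((tmap _ \o tmap _) _) -!tmap_comp;
  try by [exact: trunc_step_linear | exact: trunc_map_linear].
apply: eq_tmap; elim/tpi_ind => a /=.
by rewrite trunc_stepE !trunc_mapE trunc_stepE.
Qed.

Definition cmap (t : ctens A L) : ctens A' L :=
  @CTens K A' L (fun n => tmap (@trunc_map K A A' f n) (t n)) (cmapP t).

End CompletedMap.

(* epsilon (x) id, K (x) L being identified with L. *)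
Definition aug_tens (K : fieldType) (A : augalg K) (L : lmodType K)
  (t : atens A L) : L := tlift (fun (a : A) (l : L) => aug a *: l) t.

Definition aug_ctens (K : fieldType) (A : augalg K) (L : lmodType K)
  (t : ctens A L) : L := aug_tens (t 0).

Definition finite_dim (K : fieldType) (V : lmodType K) : Prop :=
  exists (d : nat) (e : 'I_d -> V),
    forall v, exists c : 'I_d -> K, v = \sum_i c i *: e i.

Definition is_base (K : fieldType) (A : augalg K) : Prop :=
  forall k, finite_dim (subquot (apow A k) (apow A k.+1)).

(* The first clause says that the augmentation ideal is the unique maximal
   ideal, the second that A -> lim A/M^n is bijective. *)
Definition complete_local (K : fieldType) (A : augalg K) : Prop :=
  (forall a : A, aug a != 0 -> exists b : A, a * b = 1) /\
  (forall x : forall n, trunc A n, (forall n, trunc_step (x n.+1) = x n) ->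
    exists! a : A, forall n, tpi n a = x n).

Section LinearMaps.
Variable K : fieldType.

Section Maps.
Variables U V : lmodType K.

Let lin0 : linear (0 : U -> V).
Proof. by move=> a u v; apply: esym; apply: etrans (addr0 _) (scaler0 _ _). Qed.
Let linP k (f g : U -> V) : linear f -> linear g -> linear (k *: f + g).
Proof.
move=> fl gl a u v.
change (k *: f (a *: u + v) + g (a *: u + v) =
        a *: (k *: f u + g u) + (k *: f v + g v)).
by rewrite fl gl !scalerDr !scalerA mulrC addrACA.
Qed.

Definition linear_maps : submod (U -> V) := Submod lin0 linP.

End Maps.

Definition dual (V : lmodType K) := subm (linear_maps V K^o).

HB.instance Definition _ V := GRing.Lmodule.on (dual V).

Definition dapp (V : lmodType K) (g : dual V) (v : V) : K := subm_val g v.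

Definition mkdual (V : lmodType K) (g : V -> K^o) (gl : linear g) : dual V :=
  @mksub _ _ (linear_maps V K^o) g gl.

Lemma dual_eq (V : lmodType K) (g h : dual V) : dapp g =1 dapp h -> g = h.
Proof. by move=> gh; apply: val_inj; apply: funext. Qed.

Let transpose_linear (U V : lmodType K) (w : {linear U -> V}) (psi : dual V) :
  linear (dapp psi \o w : U -> K^o).
Proof.
by move=> a u v; rewrite /= linearP; apply: (submP psi).
Qed.

Definition transpose (U V : lmodType K) (w : {linear U -> V}) (psi : dual V) :
  dual U := mkdual (transpose_linear w psi).

End LinearMaps.

Record is_leibniz (R : comPzRingType) (V : lmodType R) (br : V -> V -> V) :
    Prop := IsLeibniz {
  leibniz_linl : forall y, linear (br^~ y);
  leibniz_linr : forall x, linear (br x);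
  leibnizE : forall x y z, br x (br y z) = br (br x y) z - br (br x z) y }.

Record leibniz_algebra (K : fieldType) := LeibnizAlgebra {
  lsort :> lmodType K;
  lbr : lsort -> lsort -> lsort;
  lbrP : is_leibniz lbr }.

Arguments lbr {K _} x y.

Section Cohomology.
Variables (K : fieldType) (L : leibniz_algebra K).

Definition upd n (x : 'I_n -> L) (i : 'I_n) (v : L) : 'I_n -> L :=
  fun j => if j == i then v else x j.

Definition multilinear (V : lmodType K) n (f : ('I_n -> L) -> V) : Prop :=
  forall (i : 'I_n) (x : 'I_n -> L), linear (fun v => f (upd x i v)).

(* x with its j-th entry omitted and its i-th entry replaced by [x_i, x_j]. *)
Definition contract n (x : 'I_n.+1 -> L) (i j : 'I_n.+1) : 'I_n -> L :=
  fun k => if fintype.lift j k == i then lbr (x i) (x j)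
           else x (fintype.lift j k).

(* The entries of x are numbered from 0, whence the shift by one of the
   exponents of the signs. *)
Definition delta n (f : ('I_n -> L) -> L) : ('I_n.+1 -> L) -> L := fun x =>
  lbr (x ord0) (f (fun k => x (fintype.lift ord0 k)))
  + \sum_(i < n.+1 | (0 < i)%N)
      (-1) ^+ i.+1 *: lbr (f (fun k => x (fintype.lift i k))) (x i)
  + \sum_(i < n.+1) \sum_(j < n.+1 | (i < j)%N)
      (-1) ^+ j *: f (contract x i j).

Lemma delta_linear n a (f g : ('I_n -> L) -> L) :
  delta (a *: f + g) = a *: delta f + delta g.
Proof.
apply: funext => x.
transitivity (a *: delta f x + delta g x); last by [].
have E y : (a *: f + g) y = a *: f y + g y by [].
rewrite /delta !scalerDr E (leibniz_linr (lbrP L)).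
rewrite [RHS]addrACA [X in _ = X + _]addrACA; congr (_ + _ + _).
  rewrite scaler_sumr -big_split /=; apply: eq_bigr => i _.
  by rewrite E (leibniz_linl (lbrP L)) scalerDr !scalerA mulrC.
rewrite scaler_sumr -big_split /=; apply: eq_bigr => i _.
rewrite scaler_sumr -big_split /=; apply: eq_bigr => j _.
by rewrite E scalerDr !scalerA mulrC.
Qed.

Let multilinear0 (V : lmodType K) n : multilinear (0 : ('I_n -> L) -> V).
Proof.
by move=> i x a u v; apply: esym; apply: etrans (addr0 _) (scaler0 _ _).
Qed.
Let multilinearP (V : lmodType K) n a (f g : ('I_n -> L) -> V) :
  multilinear f -> multilinear g -> multilinear (a *: f + g).
Proof.
move=> fm gm i x.
exact: (smemP (s := linear_maps _ _) a (fm i x) (gm i x)).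
Qed.

Definition cochains (V : lmodType K) n : submod (('I_n -> L) -> V) :=
  Submod (@multilinear0 V n) (@multilinearP V n).

Let cocycle n (f : ('I_n -> L) -> L) := cochains L n f /\ delta f = 0.

Let delta0 n : delta (0 : ('I_n -> L) -> L) = 0.
Proof.
have := @delta_linear n (-1) 0 0.
by rewrite !scaleN1r !addNr.
Qed.
Let cocycle0 n : @cocycle n 0.
Proof. by split; [apply: smem0 | apply: delta0]. Qed.
Let cocycleP n a (f g : ('I_n -> L) -> L) :
  cocycle f -> cocycle g -> cocycle (a *: f + g).
Proof.
move=> [fm f0] [gm g0]; split; first exact: smemP.
by rewrite delta_linear f0 g0 scaler0 addr0.
Qed.

Definition cocycles n : submod (('I_n -> L) -> L) :=
  Submod (@cocycle0 n) (@cocycleP n).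

Let coboundary n : (('I_n -> L) -> L) -> Prop :=
  if n is m.+1 then fun f => exists2 g, cochains L m g & f = delta g
  else fun f => f = 0.

Let coboundary0 n : @coboundary n 0.
Proof. by case: n => [//|n]; exists 0; [apply: smem0 | rewrite delta0]. Qed.
Let coboundaryP n a (f g : ('I_n -> L) -> L) :
  coboundary f -> coboundary g -> coboundary (a *: f + g).
Proof.
case: n f g => [|n] f g; first by move=> -> ->; rewrite scaler0 addr0.
move=> [f' fm ->] [g' gm ->]; exists (a *: f' + g'); first exact: smemP.
by rewrite delta_linear.
Qed.

Definition coboundaries n : submod (('I_n -> L) -> L) :=
  Submod (@coboundary0 n) (@coboundaryP n).

Definition HL n := subquot (cocycles n) (coboundaries n).

HB.instance Definition _ n := GRing.Lmodule.on (HL n).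

Definition HLclass n (z : subm (cocycles n)) : HL n := subpi _ z.

End Cohomology.

(* An A-module M with MM = 0, MM the augmentation ideal, is a K-vector space M
   on which A acts through the augmentation. *)
Section Harrison.
Variables (K : fieldType) (A : augalg K) (M : lmodType K).

Record is_harr_cocycle (f : A -> A -> M) : Prop := IsHarrCocycle {
  harr_lin : forall b, linear (f^~ b);
  harr_sym : forall a b, f a b = f b a;
  harrE : forall a b c,
    aug a *: f b c - f (a * b) c + f a (b * c) - aug c *: f a b = 0 }.

Let harr_cocycle0 : is_harr_cocycle 0.
Proof.
split=> //.
- by move=> b a u v; apply: esym; apply: etrans (addr0 _) (scaler0 _ _).
- move=> a b c; change (aug a *: (0 : M) - 0 + 0 - aug c *: (0 : M) = 0).
  by rewrite !scaler0 !subr0 addr0.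
Qed.
Let harr_cocycleP k (f g : A -> A -> M) :
  is_harr_cocycle f -> is_harr_cocycle g -> is_harr_cocycle (k *: f + g).
Proof.
move=> [fl fs fc] [gl gs gc]; split.
- by move=> b; apply: (smemP (s := linear_maps _ _) k (fl b) (gl b)).
- move=> a b; change (k *: f a b + g a b = k *: f b a + g b a).
  by rewrite fs gs.
- move=> a b c.
  change (aug a *: (k *: f b c + g b c) - (k *: f (a * b) c + g (a * b) c)
    + (k *: f a (b * c) + g a (b * c)) - aug c *: (k *: f a b + g a b) = 0).
  transitivity (k *: (aug a *: f b c - f (a * b) c + f a (b * c) - aug c *: f a b)
    + (aug a *: g b c - g (a * b) c + g a (b * c) - aug c *: g a b)).
    rewrite !scalerDr !scalerN !scalerA [aug a * k]mulrC [aug c * k]mulrC !opprD.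
    by rewrite [RHS]addrACA [X in _ = X + _]addrACA [X in _ = X + _ + _]addrACA.
  by rewrite fc gc scaler0 addr0.
Qed.

Definition harr_cocycles : submod (A -> A -> M) :=
  Submod harr_cocycle0 harr_cocycleP.

Let harr_coboundary (f : A -> A -> M) := exists2 g : A -> M, linear g &
  forall a b, f a b = aug a *: g b - g (a * b) + aug b *: g a.

Let harr_coboundary0 : harr_coboundary 0.
Proof.
exists 0; first exact: (smem0 (linear_maps A M)).
move=> a b; change (0 = aug a *: (0 : M) - 0 + aug b *: (0 : M)).
by rewrite !scaler0 subr0 addr0.
Qed.
Let harr_coboundaryP k (f g : A -> A -> M) :
  harr_coboundary f -> harr_coboundary g -> harr_coboundary (k *: f + g).
Proof.
move=> [f' fl fE] [g' gl gE]; exists (k *: f' + g').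
  exact: (smemP (s := linear_maps _ _) k fl gl).
move=> a b; change (k *: f a b + g a b = aug a *: (k *: f' b + g' b)
  - (k *: f' (a * b) + g' (a * b)) + aug b *: (k *: f' a + g' a)).
rewrite fE gE !scalerDr !scalerN !scalerA [aug a * k]mulrC [aug b * k]mulrC.
by rewrite opprD [LHS]addrACA [X in X + _ = _]addrACA.
Qed.

Definition harr_coboundaries : submod (A -> A -> M) :=
  Submod harr_coboundary0 harr_coboundaryP.

Definition harrH2 := subquot harr_cocycles harr_coboundaries.

HB.instance Definition _ := GRing.Lmodule.on harrH2.

Definition harr_class (z : subm harr_cocycles) : harrH2 := subpi _ z.

End Harrison.

Section Extension.
Variables (K : fieldType) (A : augalg K) (M : lmodType K).
Variable f : subm (harr_cocycles A M).

Definition ext_alg : Type := (A * M)%type.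

HB.instance Definition _ := GRing.Lmodule.copy ext_alg (A * M)%type.

Let F : A -> A -> M := subm_val f.

Definition ext_mul (u v : ext_alg) : ext_alg :=
  (u.1 * v.1, aug u.1 *: v.2 + aug v.1 *: u.2 + F u.1 v.1).

(* The unit of the extension; a cocycle need not be normalised. *)
Definition ext_one : ext_alg := (1, - F 1 1).

Let FP : is_harr_cocycle F := submP f.

Let F1 a : F 1 a = aug a *: F 1 1.
Proof.
have := harrE FP 1 1 a.
by rewrite rmorph1 scale1r !mul1r subrr add0r => /eqP; rewrite subr_eq0 => /eqP.
Qed.

Let FDl a b c : F (a + b) c = F a c + F b c.
Proof. by have := harr_lin FP c 1 a b; rewrite !scale1r. Qed.

Let FZl k a b : F (k *: a) b = k *: F a b.
Proof.
have F0 : F 0 b = 0 by have := harr_lin FP b (-1) 0 0; rewrite !scaleN1r !addNr.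
by have := harr_lin FP b k a 0; rewrite F0 !addr0.
Qed.

Let ext_mulC : commutative ext_mul.
Proof.
move=> [a x] [b y]; rewrite /ext_mul /= mulrC (harr_sym FP).
by rewrite [_ *: y + _]addrC.
Qed.
Let ext_mul1 : left_id ext_one ext_mul.
Proof.
move=> [a x]; rewrite /ext_mul /= mul1r rmorph1 scale1r (F1 a) scalerN.
by rewrite subrK.
Qed.
Let ext_mulA : associative ext_mul.
Proof.
move=> [a x] [b y] [c z]; rewrite /ext_mul /= mulrA; congr (_, _).
have key : aug a *: F b c + F a (b * c) = aug c *: F a b + F (a * b) c.
  apply/eqP; rewrite -subr_eq0 -(harrE FP a b c) opprD addrA.
  by rewrite [X in _ == X - _]addrAC [X in _ == X]addrAC.
rewrite !rmorphM !scalerDr !scalerA (addrAC _ (aug a *: F b c)) -[LHS]addrA key.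
by rewrite !addrA [aug c * aug a]mulrC [aug c * aug b]mulrC.
Qed.
Let ext_mulDl : left_distributive ext_mul +%R.
Proof.
move=> [a x] [b y] [c z]; rewrite /ext_mul; congr (_, _) => /=.
  by rewrite mulrDl.
rewrite raddfD scalerDl scalerDr FDl.
by rewrite [RHS]addrACA [X in _ = X + _]addrACA.
Qed.
Let ext_one_neq0 : ext_one != 0.
Proof.
by apply/eqP=> -[] /eqP; rewrite oner_eq0.
Qed.

HB.instance Definition _ := GRing.Zmodule_isComNzRing.Build ext_alg
  ext_mulA ext_mulC ext_mul1 ext_mulDl ext_one_neq0.

Let ext_scaleAl (k : K) (u v : ext_alg) : k *: (u * v) = (k *: u) * v.
Proof.
case: u v => [a x] [b y].
change ((k *: (a * b), k *: (aug a *: y + aug b *: x + F a b)) =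
  ((k *: a) * b, aug (k *: a) *: y + aug b *: (k *: x) + F (k *: a) b)).
by rewrite scalerAl augZ FZl !scalerDr !scalerA [aug b * k]mulrC.
Qed.

HB.instance Definition _ := GRing.Lmodule_isLalgebra.Build K ext_alg ext_scaleAl.
HB.instance Definition _ := GRing.Lalgebra_isComAlgebra.Build K ext_alg.

Definition ext_aug (u : ext_alg) : K := aug u.1.

Let ext_augB : {morph ext_aug : u v / u - v}.
Proof. by move=> u v; rewrite /ext_aug raddfB. Qed.
Let ext_aug_monoid : monoid_morphism ext_aug.
Proof. by split=> [|u v]; rewrite /ext_aug /= ?rmorph1 ?rmorphM. Qed.

HB.instance Definition _ := GRing.isZmodMorphism.Build ext_alg K ext_aug ext_augB.
HB.instance Definition _ :=
  GRing.isMonoidMorphism.Build ext_alg K ext_aug ext_aug_monoid.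

Let ext_augZ k u : ext_aug (k *: u) = k * ext_aug u.
Proof. exact: augZ. Qed.

Definition ext : augalg K := @AugAlg K ext_alg ext_aug ext_augZ.

Definition ext_incl (m : M) : ext := (0, m).
Definition ext_proj (u : ext) : A := u.1.

End Extension.

Section Deformations.
Variables (K : fieldType) (L : leibniz_algebra K).

Definition bracket (A : augalg K) := atens A L -> atens A L -> atens A L.

Definition is_deformation (A : augalg K) (lam : bracket A) : Prop :=
  is_leibniz lam /\
  forall x y, aug_tens (lam x y) = lbr (aug_tens x) (aug_tens y).

Definition is_pushout (A A' : augalg K) (phi : aughom A A')
    (lam : bracket A) (lam' : bracket A') : Prop :=
  forall l1 l2 : L,
    lam' (apure 1 l1) (apure 1 l2) = tmap phi (lam (apure 1 l1) (apure 1 l2)).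

Definition cbracket (A : augalg K) := ctens A L -> ctens A L -> ctens A L.

Definition is_formal_deformation (A : augalg K) (lam : cbracket A) : Prop :=
  [/\ is_leibniz lam,
      exists lamn : forall n, bracket (trunc A n),
        (forall n, is_deformation (lamn n)) /\
        (forall x y n, lam x y n = lamn n (x n) (y n))
    & forall x y, aug_ctens (lam x y) = lbr (aug_ctens x) (aug_ctens y)].

Definition formal_equiv (A : augalg K) (lam1 lam2 : cbracket A) : Prop :=
  exists rho : ctens A L -> ctens A L,
    [/\ linear rho, bijective rho,
        forall x y, rho (lam1 x y) = lam2 (rho x) (rho y)
      & forall x, aug_ctens (rho x) = aug_ctens x].

Definition is_formal_pushout (A A' : augalg K) (phi : aughom A A')
    (lam : cbracket A) (lam' : cbracket A') : Prop :=
  is_formal_deformation lam' /\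
  forall l1 l2 : L,
    lam' (cpure 1 l1) (cpure 1 l2) =
    cmap phi (lam (cpure 1 l1) (cpure 1 l2)).

End Deformations.

Section Obstruction.
Variables (K : fieldType) (L : leibniz_algebra K).
Variables (A : augalg K) (lam : bracket L A).
Variables (M : lmodType K) (f : subm (harr_cocycles A M)).

(* [m (x) l, l'] = m (x) [l, l']. *)
Definition tens_act (t : tens M L) (l' : L) : tens M L :=
  tlift (fun m l => pure m (lbr l l')) t.

Definition is_lifting (op : bracket L (ext f)) : Prop :=
  [/\ forall y, linear (op^~ y),
      forall x, linear (op x),
      forall x y, tmap (@ext_proj _ _ _ f) (op x y) =
        lam (tmap (@ext_proj _ _ _ f) x) (tmap (@ext_proj _ _ _ f) y)
    & forall (x : tens M L) y,
        op (tmap (ext_incl f) x) y = tmap (ext_incl f) (tens_act x (aug_tens y))].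

(* phib is a cocycle whose class is the obstruction theta_lam([f]). *)
Definition is_obstruction (phib : ('I_3 -> L) -> tens M L) : Prop :=
  cochains L (tens M L) 3 phib /\
  exists2 op, is_lifting op &
    forall l : 'I_3 -> L,
      let x i : atens (ext f) L := apure 1 (l i) in
      op (x 0) (op (x 1) (x 2)) - op (op (x 0) (x 1)) (x 2)
        + op (op (x 0) (x 2)) (x 1)
      = tmap (ext_incl f) (phib l).

End Obstruction.

Section ProjectiveLimit.
Variables (K : fieldType) (C : nat -> augalg K).
Variable p : forall k, aughom (C k.+1) (C k).

Record plim_alg := PLim {
  coord :> forall k, C k;
  coord_step : forall k, p k (coord k.+1) = coord k }.

Lemma plim_eq (x y : plim_alg) : (forall k, x k = y k) -> x = y.
Proof.
case: x y => [x xP] [y yP] /= xy.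
have e : x = y by apply: functional_extensionality_dep.
by rewrite -e in yP *; congr PLim; apply: Prop_irrelevance.
Qed.

HB.instance Definition _ := gen_eqMixin plim_alg.
HB.instance Definition _ := gen_choiceMixin plim_alg.

Let pl0P k : p k (0 : C k.+1) = 0.
Proof. exact: rmorph0. Qed.
Let pl1P k : p k (1 : C k.+1) = 1.
Proof. exact: rmorph1. Qed.
Let plNP (x : plim_alg) k : p k (- x k.+1) = - x k.
Proof. by rewrite rmorphN -[in RHS]coord_step. Qed.
Let plDP (x y : plim_alg) k : p k (x k.+1 + y k.+1) = x k + y k.
Proof. by rewrite rmorphD -[x k]coord_step -[y k]coord_step. Qed.
Let plMP (x y : plim_alg) k : p k (x k.+1 * y k.+1) = x k * y k.
Proof. by rewrite rmorphM -[x k]coord_step -[y k]coord_step. Qed.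
Let plZP a (x : plim_alg) k : p k (a *: x k.+1) = a *: x k.
Proof. by rewrite linearZ /= -[in RHS]coord_step. Qed.

Let pl0 := PLim pl0P.
Let pl1 := PLim pl1P.
Let plN x := PLim (plNP x).
Let plD x y := PLim (plDP x y).
Let plM x y := PLim (plMP x y).
Let plZ a x := PLim (plZP a x).

Let plDA : associative plD.
Proof. by move=> x y z; apply: plim_eq => k; apply: addrA. Qed.
Let plDC : commutative plD.
Proof. by move=> x y; apply: plim_eq => k; apply: addrC. Qed.
Let plD0 : left_id pl0 plD.
Proof. by move=> x; apply: plim_eq => k; apply: add0r. Qed.
Let plDN : left_inverse pl0 plN plD.
Proof. by move=> x; apply: plim_eq => k; apply: addNr. Qed.

HB.instance Definition _ := GRing.isZmodule.Build plim_alg plDA plDC plD0 plDN.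

Let plMA : associative plM.
Proof. by move=> x y z; apply: plim_eq => k; apply: mulrA. Qed.
Let plMC : commutative plM.
Proof. by move=> x y; apply: plim_eq => k; apply: mulrC. Qed.
Let plM1 : left_id pl1 plM.
Proof. by move=> x; apply: plim_eq => k; apply: mul1r. Qed.
Let plMDl : left_distributive plM +%R.
Proof. by move=> x y z; apply: plim_eq => k; apply: mulrDl. Qed.
Let pl1_neq0 : pl1 != 0.
Proof.
apply/eqP=> /(congr1 (fun x : plim_alg => x 0%N)) /= /eqP.
by rewrite oner_eq0.
Qed.

HB.instance Definition _ :=
  GRing.Zmodule_isComNzRing.Build plim_alg plMA plMC plM1 plMDl pl1_neq0.

Let plZA a b x : plZ a (plZ b x) = plZ (a * b) x.
Proof. by apply: plim_eq => k; apply: scalerA. Qed.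
Let plZ1 : left_id 1 plZ.
Proof. by move=> x; apply: plim_eq => k; apply: scale1r. Qed.
Let plZDr : right_distributive plZ +%R.
Proof. by move=> a x y; apply: plim_eq => k; apply: scalerDr. Qed.
Let plZDl x : {morph plZ^~ x : a b / a + b}.
Proof. by move=> a b; apply: plim_eq => k; apply: scalerDl. Qed.

HB.instance Definition _ :=
  GRing.Zmodule_isLmodule.Build K plim_alg plZA plZ1 plZDr plZDl.

Let plZAl (a : K) (x y : plim_alg) : a *: (x * y) = (a *: x) * y.
Proof. by apply: plim_eq => k; apply: scalerAl. Qed.

HB.instance Definition _ := GRing.Lmodule_isLalgebra.Build K plim_alg plZAl.
HB.instance Definition _ := GRing.Lalgebra_isComAlgebra.Build K plim_alg.

Definition plim_aug (x : plim_alg) : K := aug (x 0%N).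

Let plim_augB : {morph plim_aug : x y / x - y}.
Proof. by move=> x y; apply: rmorphB. Qed.
Let plim_aug_monoid : monoid_morphism plim_aug.
Proof. by split=> [|x y]; [apply: rmorph1 | apply: rmorphM]. Qed.

HB.instance Definition _ :=
  GRing.isZmodMorphism.Build plim_alg K plim_aug plim_augB.
HB.instance Definition _ :=
  GRing.isMonoidMorphism.Build plim_alg K plim_aug plim_aug_monoid.

Let plim_augZ a x : plim_aug (a *: x) = a * plim_aug x.
Proof. exact: augZ. Qed.

Definition plim : augalg K := @AugAlg K plim_alg plim_aug plim_augZ.

Let proj k (x : plim) : C k := coord x k.

Let proj_linear k : linear (@proj k).
Proof. by []. Qed.
Let proj_monoid k : monoid_morphism (@proj k).
Proof. by []. Qed.

HB.instance Definition _ k :=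
  GRing.isLinear.Build K plim (C k) _ (@proj k) (@proj_linear k).
HB.instance Definition _ k :=
  GRing.isMonoidMorphism.Build plim (C k) (@proj k) (@proj_monoid k).

Let proj_aug k (x : plim) : aug (proj k x) = aug x.
Proof.
elim: k => [//|k IHk]; rewrite -IHk /proj -[in RHS]coord_step.
by rewrite ahom_aug.
Qed.

Definition plim_proj k : aughom plim (C k) := AugHom (@proj_aug k).

End ProjectiveLimit.

Section Construction.
Variables (K : fieldType) (L : leibniz_algebra K).

Let base_augZ (k a : K^o) : idfun (k *: a) = k * idfun a.
Proof. by []. Qed.

Definition triv : augalg K := @AugAlg K K^o idfun base_augZ.

Definition dual_bases (V : lmodType K) d (h : 'I_d -> V) (g : 'I_d -> dual V) :
    Prop :=
  (forall v, v = \sum_i dapp (g i) v *: h i) /\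
  (forall i j, dapp (g i) (h j) = (i == j)%:R).

(* C_1 = K + H' with H = HL^2(L; L): the extension of K with zero cocycle. *)
Definition first_base : augalg K :=
  ext (0 : subm (harr_cocycles triv (dual (HL L 2)))).

(* (C, eta) is (C_1, eta_1), up to an isomorphism of bases iota. *)
Definition is_first_stage (C : augalg K) (eta : bracket L C) : Prop :=
  exists d (h : 'I_d -> HL L 2) (g : 'I_d -> dual (HL L 2))
         (mu : {linear HL L 2 -> subm (cocycles L 2)})
         (iota : aughom first_base C),
    [/\ dual_bases h g,
        forall x, HLclass (mu x) = x,
        bijective iota,
        is_deformation eta
      & forall l1 l2 : L,
          eta (apure 1 l1) (apure 1 l2) =
          apure 1 (lbr l1 l2)
          + \sum_i apure (iota (ext_incl _ (g i)))
                     (subm_val (mu (h i)) (tnth [tuple l1; l2]))].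

Section DualCocycle.
Variables (A : augalg K).
Variable sigma : {linear harrH2 A K^o -> subm (harr_cocycles A K^o)}.

Let dual_harr_linear a b :
  linear (fun h : harrH2 A K^o => subm_val (sigma h) a b : K^o).
Proof. by move=> k x y; rewrite linearP. Qed.

Let dual_harr_fun (a b : A) : dual (harrH2 A K^o) :=
  mkdual (dual_harr_linear a b).

Let dual_harrP : is_harr_cocycle dual_harr_fun.
Proof.
split.
- move=> b k x y; apply: dual_eq => h.
  exact: (harr_lin (submP (sigma h)) b k x y).
- by move=> a b; apply: dual_eq => h; apply: (harr_sym (submP (sigma h)) a b).
- move=> a b c; apply: dual_eq => h.
  exact: (harrE (submP (sigma h)) a b c).
Qed.

(* The cocycle f_A with values in H^2_Harr(A; K)' dual to the choice sigma of
   representing cocycles. *)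
Definition dual_harr : subm (harr_cocycles A (dual (harrH2 A K^o))) :=
  @mksub _ _ (harr_cocycles A (dual (harrH2 A K^o))) dual_harr_fun dual_harrP.

End DualCocycle.

(* (A', eta') is obtained from (A, eta), p : A' -> A being the projection, by
   one step of the construction.  The obstruction, in H^2_Harr(A; K)' (x) HL^3,
   is viewed as the map omega sending h to the class of (ev_h (x) id) o phib;
   pi exhibits A' as the quotient of the extension by i(omega'(HL^3(L; L)')). *)
Definition is_next_stage (A : augalg K) (eta : bracket L A) (A' : augalg K)
    (p : aughom A' A) (eta' : bracket L A') : Prop :=
  exists (sigma : {linear harrH2 A K^o -> subm (harr_cocycles A K^o)})
         (phib : ('I_3 -> L) -> tens (dual (harrH2 A K^o)) L)
         (omega : {linear harrH2 A K^o -> HL L 3})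
         (pi : aughom (ext (dual_harr sigma)) A'),
    [/\ forall h, harr_class (sigma h) = h,
        is_obstruction eta (dual_harr sigma) phib,
        forall h, exists2 z : subm (cocycles L 3),
          subm_val z = (fun l => tlift (fun m x => dapp m h *: x) (phib l))
          & omega h = HLclass z,
        [/\ forall a', exists b, pi b = a',
            forall b, pi b = 0 <->
              exists psi : dual (HL L 3),
                b = ext_incl (dual_harr sigma) (transpose omega psi)
          & forall b, p (pi b) = ext_proj b]
      & is_deformation eta' /\ is_pushout p eta' eta].

(* The sequence C_1 <- C_2 <- ... with the deformations eta_k; the index k
   stands for k + 1 (the term C_0 = K does not affect the limit). *)
Definition is_construction (C : nat -> augalg K)
    (p : forall k, aughom (C k.+1) (C k)) (eta : forall k, bracket L (C k)) :
    Prop :=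
  is_first_stage (eta 0%N) /\
  forall k, is_next_stage (eta k) (p k) (eta k.+1).

Definition is_limit_deformation (C : nat -> augalg K)
    (p : forall k, aughom (C k.+1) (C k)) (etak : forall k, bracket L (C k))
    (eta : cbracket L (plim p)) : Prop :=
  is_formal_deformation eta /\
  forall k (l1 l2 : L),
    cmap (plim_proj p k) (eta (cpure 1 l1) (cpure 1 l2)) =
    complete (etak k (apure 1 l1) (apure 1 l2)).

Definition induces (C A : augalg K) (eta : cbracket L C) (lam : cbracket L A)
    (f : aughom C A) : Prop :=
  exists lam' : cbracket L A,
    is_formal_pushout f eta lam' /\ formal_equiv lam lam'.

Definition versal (C : augalg K) (eta : cbracket L C) : Prop :=
  forall (A : augalg K) (lam : cbracket L A),
    is_base A -> complete_local A -> is_formal_deformation lam ->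
    (exists f : aughom C A, induces eta lam f) /\
    ((forall a : A, apow A 2 a -> a = 0) ->
      forall f g : aughom C A, induces eta lam f -> induces eta lam g -> f =1 g).

End Construction.

(* Main.v *)
(** The homomorphism from C to A is built through the quotients A/M^(n+1).  Given
    C_k -> A/M^(k+1) carrying eta_k to lambda up to equivalence, a linear lift
    to A/M^(k+2) fails to be multiplicative by a Harrison cocycle.  After a
    correction by a cochain, this cocycle is a combination of the chosen
    representatives, and the lift extends to a homomorphism on the universal
    extension of C_k.  Since lambda exists over A/M^(k+2), comparing Jacobiators
    shows that the classes involved lie in the kernel of the obstruction map, so
    that the homomorphism factors through C_(k+1).  It then differs from lambda
    by a 2-cocycle with values in M^(k+1)/M^(k+2), whose class is removed by
    adding to the homomorphism a derivation through C_1 = K + H'.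

    For uniqueness, the difference of two homomorphisms to A with M^2 = 0 kills
    the square of the augmentation ideal of C.  The kernel of C -> C_1 lies in
    that square: for each C_k because a functional on the universal extension
    that vanishes on the square splits its own class, and in the limit by a
    Mittag-Leffler argument in finite-dimensional spaces.  Hence the difference
    is a derivation through H', and equivalence of the two push-outs says that
    the class in HL^2 it defines is zero. *)

From HB Require Import structures.
Require Import Defs.
From mathcomp Require Import all_boot all_algebra.
From mathcomp Require Import boolp functions ring.

Set Implicit Arguments.
Unset Strict Implicit.
Unset Printing Implicit Defensive.

Import GRing.Theory.
Local Open Scope ring_scope.

(** * Linear maps and tensor products *)

(** An equivalence of formal deformations is a map between limits, so at each level both the
    homomorphism and the equivalence must lift the previous ones exactly. This is why the inductive
    step first lifts the equivalence and transports lambda along it, before a homomorphism is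
    sought. Such a lift exists because A (x) L is free over A on the elements 1 (x) l, and it is
    bijective because it acts as the identity on the kernel.

    The kernels M^(k+1)/M^(k+2) may have any finite dimension, hence bases n_i with coordinate
    functionals chi_i: a cocycle with values in the kernel becomes a finite family of cocycles with
    values in K or L, to which the universal extension and HL^2 are applied one i at a time.

    For uniqueness the obstacle is that the number of products needed to write each coordinate in
    the square of the ideal of C_k could grow with k. Lifts t_i of a basis of H' supply a number of
    generators independent of k; it then remains to choose their coefficients coherently, which is
    where finite dimension of the C_k enters. *)

Section LinearMaps.
Variables (R : pzRingType) (U V : lmodType R) (f : U -> V).
Hypothesis fl : linear f.

Let F : {linear U -> V} := HB.pack f (GRing.isLinear.Build _ _ _ _ f fl).

Lemma lin0 : f 0 = 0. Proof. exact: (linear0 F). Qed.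
Lemma linD x y : f (x + y) = f x + f y. Proof. exact: (linearD F). Qed.
Lemma linN x : f (- x) = - f x. Proof. exact: (linearN F). Qed.
Lemma linB x y : f (x - y) = f x - f y. Proof. exact: (linearB F). Qed.
Lemma linZ a x : f (a *: x) = a *: f x. Proof. by rewrite -[LHS]/(F _) linearZ. Qed.
Lemma lin_sum I (r : seq I) (P : pred I) (E : I -> U) :
  f (\sum_(i <- r | P i) E i) = \sum_(i <- r | P i) f (E i).
Proof. exact: (linear_sum F). Qed.

End LinearMaps.

Section LinearCombination.
Variables (R : pzRingType) (U V : lmodType R).

Lemma linear_add (f g : U -> V) :
  linear f -> linear g -> linear (fun x => f x + g x).
Proof. by move=> fl gl a x y; rewrite fl gl scalerDr addrACA. Qed.

Lemma linear_opp (f : U -> V) : linear f -> linear (fun x => - f x).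
Proof. by move=> fl a x y; rewrite fl opprD scalerN. Qed.

Lemma linear_sub (f g : U -> V) :
  linear f -> linear g -> linear (fun x => f x - g x).
Proof. by move=> fl gl; apply: linear_add => //; apply: linear_opp. Qed.

Lemma linear_bigsum I (r : seq I) (P : pred I) (f : I -> U -> V) :
  (forall i, linear (f i)) -> linear (fun x => \sum_(i <- r | P i) f i x).
Proof.
move=> fl a x y; rewrite scaler_sumr -big_split /=.
by apply: eq_bigr => i _; apply: fl.
Qed.

End LinearCombination.

Lemma linear_scalel (R : pzRingType) (U V : lmodType R) (g : U -> R^o) (v : V) :
  linear g -> linear (fun x => (g x : R) *: v).
Proof. by move=> gl a x y; rewrite gl scalerDl scalerA. Qed.

Lemma ahom_linear (K : fieldType) (A A' : augalg K) (f : aughom A A') : linear f.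
Proof. exact: linearP. Qed.

Lemma ahomM (K : fieldType) (A A' : augalg K) (f : aughom A A') :
  {morph f : x y / x * y}.
Proof. exact: rmorphM. Qed.

Lemma ahomB (K : fieldType) (A A' : augalg K) (f : aughom A A') :
  {morph f : x y / x - y}.
Proof. exact: rmorphB. Qed.

Lemma ahom1 (K : fieldType) (A A' : augalg K) (f : aughom A A') : f 1 = 1.
Proof. exact: rmorph1. Qed.

Lemma aug_linear (K : fieldType) (A : augalg K) : linear (aug : A -> K^o).
Proof. by move=> k x y; rewrite rmorphD augZ. Qed.

Section MakeHom.
Variables (K : fieldType) (A A' : augalg K) (f : A -> A').
Hypotheses (fl : linear f) (f1 : f 1 = 1) (fM : {morph f : x y / x * y}).
Hypothesis (fa : forall x, aug (f x) = aug x).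

Definition mkahom : aughom A A' := @AugHom K A A'
  (HB.pack f (GRing.isLinear.Build _ _ _ _ f fl)
    (GRing.isMonoidMorphism.Build _ _ f (conj f1 fM))) fa.

Lemma mkahomE x : mkahom x = f x. Proof. by []. Qed.

End MakeHom.

Section HomComp.
Variables (K : fieldType) (A A' A'' : augalg K).
Variables (g : aughom A' A'') (f : aughom A A').

Lemma ahom_comp_aug x : aug ((g \o f) x) = aug x.
Proof. by rewrite /= !ahom_aug. Qed.

Definition ahom_comp : aughom A A'' := @AugHom K A A'' (g \o f) ahom_comp_aug.

End HomComp.

Section Pure.
Variables (K : fieldType) (M L : lmodType K).

Lemma pure_linl (l : L) : linear (fun m : M => pure m l).
Proof. by have [+ _] := pure_bilinear M L; apply. Qed.
Lemma pure_linr (m : M) : linear (fun l : L => pure m l).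
Proof. by have [_ +] := pure_bilinear M L; apply. Qed.

Lemma pure0l (l : L) : pure (0 : M) l = 0. Proof. exact: lin0 (pure_linl l). Qed.
Lemma pure0r (m : M) : pure m (0 : L) = 0. Proof. exact: lin0 (pure_linr m). Qed.
Lemma pureZ k (m : M) (l : L) : pure (k *: m) l = pure m (k *: l).
Proof. by rewrite (linZ (pure_linl l)) (linZ (pure_linr m)). Qed.

(** This is chi (x) id with K (x) L identified with L; for a coordinate functional [chi] it reads
    off a coefficient in [L]. *)
Definition contr (chi : M -> K^o) (t : tens M L) : L := tlift (fun m l => (chi m :
  K) *: l) t.

Variables (chi : M -> K^o) (chil : linear chi).

Lemma contr_bilinear : bilinear2 (fun (m : M) (l : L) => (chi m : K) *: l).
Proof.
split=> [l|m]; first exact: linear_scalel.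
by move=> a x y; rewrite scalerDr !scalerA mulrC.
Qed.

Lemma contr_pure m l : contr chi (pure m l) = (chi m : K) *: l.
Proof. exact: tliftE contr_bilinear. Qed.

Lemma contr_linear : linear (contr chi).
Proof. exact: tlift_linear contr_bilinear. Qed.

End Pure.

Lemma contr_tmap (K : fieldType) (M N L : lmodType K) (chi : N -> K^o) (f : M -> N)
    (t : tens M L) :
  linear chi -> linear f -> contr chi (tmap f t) = contr (chi \o f) t.
Proof.
move=> chil fl; have fchil : linear (chi \o f) := linear_comp chil fl.
elim/tens_ind: t => [m l|a x y IHx IHy].
  by rewrite tmapE // !contr_pure.
by rewrite tmap_linear // !contr_linear // IHx IHy.
Qed.

Lemma tmap_add (K : fieldType) (M N L : lmodType K) (f g : M -> N) (t : tens M L) :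
  linear f -> linear g -> tmap (fun m => f m + g m) t = tmap f t + tmap g t.
Proof.
move=> fl gl; have fgl := linear_add fl gl.
elim/tens_ind: t => [m l|a x y IHx IHy].
  by rewrite !tmapE // (linD (pure_linl l)).
by rewrite !tmap_linear // IHx IHy scalerDr addrACA.
Qed.

Lemma tmap_id (K : fieldType) (M L : lmodType K) (f : M -> M) (t : tens M L) :
  f =1 id -> tmap f t = t.
Proof.
move=> /eq_tmap ->.
elim/tens_ind: t => [m l|a x y IHx IHy]; first exact: tmapE.
by rewrite tmap_linear // IHx IHy.
Qed.

Section Atens.
Variables (K : fieldType) (A : comAlgType K) (L : lmodType K).
Implicit Types (t : atens A L) (a : A) (l : L).

Lemma apureE a l : apure a l = a *: apure 1 l.
Proof. by rewrite ascale_pure mulr1. Qed.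

(** [tens] and [atens] are one type with two module structures, over K and over A. The universal
    property of the tensor product yields K-linear maps while brackets are A-bilinear; this is the
    bridge. *)
Lemma atens_scaleK (k : K) (t : atens A L) :
  (k%:A : A) *: t = (k *: (t : tens A L)) :> tens A L.
Proof.
move: t; apply: (@tens_eq _ A L (tens A L) (fun t => (k%:A : A) *: (t : atens A L))).
- move=> a x y; rewrite ascale_tmap tmap_linear //.
  by move=> b u v; rewrite mulrDr scalerAr.
- by move=> a x y; rewrite scalerDr !scalerA mulrC.
- move=> a l; rewrite [LHS]ascale_pure -(linZ (pure_linl l)).
  by rewrite -scalerAl mul1r.
Qed.

Lemma atens_ind (P : atens A L -> Prop) :
    (forall l, P (apure 1 l)) ->
    (forall a x y, P x -> P y -> P (a *: x + y)) ->
  forall x, P x.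
Proof.
move=> P1 Plin; have P0 : P 0.
  by rewrite -[0](addNr (apure 1 0)) -scaleN1r; apply: Plin.
apply: (@tens_ind K A L P) => [a l|k x y Px Py].
  by rewrite -[pure _ _]/(apure a l) apureE -[_ *: _]addr0; apply: Plin.
by rewrite -[k *: x]atens_scaleK; apply: Plin.
Qed.

Lemma atens_eq (V : lmodType A) (f g : atens A L -> V) :
  linear f -> linear g -> (forall l, f (apure 1 l) = g (apure 1 l)) -> f =1 g.
Proof.
move=> fl gl fg; elim/atens_ind=> // a x y fx fy.
by rewrite fl gl fx fy.
Qed.

Lemma atens_linearK (f : atens A L -> atens A L) :
  linear f -> linear (f : tens A L -> tens A L).
Proof.
move=> fl k x y; rewrite -[k *: x]atens_scaleK.
by rewrite [f _](fl) [_ *: f x]atens_scaleK.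
Qed.

Lemma ascale_linearK (a : A) : linear (fun t : tens A L => a *: (t : atens A L) :
  tens A L).
Proof. by apply: atens_linearK => b x y; rewrite scalerDr !scalerA mulrC. Qed.

(** Extension of scalars: A (x) L is free over A on L, so a K-linear map from L extends uniquely to
    an A-linear one. *)
Definition alin (r : L -> atens A L) (x : atens A L) : atens A L :=
  tlift (fun (a : A) l => (a *: r l : tens A L)) x.

Section Alin.
Variables (r : L -> atens A L) (rl : linear (r : L -> tens A L)).

Let rb : bilinear2 (fun (a : A) l => (a *: r l : tens A L)).
Proof.
split=> [l k a b|a k l m]; last by rewrite rl; apply: ascale_linearK.
by rewrite scalerDl -[k *: _ in RHS]atens_scaleK scalerA -scalerAl mul1r.
Qed.

Lemma alinE a l : alin r (apure a l) = a *: r l.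
Proof. exact: (tliftE a l rb). Qed.

Lemma alin_linear : linear (alin r).
Proof.
have D x y : alin r (x + y) = alin r x + alin r y.
  by have := tlift_linear rb 1 x y; rewrite !scale1r.
move=> a x y; rewrite D; congr (_ + _).
have kE k w : alin r (k%:A *: w) = k%:A *: alin r w.
  rewrite !atens_scaleK; exact: (linZ (tlift_linear rb) k w).
(* [tlift] gives K-linearity only; compatibility with A is checked on pure tensors, where it is
   associativity of the action. *)
apply: (@tens_ind K A L (fun x => alin r (a *: (x : atens A L)) = a *: alin r x)).
  by move=> b l; rewrite -[pure b l]/(apure b l) ascale_pure !alinE scalerA.
move=> k u v IHu IHv; rewrite -[k *: u]atens_scaleK.
rewrite [in LHS]scalerDr !D IHv scalerA mulrC -scalerA !kE IHu.
by rewrite scalerDr !scalerA mulrC.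
Qed.

End Alin.
End Atens.

(** * Brackets and push-outs *)

Lemma linear_atensE (K : fieldType) (A : comAlgType K) (L : lmodType K)
    (f : L -> atens A L) :
  linear (f : L -> tens A L) -> forall k l m, f (k *: l + m) = k%:A *: f l + f m.
Proof. by move=> fl k l m; rewrite atens_scaleK; apply: fl. Qed.

Lemma linear_scalerm (K : fieldType) (A : comAlgType K) (V W : lmodType A) (a : A)
  (f : V -> W) : linear f -> linear (fun x => a *: f x).
Proof. by move=> fl b x y; rewrite fl scalerDr !scalerA mulrC. Qed.

Lemma apure1P (K : fieldType) (A : comAlgType K) (L : lmodType K) k (l m : L) :
  apure (1 : A) (k *: l + m) = k%:A *: apure 1 l + apure 1 m.
Proof. by rewrite atens_scaleK; apply: pure_linr. Qed.

Section BilinearExtension.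
Variables (K : fieldType) (A : comAlgType K) (L : lmodType K).

Definition bilin (op : atens A L -> atens A L -> atens A L) : Prop :=
  (forall y, linear (op^~ y)) /\ (forall x, linear (op x)).

Definition kbilin (c : L -> L -> atens A L) : Prop :=
  (forall m, linear (c^~ m : L -> tens A L)) /\ (forall l, linear (c l : L -> tens
    A L)).

Definition abil (c : L -> L -> atens A L) (x y : atens A L) : atens A L :=
  alin (fun l => alin (c l) y) x.

Section Abil.
Variables (c : L -> L -> atens A L) (cb : kbilin c).

Let inner_linear y : linear ((fun l => alin (c l) y) : L -> tens A L).
Proof.
case: cb => cl cr k l m; rewrite -[k *: alin _ _]atens_scaleK.
apply: (@atens_eq _ _ _ _ (alin (c (k *: l + m)))
  (fun y => k%:A *: alin (c l) y + alin (c m) y)).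
- exact: alin_linear.
- apply: linear_add; last exact: alin_linear.
  by apply: linear_scalerm; apply: alin_linear.
- by move=> n; rewrite !alinE // !scale1r (linear_atensE (cl n)).
Qed.

Lemma abilE a b l m : abil c (apure a l) (apure b m) = (a * b) *: c l m.
Proof. by case: cb => cl cr; rewrite /abil alinE // alinE // scalerA. Qed.

Lemma abil_bilin : bilin (abil c).
Proof.
case: cb => cl cr; split=> [y|x]; first exact: alin_linear.
move=> a y z; apply: (@atens_eq _ _ _ _ (fun x => abil c x (a *: y + z))
   (fun x => a *: abil c x y + abil c x z)).
- exact: alin_linear.
- apply: linear_add; last exact: alin_linear.
  by apply: linear_scalerm; apply: alin_linear.
- by move=> n; rewrite /abil !alinE // !scale1r alin_linear.
Qed.

End Abil.

Section Bilin.
Variables (op : atens A L -> atens A L -> atens A L) (opb : bilin op).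

Lemma bilin_kbilin : kbilin (fun l m => op (apure 1 l) (apure 1 m)).
Proof.
case: opb => opl opr; split=> n k l m;
  by rewrite apure1P (opl, opr) atens_scaleK.
Qed.

Lemma bilinE x y : op x y = abil (fun l m => op (apure 1 l) (apure 1 m)) x y.
Proof.
have [al ar] := abil_bilin bilin_kbilin; case: opb => opl opr.
move: x; apply: atens_eq => // l; move: y; apply: atens_eq => // m.
by rewrite (abilE bilin_kbilin) mulr1 scale1r.
Qed.

Lemma bilin_pure a b l m :
  op (apure a l) (apure b m) = (a * b) *: op (apure 1 l) (apure 1 m).
Proof. by rewrite bilinE (abilE bilin_kbilin). Qed.

End Bilin.

Lemma bilin_eq op1 op2 : bilin op1 -> bilin op2 ->
  (forall l m, op1 (apure 1 l) (apure 1 m) = op2 (apure 1 l) (apure 1 m)) ->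
  forall x y, op1 x y = op2 x y.
Proof.
move=> b1 b2 e x y; rewrite (bilinE b1) (bilinE b2).
by congr (abil _ x y); apply/funext => l; apply/funext => m; apply: e.
Qed.

Definition jac (V : zmodType) (op : V -> V -> V) x y z :=
  op x (op y z) - op (op x y) z + op (op x z) y.

Lemma is_leibniz_jac (R : comPzRingType) (V : lmodType R) (op : V -> V -> V) :
  is_leibniz op -> forall x y z, jac op x y z = 0.
Proof. by move=> [_ _ e] x y z; rewrite /jac e addrAC subrK subrr. Qed.

(** The Jacobiator of a bilinear operation is trilinear over A, hence zero once it vanishes on the
    generators 1 (x) l. *)
Lemma jac_leibniz op : bilin op ->
  (forall l m n, jac op (apure 1 l) (apure 1 m) (apure 1 n) = 0) ->
  is_leibniz op.
Proof.
move=> [opl opr] J0.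
have Jx y z : linear (fun x => jac op x y z).
  apply: linear_add; first apply: linear_sub;
    by move=> a u v; rewrite !opl.
have Jy x z : linear (fun y => jac op x y z).
  apply: linear_add; first apply: linear_sub;
    by move=> a u v; rewrite ?opl ?opr ?opl.
have Jz x y : linear (fun z => jac op x y z).
  apply: linear_add; first apply: linear_sub;
    by move=> a u v; rewrite !opr ?opl.
have J x y z : jac op x y z = 0.
  have L0 : linear (fun _ : atens A L => 0 : atens A L).
    by move=> a u v; rewrite scaler0 addr0.
  rewrite (atens_eq (Jx y z) L0) // => l.
  rewrite (atens_eq (Jy _ z) L0) // => m.
  by rewrite (atens_eq (Jz _ _) L0).
split=> // x y z; apply/eqP; rewrite -subr_eq0 opprB addrCA addrC -(J x y z).
by rewrite /jac addrAC.
Qed.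

End BilinearExtension.

Section Push.
Variables (K : fieldType) (L : leibniz_algebra K).
Implicit Types A B : augalg K.

Lemma aug_bilinear A : bilinear2 (fun (a : A) (l : L) => aug a *: l).
Proof. exact: (@contr_bilinear _ A L aug (@aug_linear K A)). Qed.

Lemma aug_tensE A (a : A) (l : L) : aug_tens (apure a l) = aug a *: l.
Proof. exact: (tliftE a l (aug_bilinear A)). Qed.

Lemma aug_tens1 A (l : L) : aug_tens (apure (1 : A) l) = l.
Proof. by rewrite aug_tensE rmorph1 scale1r. Qed.

Lemma aug_tens_linear A : linear (@aug_tens K A L : tens A L -> L).
Proof. exact: (tlift_linear (aug_bilinear A)). Qed.

Lemma aug_tensD A (x y : atens A L) : aug_tens (x + y) = aug_tens x + aug_tens y.
Proof. by have := @aug_tens_linear A 1 x y; rewrite !scale1r. Qed.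

Lemma aug_tensZ A (a : A) (x : atens A L) : aug_tens (a *: x) = aug a *: aug_tens x.
Proof.
apply: (@tens_ind K A L (fun x => aug_tens (a *: (x : atens A L)) = aug a *:
  aug_tens x)).
  by move=> b l; rewrite ascale_pure !aug_tensE rmorphM scalerA.
move=> k u v Iu Iv; rewrite -[k *: u]atens_scaleK scalerDr !aug_tensD Iv.
rewrite scalerA mulrC -scalerA !(atens_scaleK k) !(linZ (@aug_tens_linear A)) Iu.
by rewrite scalerDr !scalerA mulrC.
Qed.

Lemma aug_tens_tmap A B (f : A -> B) (x : atens A L) : linear f ->
  (forall a, aug (f a) = aug a) -> aug_tens (tmap f x : atens B L) = aug_tens x.
Proof.
move=> fl fa; elim/tens_ind: x => [a l|k u v Iu Iv].
  by rewrite tmapE // -[pure _ _]/(apure (f a) l) -[pure _ _]/(apure a l)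
    !aug_tensE fa.
by rewrite tmap_linear // !(@aug_tens_linear _ k) Iu Iv.
Qed.

Lemma tmapD (M N : lmodType K) (f : M -> N) (x y : tens M L) : linear f ->
  tmap f (x + y) = tmap f x + tmap f y.
Proof. by move=> fl; rewrite (linD (tmap_linear fl)). Qed.

Lemma tmapB (M N : lmodType K) (f : M -> N) (x y : tens M L) : linear f ->
  tmap f (x - y) = tmap f x - tmap f y.
Proof. by move=> fl; rewrite (linB (tmap_linear fl)). Qed.

Lemma tmap_ahomZ A B (f : aughom A B) (a : A) (t : atens A L) :
  tmap f (a *: t) = f a *: (tmap f t : atens B L).
Proof. by apply: tmap_scale; [exact: ahom_linear | exact: rmorphM]. Qed.

(** [is_pushout] constrains only the values on the 1 (x) l; bilinearity determines the rest, and
    [push] is the resulting bracket as a function. *)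
Definition push A B (f : aughom A B) (lam : bracket L A) : bracket L B :=
  abil (fun l m => tmap f (lam (apure 1 l) (apure 1 m))).

Definition augcompat A (lam : bracket L A) : Prop :=
  forall x y, aug_tens (lam x y) = lbr (aug_tens x) (aug_tens y).

Lemma leibniz_bilin A (lam : bracket L A) : is_leibniz lam -> bilin lam.
Proof. by case. Qed.

Lemma deformation_bilin A (lam : bracket L A) : is_deformation lam -> bilin lam.
Proof. by case=> [[]]. Qed.

Section PushLemmas.
Variables (A B : augalg K) (f : aughom A B) (lam : bracket L A) (lb : bilin lam).

Lemma push_kbilin : kbilin (fun l m => tmap f (lam (apure 1 l) (apure 1 m)) : atens
  B L).
Proof.
have [cl cr] := bilin_kbilin lb; have fl := tmap_linear (ahom_linear f).
by split=> [m|l] k x y /=; rewrite (cl, cr) fl.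
Qed.

Lemma push_bilin : bilin (push f lam).
Proof. exact: abil_bilin push_kbilin. Qed.

Lemma push1 l m : push f lam (apure 1 l) (apure 1 m) = tmap f (lam (apure 1 l)
  (apure 1 m)).
Proof. by rewrite /push (abilE push_kbilin) mulr1 scale1r. Qed.

Lemma tmap_push x y : tmap f (lam x y) = push f lam (tmap f x) (tmap f y).
Proof.
have [pl pr] := push_bilin; case: (lb) => ll lr.
elim/(@atens_ind K A L): x => [l|a u v Iu Iv]; last first.
  by rewrite ll !(tmapD _ _ (ahom_linear f)) !tmap_ahomZ pl Iu Iv.
elim/(@atens_ind K A L): y => [m|a u v Iu Iv]; last first.
  by rewrite lr !(tmapD _ _ (ahom_linear f)) !tmap_ahomZ pr Iu Iv.
by rewrite !(tmapE (ahom_linear f)) rmorph1 push1.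
Qed.

End PushLemmas.

Lemma bilin_augcompat A (lam : bracket L A) : bilin lam ->
  (forall l m, aug_tens (lam (apure 1 l) (apure 1 m)) = lbr l m) -> augcompat lam.
Proof.
move=> [ll lr] e x y; have [bl br _] := lbrP L.
elim/(@atens_ind K A L): x => [l|a u v Iu Iv]; last first.
  by rewrite ll !aug_tensD !aug_tensZ Iu Iv bl.
elim/(@atens_ind K A L): y => [m|a u v Iu Iv]; last first.
  by rewrite lr !aug_tensD !aug_tensZ Iu Iv br.
by rewrite e !aug_tens1.
Qed.

Lemma push_deformation A B (f : aughom A B) (lam : bracket L A) :
  is_deformation lam -> is_deformation (push f lam).
Proof.
move=> [lamL lama]; have lb := leibniz_bilin lamL; have pb := push_bilin f lb.
split.
  apply: jac_leibniz => // l m n.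
  (* The generators come from A, so the Jacobiator over B is the image of the vanishing one over
     A. *)
  have T (p : L) : apure 1 p = tmap f (apure 1 p : atens A L) :> atens B L.
    by rewrite [RHS](tmapE (ahom_linear f)) rmorph1.
  rewrite /jac !T -!(tmap_push f lb) -(tmapB _ _ (ahom_linear f)).
  rewrite -(tmapD _ _ (ahom_linear f)).
  have := is_leibniz_jac lamL (apure 1 l) (apure 1 m) (apure 1 n).
  by rewrite /jac => ->; apply: lin0 (tmap_linear (ahom_linear f)).
apply: bilin_augcompat => // l m; rewrite push1 // aug_tens_tmap ?lama ?aug_tens1 //.
- exact: ahom_linear.
- exact: ahom_aug.
Qed.

Lemma pushout_push A B (f : aughom A B) (lam : bracket L A) (lam' : bracket L B) :
  bilin lam -> bilin lam' -> is_pushout f lam lam' ->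
  forall x y, lam' x y = push f lam x y.
Proof.
move=> lb lb' po; apply: bilin_eq => //; first exact: push_bilin.
by move=> l m; rewrite push1.
Qed.

Lemma pushout_tmap A B (f : aughom A B) (lam : bracket L A) (lam' : bracket L B) :
  bilin lam -> bilin lam' -> is_pushout f lam lam' ->
  forall x y, tmap f (lam x y) = lam' (tmap f x) (tmap f y).
Proof.
by move=> lb lb' po x y; rewrite (pushout_push lb lb' po) tmap_push.
Qed.

End Push.

(** * Cochains of low degree *)

Section SmallCochains.
Variables (K : fieldType) (L : leibniz_algebra K).

Lemma lbr_linr (l : L) : linear (fun m : L => lbr l m).
Proof. exact: (leibniz_linr (lbrP L)). Qed.

Definition coc1 (b : L -> L) : ('I_1 -> L) -> L := fun x => b (x ord0).
Definition coc2 (b : L -> L -> L) : ('I_2 -> L) -> L := fun x => b (x ord0) (x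
  ord_max).

(** The differential of the Leibniz complex on curried cochains of degrees 1 and 2, the form in
    which it arises from computations with brackets. *)
Definition del1 (b : L -> L) (l m : L) : L := lbr l (b m) + lbr (b l) m - b (lbr l m).
Definition del2 (b : L -> L -> L) (l m n : L) : L :=
  lbr l (b m n) + lbr (b l n) m - lbr (b l m) n
    - b (lbr l m) n + b (lbr l n) m + b l (lbr m n).

Lemma delta_coc1 (b : L -> L) (x : 'I_2 -> L) :
  delta (coc1 b) x = del1 b (x ord0) (x ord_max).
Proof.
rewrite /delta /coc1 /del1 !big_mkcond /= !big_ord_recl !big_ord0 /=.
rewrite !add0r !addr0 !big_mkcond /= !big_ord_recl !big_ord0 /= !addr0 !add0r.
rewrite /contract /=.
have -> : fintype.lift (ord0 : 'I_2) (ord0 : 'I_1) = ord_max by apply/val_inj.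
have -> : fintype.lift (ord_max : 'I_2) (ord0 : 'I_1) = ord0 by apply/val_inj.
rewrite big_mkcond !big_ord_recl big_ord0 /= !addr0.
by rewrite /bump /= sqrrN !expr1n expr1 scale1r scaleN1r.
Qed.

Definition o1 : 'I_3 := fintype.lift ord0 ord0.

Lemma delta_coc2 (b : L -> L -> L) (x : 'I_3 -> L) :
  delta (coc2 b) x = del2 b (x ord0) (x o1) (x ord_max).
Proof.
rewrite /delta /coc2 /del2 !big_mkcond /= !big_ord_recl !big_ord0 /=.
rewrite !add0r !addr0 !big_mkcond /= !big_ord_recl !big_ord0 /= !addr0 !add0r.
rewrite /contract /=.
rewrite !big_mkcond !big_ord_recl !big_ord0 /= !addr0 !add0r.
have e2 : fintype.lift (ord0 : 'I_3) (fintype.lift ord0 ord0) = ord_max by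
  apply/val_inj.
have e2' : fintype.lift (ord0 : 'I_3) ord_max = ord_max by apply/val_inj.
have e0 : fintype.lift o1 ord0 = ord0 by apply/val_inj.
have e0' : fintype.lift o1 ord_max = ord_max by apply/val_inj.
have e1 : fintype.lift (ord_max : 'I_3) (ord0 : 'I_2) = ord0 by apply/val_inj.
have e1' : fintype.lift (ord_max : 'I_3) (ord_max : 'I_2) = o1 by apply/val_inj.
rewrite -/o1 !(e2, e2', e0, e0', e1, e1').
rewrite /bump /= !add1n !exprS expr0 !mulr1 !mulN1r !opprK !scale1r !scaleN1r.
rewrite big_pred0 ?addr0 ?addrA //.
by case=> [[|[|[|]]]].
Qed.

Lemma coc1_multilinear (b : L -> L) : linear b -> cochains L L 1 (coc1 b).
Proof.
move=> bl; change (multilinear (coc1 b)) => i x a u v; rewrite /coc1 /upd.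
by rewrite (ord1 i) eqxx bl.
Qed.

Lemma coc1K (f : ('I_1 -> L) -> L) : f = coc1 (fun l => f (fun=> l)).
Proof.
apply/funext => x; rewrite /coc1; congr f.
by apply/funext => i; rewrite ord1.
Qed.

Lemma cochain1_linear (f : ('I_1 -> L) -> L) :
  cochains L L 1 f -> linear (fun l => f (fun=> l)).
Proof.
move=> fm a u v; change (multilinear f) in fm; have := fm ord0 (fun=> 0) a u v.
have E w : upd (fun=> 0 : L) (ord0 : 'I_1) w = fun=> w.
  by apply/funext => i; rewrite /upd ord1.
by rewrite !E.
Qed.

Definition pair2 (l m : L) : 'I_2 -> L := fun i => if i == ord0 then l else m.

Lemma coc2_multilinear (b : L -> L -> L) :
  (forall m, linear (b^~ m)) -> (forall l, linear (b l)) -> cochains L L 2 (coc2 b).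
Proof.
move=> bl br; change (multilinear (coc2 b)) => i x a u v; rewrite /coc2 /upd.
have [->|] := eqVneq i ord0; first by rewrite /= bl.
case: i => [[|[|//]]] //= H _.
by rewrite br.
Qed.

Lemma pair2E (l m : L) : tnth [tuple l; m] = pair2 l m.
Proof.
apply/funext => i; rewrite /pair2 (tnth_nth 0) /=.
by case: i => [[|[|//]]].
Qed.

End SmallCochains.

Section SquareZeroKernel.
Variables (K : fieldType) (L : leibniz_algebra K) (A : augalg K).
Variables (r : nat) (n : 'I_r -> A).
Hypothesis nA : forall a i, a * n i = aug a *: n i.

(** Coordinates on N (x) L inside A (x) L, with N the span of the [n i]; all comparisons of brackets
    take place there. *)
Definition inc (u : 'I_r -> L) : atens A L := \sum_i (pure (n i) (u i) : tens A L).

Lemma incD u v : inc u + inc v = inc (fun i => u i + v i).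
Proof.
rewrite /inc -[LHS](big_split (+%R : tens A L -> _)) /=.
by apply: eq_bigr => i _; rewrite (linD (pure_linr _)).
Qed.

Lemma incN u : - inc u = inc (fun i => - u i).
Proof.
rewrite /inc -sumrN.
by apply: eq_bigr => i _; rewrite (linN (pure_linr _)).
Qed.

Lemma incB u v : inc u - inc v = inc (fun i => u i - v i).
Proof. by rewrite incN incD. Qed.

(** The augmentation ideal annihilates [n i], so the product sees [t] only modulo that ideal. *)
Lemma scale_kernel (i : 'I_r) (t : atens A L) : n i *: t = apure (n i) (aug_tens t).
Proof.
apply: (@atens_ind K A L (fun t => n i *: t = apure (n i) (aug_tens t))) => {t}
  [l|a u v Iu Iv].
  by rewrite ascale_pure mulr1 aug_tens1.
rewrite scalerDr scalerA mulrC -scalerA Iu Iv ascale_pure nA.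
rewrite aug_tensD aug_tensZ /apure (linD (pure_linr _)).
by rewrite pureZ.
Qed.

Lemma incZ a u : a *: inc u = inc (fun i => aug a *: u i).
Proof.
rewrite /inc [LHS](scaler_sumr a _ _ (fun i => apure (n i) (u i))).
by apply: eq_bigr => i _; rewrite ascale_pure nA -pureZ.
Qed.

Lemma inc_lin k u v : inc (fun i => k *: u i + v i) = (k *: (inc u : tens A L)) +
  inc v.
Proof.
rewrite -incD -atens_scaleK incZ augZ rmorph1 mulr1; congr (_ + _).
Qed.

Lemma eq_inc u v : u =1 v -> inc u = inc v.
Proof. by move=> uv; apply: eq_bigr => i _; rewrite uv. Qed.

Lemma aug_inc u : (forall i, aug (n i) = 0) -> aug_tens (inc u) = 0.
Proof.
move=> n0; rewrite /inc (lin_sum (@aug_tens_linear _ _ _)) big1 // => i _.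
by rewrite -[pure _ _]/(apure (n i) (u i)) aug_tensE n0 scale0r.
Qed.

Section Bracket.
Variables (lam : bracket L A) (lb : bilin lam) (la : augcompat lam).

Lemma bracket_incr l u : lam (apure 1 l) (inc u) = inc (fun i => lbr l (u i)).
Proof.
case: lb => ll lr; rewrite /inc (lin_sum (lr _)); apply: eq_bigr => i _.
rewrite (bilin_pure lb) mul1r scale_kernel la !aug_tens1 //.
Qed.

Lemma bracket_incl u l : lam (inc u) (apure 1 l) = inc (fun i => lbr (u i) l).
Proof.
case: lb => ll lr; rewrite /inc (lin_sum (ll _)); apply: eq_bigr => i _.
by rewrite (bilin_pure lb) mulr1 scale_kernel la !aug_tens1.
Qed.

(** Bracketing with a kernel element depends on the other argument only through its augmentation,
    which is zero here. *)
Lemma bracket_inc2 u v : (forall i, aug (n i) = 0) -> lam (inc u) (inc v) = 0.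
Proof.
move=> n0; case: lb => ll lr; rewrite /inc (lin_sum (ll _)) big1 // => i _.
rewrite -[pure _ _]/(apure (n i) (u i)) apureE (linZ (ll _)) scale_kernel la
  aug_inc //.
by rewrite (lin0 (lbr_linr _)) /apure pure0r.
Qed.

Variables (B : augalg K) (Phi : aughom B A) (op : bracket L B).
Hypotheses (opb : bilin op) (opa : augcompat op).
Variable beta : 'I_r -> L -> L -> L.
Hypothesis betal : forall i m, linear (beta i ^~ m).
Hypothesis betar : forall i l, linear (beta i l).
Hypothesis lamE : forall l m, lam (apure 1 l) (apure 1 m) =
  tmap Phi (op (apure 1 l) (apure 1 m)) + inc (fun i => beta i l m).

Let P1 (l : L) : tmap Phi (apure 1 l : atens B L) = apure 1 l.
Proof. by rewrite (tmapE (ahom_linear Phi)) rmorph1. Qed.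

(** Extends [lamE] from generators to one arbitrary argument: the term in [beta] lies in the kernel
    and so sees only the augmentation of [t]. *)
Lemma bracket_tmapr l t : lam (apure 1 l) (tmap Phi t) =
  tmap Phi (op (apure 1 l) t) + inc (fun i => beta i l (aug_tens t)).
Proof.
case: lb opb => ll lr [ol or].
elim/(@atens_ind K B L): t => [m|a u v Iu Iv].
  by rewrite P1 lamE aug_tens1.
rewrite or !(tmapD _ _ (ahom_linear Phi)) !tmap_ahomZ lr Iu Iv scalerDr incZ ahom_aug.
rewrite addrACA incD; congr (_ + _); apply: eq_inc => i.
by rewrite aug_tensD aug_tensZ betar.
Qed.

Lemma bracket_tmapl t m : lam (tmap Phi t) (apure 1 m) =
  tmap Phi (op t (apure 1 m)) + inc (fun i => beta i (aug_tens t) m).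
Proof.
case: lb opb => ll lr [ol or].
elim/(@atens_ind K B L): t => [l|a u v Iu Iv].
  by rewrite P1 lamE aug_tens1.
rewrite ol !(tmapD _ _ (ahom_linear Phi)) !tmap_ahomZ ll Iu Iv scalerDr incZ ahom_aug.
rewrite addrACA incD; congr (_ + _); apply: eq_inc => i.
by rewrite aug_tensD aug_tensZ betal.
Qed.

(* The kernel is annihilated by the augmentation ideal, so the Jacobiator of
   op + beta is that of op plus the linear part in beta, which is delta beta. *)
Lemma jac_lift l m p : jac lam (apure 1 l) (apure 1 m) (apure 1 p) =
  tmap Phi (jac op (apure 1 l) (apure 1 m) (apure 1 p))
  + inc (fun i => del2 (beta i) l m p).
Proof.
case: (lb) => ll lr; rewrite /jac !lamE.
rewrite [lam _ (_ + _)](linD (lr _)) !(linD (ll _)) bracket_tmapr !bracket_tmapl.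
rewrite bracket_incr !bracket_incl !opa !aug_tens1.
rewrite (tmapD _ _ (ahom_linear Phi)) (tmapB _ _ (ahom_linear Phi)).
rewrite -!addrA !incD ![- (_ + _)]opprD !addrA.
have X (a b c d e f : atens A L) : a + b - c - d + e + f = a - c + e + (b - d + f).
  by rewrite [RHS]addrACA addrA; congr (_ + _ + _); rewrite [a + b - c]addrAC addrA.
rewrite -[X in X - _ - _]addrA incD X incB incD; congr (_ + _); apply: eq_inc => i.
by rewrite /del2 !opprD !addrA [LHS](ACl (2*6*4*3*5*1)).
Qed.

End Bracket.

(* Conjugating by 1 + b changes a bracket by the coboundary of b. *)
Lemma equiv_lift (lam lam' : bracket L A) (rho : atens A L -> atens A L)
    (b : 'I_r -> L -> L) : (forall i, aug (n i) = 0) ->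
  bilin lam -> augcompat lam -> bilin lam' -> augcompat lam' ->
  linear rho -> (forall l, rho (apure 1 l) = apure 1 l + inc (fun i => b i l)) ->
  (forall i, linear (b i)) ->
  forall l m, rho (lam (apure 1 l) (apure 1 m)) - lam' (rho (apure 1 l)) (rho
    (apure 1 m))
    = lam (apure 1 l) (apure 1 m) - lam' (apure 1 l) (apure 1 m)
      - inc (fun i => del1 (b i) l m).
Proof.
move=> n0 lb la lb' la' rl r1 bl l m.
(* Modulo the kernel [rho] is the identity, and its kernel part depends on [t] only through the
   augmentation. *)
have rE t : rho t = t + inc (fun i => b i (aug_tens t)).
  elim/(@atens_ind K A L): t => [k|a u v Iu Iv]; first by rewrite r1 aug_tens1.
  rewrite rl Iu Iv scalerDr incZ addrACA incD; congr (_ + _); apply: eq_inc => i.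
  by rewrite aug_tensD aug_tensZ bl.
case: (lb') => ll lr.
rewrite rE !r1 (linD (ll _)) !(linD (lr _)) bracket_incr // bracket_incl //
  bracket_inc2 //.
rewrite addr0 la !aug_tens1 -!addrA incD opprD incN.
congr (_ + _); rewrite addrCA incB; congr (_ + _); apply: eq_inc => i.
by rewrite /del1 opprB.
Qed.

End SquareZeroKernel.

(** * Small extensions *)

(** A surjection with finite-dimensional kernel killed by the augmentation ideal, in chosen
    coordinates: [n] is a basis of the kernel, [s] a linear section, and the [chi i] are the
    coordinate functionals of the kernel extended by zero on the image of [s]. *)
Record small_ext (K : fieldType) (A A0 : augalg K) (q : aughom A A0)
    r (n : 'I_r -> A) (chi : 'I_r -> A -> K^o) (s : A0 -> A) : Prop := SmallExt {
  se_annih : forall a i, a * n i = aug a *: n i;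
  se_ker : forall i, q (n i) = 0;
  se_chi_lin : forall i, linear (chi i);
  se_chiE : forall i j, chi i (n j) = (i == j)%:R;
  se_sec_lin : linear s;
  se_secK : forall a, q (s a) = a;
  se_dec : forall a, a = s (q a) + \sum_i (chi i a : K) *: n i }.

Lemma bij_inj_surj (T U : Type) (f : T -> U) :
  injective f -> (forall y, exists x, f x = y) -> bijective f.
Proof.
move=> fi fs; pose g y := projT1 (cid (fs y)).
have gK y : f (g y) = y by rewrite /g; case: cid.
by exists g => // x; apply: fi.
Qed.

Section SmallExtension.
Variables (K : fieldType) (L : leibniz_algebra K) (A A0 : augalg K) (q : aughom A A0).
Variables (r : nat) (n : 'I_r -> A) (chi : 'I_r -> A -> K^o) (s : A0 -> A).
Hypothesis se : small_ext q n chi s.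

Let ql := ahom_linear q.
Let sl := se_sec_lin se.
Let nA := se_annih se.

Lemma se_aug i : aug (n i) = 0.
Proof. by rewrite -(ahom_aug q) (se_ker se) rmorph0. Qed.

Lemma se_tdec (t : tens A L) :
  t = tmap s (tmap q t) + inc n (fun i => contr (chi i) t).
Proof.
elim/tens_ind: t => [a l|k x y Ix Iy]; last first.
  rewrite {1}Ix {1}Iy.
  rewrite (tmap_linear ql k) (tmap_linear sl k).
  under [in RHS]eq_inc => i do rewrite (contr_linear (se_chi_lin se i)).
  by rewrite (inc_lin nA) scalerDr addrACA.
rewrite !tmapE // {1}(se_dec se a).
rewrite (linD (pure_linl l)) (lin_sum (pure_linl l)); congr (_ + _).
apply: eq_bigr => i _; rewrite contr_pure; last exact: (se_chi_lin se); exact: pureZ.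
Qed.

Lemma se_tker (t : tens A L) :
  tmap q t = 0 -> t = inc n (fun i => contr (chi i) t).
Proof. by move=> t0; rewrite {1}[t]se_tdec t0 (lin0 (tmap_linear sl)) add0r. Qed.

Lemma tmap_inc (u : 'I_r -> L) : tmap q (inc n u) = 0.
Proof.
rewrite (lin_sum (tmap_linear ql)) big1 // => i _.
by rewrite (tmapE ql) (se_ker se) pure0l.
Qed.

Lemma contr_inc j (u : 'I_r -> L) : contr (chi j) (inc n u) = u j.
Proof.
rewrite (lin_sum (contr_linear (se_chi_lin se j))) (bigD1 j) //= big1.
  by rewrite contr_pure ?(se_chiE se) ?eqxx ?scale1r ?addr0 //; apply: (se_chi_lin
    se).
move=> i ij; rewrite contr_pure ?(se_chiE se); last exact: (se_chi_lin se).
by rewrite eq_sym (negbTE ij) scale0r.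
Qed.

Lemma tmap_secK (t : tens A0 L) : tmap q (tmap s t) = t.
Proof.
rewrite -[LHS]/((tmap q \o tmap s) t) -tmap_comp //.
by apply: tmap_id => a; apply: (se_secK se).
Qed.

Let q1 (l : L) : tmap q (apure 1 l : atens A L) = apure 1 l :> atens A0 L.
Proof. by rewrite (tmapE ql) rmorph1. Qed.

Section LiftMap.
Variables (rho0 : atens A0 L -> atens A0 L) (rho : atens A L -> atens A L).
Hypotheses (rl0 : linear rho0) (rl : linear rho).
Hypothesis rb0 : bijective rho0.
Hypothesis ra0 : forall x, aug_tens (rho0 x) = aug_tens x.
Hypothesis qrho : forall x, tmap q (rho x) = rho0 (tmap q x).

Lemma lift_aug x : aug_tens (rho x) = aug_tens x.
Proof.
have qa (t : atens A L) : aug_tens t = aug_tens (tmap q t : atens A0 L).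
  by rewrite aug_tens_tmap //; apply: ahom_aug.
by rewrite qa qrho ra0 -qa.
Qed.

(** A kernel tensor is a sum of multiples by [n i] of elements 1 (x) l. The A-linear map [rho]
    commutes with [n i], which then sees only the augmentation, and that is preserved. *)
Lemma lift_inc u : rho (inc n u) = inc n u.
Proof.
rewrite /inc (lin_sum rl); apply: eq_bigr => i _.
by rewrite -[pure _ _]/(apure (n i) (u i)) apureE (linZ rl) !(scale_kernel nA)
  lift_aug.
Qed.

(** The five lemma: [rho] is the identity on the kernel and bijective on the quotient. *)
Lemma lift_bij : bijective rho.
Proof.
case: rb0 => g gK Kg.
have ker x : rho x = 0 -> x = 0.
  move=> x0; have qx0 : tmap q x = 0.
    by rewrite -[tmap q x]gK -qrho x0 (lin0 (tmap_linear ql)) -[X in g X](lin0 rl0)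
      gK.
  have e : x = inc n _ := se_tker qx0.
  by rewrite e -lift_inc -e.
apply: bij_inj_surj => [x y xy|y].
  by apply/eqP; rewrite -subr_eq0; apply/eqP/ker; rewrite (linB rl) xy subrr.
pose x := tmap s (g (tmap q y)) : atens A L.
have d0 : tmap q (y - rho x) = 0.
  by rewrite (tmapB _ _ ql) qrho tmap_secK Kg subrr.
have e : y - rho x = inc n _ := se_tker d0.
by exists (x + (y - rho x)); rewrite (linD rl) e lift_inc -e addrC subrK.
Qed.

End LiftMap.

(** Freeness of A (x) L over A: the values on the 1 (x) l may be lifted arbitrarily, here by [s]. *)
Lemma lift_exists (rho0 : atens A0 L -> atens A0 L) : linear rho0 ->
  exists2 rho : atens A L -> atens A L, linear rho &
    forall x, tmap q (rho x) = rho0 (tmap q x).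
Proof.
move=> rl0; pose c (l : L) : atens A L := tmap s (rho0 (apure 1 l)).
have cl : linear (c : L -> tens A L).
  move=> k l m; rewrite /c apure1P rl0 atens_scaleK; exact: tmap_linear.
exists (alin c); first exact: alin_linear.
move=> x; elim/(@atens_ind K A L): x => [l|a u v Iu Iv].
  by rewrite alinE // scale1r tmap_secK q1.
rewrite (alin_linear cl) !(tmapD _ _ ql) !tmap_ahomZ Iu Iv.
by rewrite rl0.
Qed.

End SmallExtension.

Lemma transport_deformation (K : fieldType) (L : leibniz_algebra K) (A : augalg K)
    (lam : bracket L A) (rho g : atens A L -> atens A L) :
  is_deformation lam -> linear rho -> cancel rho g -> cancel g rho ->
  (forall x, aug_tens (rho x) = aug_tens x) ->
  is_deformation (fun x y => rho (lam (g x) (g y))).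
Proof.
move=> [[ll lr le] la] rl gK Kg ra.
have gl : linear g by move=> a x y; rewrite -[RHS]gK rl !Kg.
have ga x : aug_tens (g x) = aug_tens x by rewrite -ra Kg.
split; last by move=> x y; rewrite ra la !ga.
split=> [y|x|x y z].
- by move=> a u v; rewrite gl ll rl.
- by move=> a u v; rewrite gl lr rl.
- by rewrite !gK le (linB rl).
Qed.

Lemma ahom_factor (K : fieldType) (B C A : augalg K) (pi : aughom B C)
    (f : aughom B A) :
  (forall c, exists b, pi b = c) -> (forall b, pi b = 0 -> f b = 0) ->
  exists g : aughom C A, forall b, g (pi b) = f b.
Proof.
move=> surj ker; pose h c := f (projT1 (cid (surj c))).
have hE b : h (pi b) = f b.
  rewrite /h; case: cid => b' e /=; apply/eqP; rewrite -subr_eq0.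
  rewrite -(linB (ahom_linear f)); apply/eqP/ker.
  by rewrite (linB (ahom_linear pi)) e subrr.
have hl : linear h.
  move=> k x y; have [b <-] := surj x; have [b' <-] := surj y.
  by rewrite -linearP !hE linearP.
have h1 : h 1 = 1 by rewrite -(rmorph1 pi) hE rmorph1.
have hM : {morph h : x y / x * y}.
  move=> x y; have [b <-] := surj x; have [b' <-] := surj y.
  by rewrite -rmorphM !hE rmorphM.
have ha x : aug (h x) = aug x.
  by have [b <-] := surj x; rewrite hE !ahom_aug.
by exists (mkahom hl h1 hM ha).
Qed.

(** * Lifting homomorphisms along a small extension *)

Section HarrisonLift.
Variables (K : fieldType) (A A0 : augalg K) (q : aughom A A0).
Variables (r : nat) (n : 'I_r -> A) (chi : 'I_r -> A -> K^o) (s : A0 -> A).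
Hypothesis se : small_ext q n chi s.
Variables (C : augalg K) (phi : aughom C A0).
Variable sigma : {linear harrH2 C K^o -> subm (harr_cocycles C K^o)}.
Hypothesis sigmaK : forall h, harr_class (sigma h) = h.

Definition ncomb (u : 'I_r -> K) : A := \sum_i u i *: n i.

Lemma ncombD u v : ncomb u + ncomb v = ncomb (fun i => u i + v i).
Proof. by rewrite /ncomb -big_split; apply: eq_bigr => i _; rewrite scalerDl. Qed.
Lemma ncombZ k u : k *: ncomb u = ncomb (fun i => k * u i).
Proof. by rewrite /ncomb scaler_sumr; apply: eq_bigr => i _; rewrite scalerA. Qed.
Lemma ncombN u : - ncomb u = ncomb (fun i => - u i).
Proof. by rewrite /ncomb -sumrN; apply: eq_bigr => i _; rewrite scaleNr. Qed.
Lemma ncombM a u : a * ncomb u = aug a *: ncomb u.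
Proof.
rewrite /ncomb mulr_sumr scaler_sumr; apply: eq_bigr => i _.
by rewrite -scalerAr (se_annih se) !scalerA mulrC.
Qed.
Lemma ncomb_aug u : aug (ncomb u) = 0.
Proof.
rewrite (lin_sum (@aug_linear K A)) big1 // => i _.
by rewrite augZ (se_aug se) mulr0.
Qed.
Lemma ncomb_q u : q (ncomb u) = 0.
Proof.
rewrite (lin_sum (ahom_linear q)) big1 // => i _.
by rewrite (linZ (ahom_linear q)) (se_ker se) scaler0.
Qed.
Lemma ncombMM u v : ncomb u * ncomb v = 0.
Proof. by rewrite ncombM ncomb_aug scale0r. Qed.
Lemma chi_ncomb j u : chi j (ncomb u) = u j.
Proof.
have cl := se_chi_lin se j; rewrite (lin_sum cl) (bigD1 j) //= big1 => [|i ij].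
  rewrite (linZ cl) (se_chiE se) eqxx addr0; exact: mulr1.
by rewrite (linZ cl) (se_chiE se) eq_sym (negbTE ij) scaler0.
Qed.
Lemma ker_ncomb a : q a = 0 -> a = ncomb (fun i => chi i a).
Proof. by move=> qa; rewrite {1}(se_dec se a) qa (lin0 (se_sec_lin se)) add0r. Qed.

Let s1 (c : C) : A := s (phi c).
Let s1l : linear s1.
Proof. by move=> k x y; rewrite /s1 linearP (se_sec_lin se). Qed.
Let s1q c : q (s1 c) = phi c. Proof. exact: (se_secK se). Qed.
Let s1a c : aug (s1 c) = aug c.
Proof. by rewrite -(ahom_aug q) s1q ahom_aug. Qed.

(** The failure of the linear lift [s1] to be multiplicative. It lies in the kernel, and its
    coordinates [F i] are Harrison cocycles because A is associative and commutative. *)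
Let D a b : A := s1 a * s1 b - s1 (a * b).
Let Dq a b : q (D a b) = 0.
Proof. by rewrite /D ahomB ahomM !s1q ahomM subrr. Qed.
Let F i (a b : C) : K^o := chi i (D a b).
Let DF a b : D a b = ncomb (fun i => F i a b). Proof. exact: ker_ncomb (Dq a b). Qed.

Let DM x a b : s1 x * D a b = aug x *: D a b.
Proof. by rewrite DF ncombM s1a. Qed.

Let FP i : is_harr_cocycle (F i).
Proof.
have cl := se_chi_lin se i; split.
- move=> b k x y; rewrite /F -cl; congr (chi i _).
  by rewrite /D mulrDl -scalerAl !s1l mulrDl -scalerAl scalerBr opprD addrACA.
- by move=> a b; rewrite /F /D mulrC [a * b]mulrC.
move=> a b c; rewrite /F -!(linZ cl) -(linB cl) -(linD cl) -(linB cl).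
rewrite -[RHS](lin0 cl); congr (chi i _).
(* Since [s1 x] acts on the kernel as [aug x], the cocycle condition becomes an identity between
   products of values of [s1] in A. *)
by rewrite -!DM /D mulrA; ring.
Qed.

(** After a change of the linear lift by a cochain, the defect is the sum of the chosen
    representatives [sigma (c i)] times [n i]. This is the image of the universal cocycle under the
    map sending m to the sum of m(c i) n i, so the lift and this map together define a homomorphism
    on the extension. *)
Lemma harr_lift : exists (c : 'I_r -> harrH2 C K^o) (Phi : aughom (ext (dual_harr
  sigma)) A),
  (forall b, q (Phi b) = phi (ext_proj b)) /\
  (forall m, Phi (ext_incl (dual_harr sigma) m) = ncomb (fun i => dapp m (c i))).
Proof.
pose z i := @mksub _ _ (harr_cocycles C K^o) (F i) (FP i).
pose c i := harr_class (z i).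
have cob i : exists g : C -> K^o, linear g /\ forall a b,
    (F i a b : K) - (subm_val (sigma (c i)) a b : K)
      = aug b * (g a : K) + aug a * (g b : K) - (g (a * b) : K).
  have /qpiP := esym (sigmaK (c i)).
  case=> g gl gE; exists g; split=> // a b; have := gE a b.
  change (F i a b - (subm_val (sigma (c i)) a b : K) =
    aug a * g b - g (a * b) + aug b * g a -> (F i a b : K) - subm_val (sigma (c i))
      a b
      = aug b * (g a : K) + aug a * (g b : K) - (g (a * b) : K)).
  by move=> ->; rewrite [RHS](ACl (2*3*1)).
have [g gP] := choice cob.
have gl i : linear (g i) by case: (gP i).
pose G a := ncomb (fun i => g i a).
pose S a b := ncomb (fun i => subm_val (sigma (c i)) a b).
have DE a b : D a b = S a b + (aug b *: G a + aug a *: G b - G (a * b)).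
  rewrite DF /S /G !ncombZ ncombN !ncombD; apply: eq_bigr => i _; congr (_ *: _).
  by have [_ /(_ a b) <-] := gP i; rewrite [RHS]addrC subrK.
have Gl : linear G.
  move=> k x y; rewrite /G ncombZ ncombD; apply: eq_bigr => i _.
  by rewrite gl.
pose s2 a := s1 a - G a.
have s2l : linear s2 by apply: linear_sub.
have s2q a : q (s2 a) = phi a by rewrite /s2 ahomB s1q ncomb_q subr0.
have s2a a : aug (s2 a) = aug a by rewrite -(ahom_aug q) s2q ahom_aug.
have s2M a b : s2 a * s2 b = s2 (a * b) + S a b.
  have e1 : s1 a * G b = aug a *: G b by rewrite /G ncombM s1a.
  have e2 : s1 b * G a = aug b *: G a by rewrite /G ncombM s1a.
  have e3 : G a * G b = 0 by rewrite ncombMM.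
  have e4 : s1 a * s1 b = D a b + s1 (a * b) by rewrite /D subrK.
  rewrite /s2 mulrBl !mulrBr e4 DE e1 [G a * s1 b]mulrC e2 e3.
  by rewrite -e1 -e2; ring.
clearbody s2; pose M (m : dual (harrH2 C K^o)) := ncomb (fun i => dapp m (c i)).
have Ml : linear M.
  by move=> k x y; rewrite /M ncombZ ncombD; apply: eq_bigr.
pose P (u : ext (dual_harr sigma)) := s2 u.1 + M u.2.
have Pl : linear P.
  move=> k x y; transitivity ((k *: s2 x.1 + s2 y.1) + (k *: M x.2 + M y.2)).
    by rewrite -s2l -Ml.
  by rewrite /P [in RHS]scalerDr addrACA.
have PM : {morph P : x y / x * y}.
  move=> [a m] [b m'] /=; rewrite /P /=.
  have -> : M (aug a *: m' + aug b *: m + subm_val (dual_harr sigma) a b)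
     = aug a *: M m' + aug b *: M m + S a b.
    by rewrite (linD Ml) (linD Ml) !(linZ Ml).
  have e1 : s2 a * M m' = aug a *: M m' by rewrite /M ncombM s2a.
  have e2 : s2 b * M m = aug b *: M m by rewrite /M ncombM s2a.
  have e3 : M m * M m' = 0 by rewrite ncombMM.
  rewrite mulrDl !mulrDr e3 s2M -e1 -e2; ring.
have Pq u : q (P u) = phi (ext_proj u).
  by rewrite /P (linD (ahom_linear q)) s2q ncomb_q addr0.
(* The unit of the extension is (1, -f(1,1)), on which the value of [P] is not immediate. Instead, 1
   - [P 1] is an idempotent lying in the kernel, where all products vanish. *)
have P1 : P 1 = 1.
  have e : q (1 - P 1) = 0 by rewrite ahomB Pq !ahom1 subrr.
  have := ncombMM (fun i => chi i (1 - P 1)) (fun i => chi i (1 - P 1)).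
  rewrite -(ker_ncomb e) mulrBl mul1r mulrBr mulr1 -PM mulr1 subrr subr0.
  by move/eqP; rewrite subr_eq0 => /eqP <-.
have Pa u : aug (P u) = aug u.
  by rewrite -(ahom_aug q) Pq ahom_aug.
exists c, (mkahom Pl P1 PM Pa); split=> // m.
by rewrite mkahomE /P /= (lin0 s2l) add0r.
Qed.

End HarrisonLift.

Lemma HLclass_eq0 (K : fieldType) (L : leibniz_algebra K) n (z : subm (cocycles L
  n)) :
  coboundaries L n (subm_val z) -> HLclass z = 0.
Proof.
move=> cz; rewrite -[RHS](linear0 (@qpi _ _ (inside (cocycles L n) (coboundaries L
  n)))).
by apply/qpiP; rewrite subr0.
Qed.

(** * Obstructions and passage to the next stage *)

Section LiftStage.
Variables (K : fieldType) (L : leibniz_algebra K) (A A0 : augalg K) (q : aughom A A0).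
Variables (r : nat) (n : 'I_r -> A) (chi : 'I_r -> A -> K^o) (s : A0 -> A).
Hypothesis se : small_ext q n chi s.
Variables (C : augalg K) (phi : aughom C A0) (eta : bracket L C).
Hypothesis etad : is_deformation eta.
Variable lam : bracket L A.
Hypothesis lamd : is_deformation lam.
Hypothesis qlam : forall x y, tmap q (lam x y) = push phi eta (tmap q x) (tmap q y).

Let ql := ahom_linear q.
Let lb := deformation_bilin lamd.
Let eb := deformation_bilin etad.

Let q1 (l : L) : tmap q (apure 1 l : atens A L) = apure 1 l :> atens A0 L.
Proof. by rewrite (tmapE ql) ahom1. Qed.

Section Compare.
Variables (B : augalg K) (p : aughom B C) (op : bracket L B) (Phi : aughom B A).
Hypothesis opb : bilin op.
Hypothesis pop : forall x y, tmap p (op x y) = eta (tmap p x) (tmap p y).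
Hypothesis qPhi : forall b, q (Phi b) = phi (p b).

Lemma lift_augcompat : augcompat op.
Proof.
move=> x y; have pa (t : atens B L) : aug_tens t = aug_tens (tmap p t : atens C L).
  by rewrite (aug_tens_tmap _ (ahom_linear p)) //; apply: ahom_aug.
by rewrite pa pop; case: etad => _ ->; rewrite -!pa.
Qed.

(** Kernel coordinates of [lam] minus the image of [op]; modulo the kernel both reduce to
    [push phi eta]. The operation [op] may violate the Leibniz identity: it will be a lifting on the
    universal extension, and later [eta']. *)
Definition lift_diff i (l m : L) : L :=
  contr (chi i) (lam (apure 1 l) (apure 1 m) - tmap Phi (op (apure 1 l) (apure 1 m))).

Lemma lift_diffE l m : lam (apure 1 l) (apure 1 m) =
  tmap Phi (op (apure 1 l) (apure 1 m)) + inc n (fun i => lift_diff i l m).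
Proof.
have d0 : tmap q (lam (apure 1 l) (apure 1 m)
    - tmap Phi (op (apure 1 l) (apure 1 m)) : tens A L) = 0.
  rewrite (tmapB _ _ ql) qlam !q1 push1 //; apply/eqP; rewrite subr_eq0; apply/eqP.
  rewrite -[RHS]/((tmap q \o tmap Phi) _) -(tmap_comp ql (ahom_linear Phi)).
  have -> : q \o Phi = phi \o p by apply/funext.
  rewrite (tmap_comp (ahom_linear phi) (ahom_linear p)) /=.
  by rewrite pop !(tmapE (ahom_linear p)) ahom1.
by rewrite /lift_diff -(se_tker se d0) addrC subrK.
Qed.

Let diff_linear (f g : L -> atens A L) i : linear (f : L -> tens A L) ->
  linear (g : L -> tens A L) -> linear (fun l => contr (chi i) (f l - g l)).
Proof.
move=> fl gl; apply: (linear_comp (contr_linear (se_chi_lin se i))).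
exact: (@linear_sub _ _ (tens A L)).
Qed.

Lemma lift_diff_linl i m : linear (lift_diff i ^~ m).
Proof.
have [cl _] := bilin_kbilin lb; have [ol _] := push_kbilin Phi opb.
exact: diff_linear (cl _) (ol _).
Qed.

Lemma lift_diff_linr i l : linear (lift_diff i l).
Proof.
have [_ cr] := bilin_kbilin lb; have [_ or] := push_kbilin Phi opb.
exact: diff_linear (cr _) (or _).
Qed.

Lemma lift_diff_jac l m k :
  tmap Phi (jac op (apure 1 l) (apure 1 m) (apure 1 k))
  + inc n (fun i => del2 (lift_diff i) l m k) = 0.
Proof.
have [lL la] := lamd.
rewrite -(jac_lift (se_annih se) lb la opb lift_augcompat lift_diff_linl
            lift_diff_linr lift_diffE).
exact: (is_leibniz_jac lL).
Qed.

End Compare.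

Variables (C' : augalg K) (p : aughom C' C) (eta' : bracket L C').

(** The obstruction evaluated at [c i] is the i-th kernel coordinate of the Jacobiator of [op]
    pushed to A. Since [lam] is Leibniz this is minus the coboundary of [lift_diff i], so
    [omega (c i)] vanishes. An element of the kernel of [pi], given by psi composed with omega, goes
    to the sum of psi(omega(c i)) n i, which is zero; hence [Phi] factors. *)
Lemma lift_stage : is_next_stage eta p eta' ->
  exists Phi : aughom C' A, forall c, q (Phi c) = phi (p c).
Proof.
case=> sigma [phib [omega [pi [sigmaK [pm [op [opl opr opp opi] phibE]] omegaE
  [pis pik ppi] _]]]].
have [c [Phi [qPhi Phii]]] := harr_lift se phi sigmaK.
have Pl := ahom_linear Phi.
pose prj := @ext_proj _ _ _ (dual_harr sigma) : ext (dual_harr sigma) -> C.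
have pl : linear prj by [].
pose P : aughom (ext (dual_harr sigma)) C :=
  @mkahom _ _ _ prj pl erefl (fun _ _ => erefl) (fun _ => erefl).
have opb : bilin op by [].
have il : linear (ext_incl (dual_harr sigma) : _ -> ext (dual_harr sigma)).
  move=> k x y; rewrite /ext_incl; congr (_, _).
  by apply/esym; apply: (etrans (addr0 _) (scaler0 _ _)).
have J := lift_diff_jac (p := P) opb opp qPhi.
have om0 i : omega (c i) = 0.
  have [z zE ->] := omegaE (c i).
  apply: HLclass_eq0; exists (- coc2 (lift_diff op Phi i)).
    apply: smemN; apply: coc2_multilinear => l.
    - exact: lift_diff_linl.
    - exact: lift_diff_linr.
  rewrite zE; apply/funext => x.
  rewrite (linN (@delta_linear K L 2)).
  change (tlift (fun m y => dapp m (c i) *: y) (phib x) =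
          - delta (coc2 (lift_diff op Phi i)) x).
  rewrite delta_coc2.
  have jE : jac op (apure 1 (x ord0)) (apure 1 (x o1)) (apure 1 (x ord_max)) =
      tmap (ext_incl (dual_harr sigma)) (phib x).
    have -> : o1 = 1 by apply/val_inj.
    have -> : ord_max = 2 :> 'I_3 by apply/val_inj.
    exact: phibE.
  have := congr1 (contr (chi i)) (J (x ord0) (x o1) (x ord_max)).
  rewrite jE (linD (contr_linear (se_chi_lin se i))) (contr_inc se).
  rewrite (lin0 (contr_linear (se_chi_lin se i))).
  rewrite contr_tmap //; last exact: (se_chi_lin se).
  rewrite contr_tmap //; last exact: (linear_comp (se_chi_lin se i) Pl).
  have -> : (chi i \o Phi) \o ext_incl (dual_harr sigma) =
      (fun m => dapp m (c i)) :> (dual (harrH2 C K^o) -> K^o).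
    by apply/funext => m /=; rewrite Phii (chi_ncomb se).
  by move=> /eqP; rewrite addr_eq0 => /eqP.
have ker b : pi b = 0 -> Phi b = 0.
  move=> /pik[psi ->]; rewrite Phii /ncomb big1 // => i _.
  rewrite /transpose /dapp /= om0.
  have psil : linear (subm_val psi : _ -> K^o) := submP psi.
  by rewrite (lin0 psil) scale0r.
have [g gE] := ahom_factor pis ker.
exists g => c0; have [b <-] := pis c0.
by rewrite gE qPhi ppi.
Qed.

End LiftStage.

Definition ahom_id (K : fieldType) (A : augalg K) : aughom A A :=
  @AugHom K A A idfun (fun=> erefl).

(** * The first base and correction by derivations *)

Section FirstStage.
Variables (K : fieldType) (L : leibniz_algebra K) (C0 : augalg K).
Variable iota : aughom (first_base L) C0.
Hypothesis iotab : bijective iota.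

Lemma first_stage_inv :
  exists j : aughom C0 (first_base L), cancel iota j /\ cancel j iota.
Proof.
case: iotab => g gK Kg.
have surj c : exists b, iota b = c by exists (g c); apply: Kg.
have ker b : iota b = 0 -> ahom_id (first_base L) b = 0.
  by move=> b0; rewrite /= -[b]gK b0 -(lin0 (ahom_linear iota)) gK.
have [j jK] := ahom_factor surj ker; exists j; split=> // c.
by have [b <-] := surj c; rewrite jK.
Qed.

Lemma first_base_mul2 (u v : first_base L) :
  (u * v).2 = aug u *: v.2 + aug v *: u.2.
Proof. by rewrite [LHS]addr0. Qed.

End FirstStage.

Lemma pure_ncomb (K : fieldType) (A : augalg K) (L : lmodType K) r (n : 'I_r -> A)
    (u : 'I_r -> K) (l : L) : pure (ncomb n u) l = \sum_i pure (n i) (u i *: l).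
Proof.
rewrite /ncomb (lin_sum (pure_linl l)); apply: eq_bigr => i _; exact: pureZ.
Qed.

Lemma dapp_lin (K : fieldType) (V : lmodType K) k (a b : dual V) (v : V) :
  dapp (k *: a + b) v = k * dapp a v + dapp b v.
Proof. by []. Qed.

Section Correction.
Variables (K : fieldType) (L : leibniz_algebra K) (A A0 : augalg K) (q : aughom A A0).
Variables (r : nat) (n : 'I_r -> A) (chi : 'I_r -> A -> K^o) (s : A0 -> A).
Hypothesis se : small_ext q n chi s.
Variables (C0 C' : augalg K) (eta0 : bracket L C0) (eta' : bracket L C').
Variable pi0 : aughom C' C0.
Hypothesis first : is_first_stage eta0.
Hypothesis push0 : is_pushout pi0 eta' eta0.
Variable Phi : aughom C' A.
Variable beta : 'I_r -> L -> L -> L.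
Hypothesis betal : forall i m, linear (beta i ^~ m).
Hypothesis betar : forall i l, linear (beta i l).
Hypothesis beta_cocycle : forall i l m k, del2 (beta i) l m k = 0.

(* Derivations of C' through C_0 = K + H' realise every class of HL^2. *)
Lemma correction : exists (Psi : aughom C' A) (b : 'I_r -> L -> L),
  [/\ forall c, q (Psi c) = q (Phi c),
      forall i, linear (b i)
    & forall l m, inc n (fun i => beta i l m) =
        tmap Psi (eta' (apure 1 l) (apure 1 m)) - tmap Phi (eta' (apure 1 l) (apure
          1 m))
        + inc n (fun i => del1 (b i) l m)].
Proof.
have [d [h [g [mu [iota [[hg _] muK iotab _ eta0E]]]]]] := first.
have [j [jK Kj]] := first_stage_inv iotab.
have zP i : cocycles L 2 (coc2 (beta i)).
  split; first by apply: coc2_multilinear.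
  by apply/funext => x; rewrite delta_coc2 beta_cocycle.
pose z i := mksub (zP i); pose c i : HL L 2 := HLclass (z i).
(* [beta i] and [mu (c i)] represent the same class, hence differ by a coboundary. *)
have bP i : exists b : L -> L, linear b /\
    forall l m, beta i l m = subm_val (mu (c i)) (pair2 l m) + del1 b l m.
  have /qpiP := esym (muK (c i)).
  case=> f fm fE; exists (fun l => f (fun=> l)); split.
    exact: cochain1_linear.
  move=> l m; have := congr1 (fun F => F (pair2 l m)) fE.
  rewrite {1}(coc1K f) delta_coc1.
  change (beta i l m - subm_val (mu (c i)) (pair2 l m) =
    del1 (fun l => f (fun=> l)) l m ->
    beta i l m = subm_val (mu (c i)) (pair2 l m) + del1 (fun l => f (fun=> l)) l m).
  by move=> <-; rewrite addrC subrK.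
have [b bE] := choice bP.
(* The derivation of K + H' into the kernel that evaluates the component in H' at each class [c i].
   Adding it to [Phi] preserves multiplicativity because the kernel has square zero. *)
pose T (y : C0) := ncomb n (fun i => dapp (j y).2 (c i)).
have Tl : linear T.
  move=> k x y; rewrite /T ncombZ ncombD; apply: eq_bigr => i _.
  have -> : (j (k *: x + y)).2 = k *: (j x).2 + (j y).2.
    by rewrite (ahom_linear j k x y).
  by rewrite dapp_lin.
have TM x y : T (x * y) = aug x *: T y + aug y *: T x.
  rewrite /T !ncombZ ncombD; apply: eq_bigr => i _; congr (_ *: _).
  by rewrite ahomM first_base_mul2 !ahom_aug.
have T1 : T 1 = 0.
  have := TM 1 1; rewrite mulr1 rmorph1 scale1r => /eqP.
  by rewrite -subr_eq0 opprD addrA subrr add0r oppr_eq0 => /eqP.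
have Tg i : T (iota (ext_incl _ (g i))) = ncomb n (fun k => dapp (g i) (c k)).
  by rewrite /T jK.
have Tq y : q (T y) = 0 by apply: (ncomb_q se).
have Ta x y : x * T y = aug x *: T y by apply: (ncombM se).
have T0 y : aug (T y) = 0 by apply: (ncomb_aug se).
clearbody T.
pose S c := T (pi0 c).
have Sl : linear S by apply: linear_comp => //; apply: ahom_linear.
pose P c := Phi c + S c.
have Pl : linear P by apply: linear_add => //; apply: ahom_linear.
have P1 : P 1 = 1 by rewrite /P /S !ahom1 T1 addr0.
have PM : {morph P : x y / x * y}.
  move=> x y; rewrite /P /S !ahomM TM !ahom_aug mulrDl !mulrDr.
  rewrite [T (pi0 x) * Phi y]mulrC !Ta T0 !ahom_aug scale0r addr0.
  by rewrite -addrA.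
have Pq c0 : q (P c0) = q (Phi c0) by rewrite (linD (ahom_linear q)) Tq addr0.
have Pa x : aug (P x) = aug x by rewrite -(ahom_aug q) Pq !ahom_aug.
exists (mkahom Pl P1 PM Pa), b; split=> // [i|l m]; first by case: (bE i).
rewrite (tmap_add _ (ahom_linear Phi) Sl) [X in _ = X + _]addrAC subrr add0r.
rewrite (tmap_comp Tl (ahom_linear pi0)) /= -push0 eta0E.
rewrite (tmapD _ _ Tl) (tmapE Tl) T1 pure0l add0r (lin_sum (tmap_linear Tl)).
under eq_bigr => i _ do rewrite (tmapE Tl) Tg pure_ncomb pair2E.
rewrite exchange_big /=.
(* By duality of the bases, the sum over i of [dapp (g i) (c k)] times [mu (h i)] is [mu (c k)]. *)
have -> : \sum_i0 \sum_i pure (n i0) (dapp (g i) (c i0) *: subm_val (mu (h i))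
  (pair2 l m))
    = inc n (fun i => subm_val (mu (c i)) (pair2 l m)).
  apply: eq_bigr => i _; rewrite -(lin_sum (pure_linr _)); congr (pure _ _).
  rewrite [in RHS](hg (c i)) linear_sum.
  have subl : linear (fun w : subm (cocycles L 2) => subm_val w (pair2 l m)) by [].
  by rewrite (lin_sum subl); apply: eq_bigr => k _; rewrite linearZ.
rewrite incD; apply: eq_inc => i.
by have [_ ->] := bE i.
Qed.
End Correction.

(** * The inductive step *)

(** The map is a parameter and not existentially quantified, because compatibility between
    successive levels concerns the maps themselves. *)
Record equivalence (K : fieldType) (L : leibniz_algebra K) (A : augalg K)
    (lam lam' : bracket L A) (rho : atens A L -> atens A L) : Prop := Equivalence {
  equiv_lin : linear rho;
  equiv_bij : bijective rho;
  equivM : forall x y, rho (lam x y) = lam' (rho x) (rho y);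
  equiv_aug : forall x, aug_tens (rho x) = aug_tens x }.

Section Step.
Variables (K : fieldType) (L : leibniz_algebra K) (A A0 : augalg K) (q : aughom A A0).
Variables (r : nat) (n : 'I_r -> A) (chi : 'I_r -> A -> K^o) (s : A0 -> A).
Hypothesis se : small_ext q n chi s.

(** The A-linear map given by 1 + b on generators covers the identity of A0 (x) L, so [lift_bij]
    applies. *)
Lemma unipotent (b : 'I_r -> L -> L) (bl : forall i, linear (b i)) :
  exists rho : atens A L -> atens A L,
    [/\ linear rho, bijective rho, forall x, tmap q (rho x) = tmap q x
      & forall l, rho (apure 1 l) = apure 1 l + inc n (fun i => b i l)].
Proof.
have ql := ahom_linear q.
pose c (l : L) : atens A L := apure 1 l + inc n (fun i => b i l).
have cl : linear (c : L -> tens A L).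
  move=> k l m; rewrite /c apure1P atens_scaleK scalerDr [RHS]addrACA.
  rewrite -(inc_lin (se_annih se)); congr (_ + _).
  by apply: eq_inc => i; rewrite bl.
have al := alin_linear cl; exists (alin c).
have c1 l : alin c (apure 1 l) = c l by rewrite alinE // scale1r.
have qc x : tmap q (alin c x) = tmap q x.
  elim/(@atens_ind K A L): x => [l|a u v Iu Iv].
    by rewrite c1 (tmapD _ _ ql) (tmap_inc se) addr0.
  by rewrite al !(tmapD _ _ ql) !tmap_ahomZ Iu Iv.
split=> //; apply: (lift_bij (rho0 := id) se) => //.
by exists id.
Qed.

(** Transport of [lam] along a lift of [rho0] gives [lam1], which reduces exactly to [push phi eta].
    Compared with [eta'], which unlike a mere lifting is Leibniz, the difference is a cocycle.
    [correction] splits it into a change of [Phi] and a coboundary, and a unipotent equivalence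
    absorbs the latter. *)
Lemma versal_step (C C' C0 : augalg K) (phi : aughom C A0) (p : aughom C' C)
    (pi0 : aughom C' C0) (eta : bracket L C) (eta' : bracket L C')
    (eta0 : bracket L C0) (lam : bracket L A) (lam0 : bracket L A0)
    (rho0 : atens A0 L -> atens A0 L) :
  is_deformation eta -> is_next_stage eta p eta' ->
  is_first_stage eta0 -> is_pushout pi0 eta' eta0 ->
  is_deformation lam ->
  (forall x y, tmap q (lam x y) = lam0 (tmap q x) (tmap q y)) ->
  equivalence lam0 (push phi eta) rho0 ->
  exists (Phi : aughom C' A) (rho : atens A L -> atens A L),
    [/\ forall c, q (Phi c) = phi (p c),
        equivalence lam (push Phi eta') rho
      & forall x, tmap q (rho x) = rho0 (tmap q x)].
Proof.
move=> etad next first push0 lamd qlam [rl0 rb0 rM0 ra0].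
have ql := ahom_linear q.
have [rho1 rl1 qr1] := lift_exists se rl0.
have ra1 := lift_aug ra0 qr1.
have rb1 := lift_bij se rl0 rl1 rb0 ra0 qr1.
have [g gK Kg] := rb1.
pose lam1 x y := rho1 (lam (g x) (g y)).
have lamd1 : is_deformation lam1 by apply: (transport_deformation lamd).
have qlam1 x y : tmap q (lam1 x y) = push phi eta (tmap q x) (tmap q y).
  by rewrite /lam1 qr1 qlam rM0 -!qr1 !Kg.
have [_ [_ [_ [_ [_ _ _ _ [etad' po]]]]]] := next.
have eb' := deformation_bilin etad'; have eb := deformation_bilin etad.
have pet := pushout_tmap eb' eb po.
have [Phi qPhi] := lift_stage se etad lamd1 qlam1 next.
have bl := lift_diff_linl se lamd1 Phi eb'.
have br := lift_diff_linr se lamd1 Phi eb'.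
have bE := lift_diffE se etad qlam1 pet qPhi.
have bJ := lift_diff_jac se etad lamd1 qlam1 eb' pet qPhi.
have bc i l m k : del2 (lift_diff chi lam1 eta' Phi i) l m k = 0.
  have := bJ l m k; rewrite (is_leibniz_jac (proj1 etad')).
  rewrite (lin0 (tmap_linear (ahom_linear Phi))) add0r.
  move/(congr1 (contr (chi i))); rewrite (contr_inc se).
  by rewrite (lin0 (contr_linear (se_chi_lin se i))).
have [Psi [b [qPsi bl1 bE1]]] := correction se first push0 Phi bl br bc.
have [rho2 [rl2 rb2 qr2 r2E]] := unipotent bl1.
have pd : is_deformation (push Psi eta') by apply: push_deformation.
have ra2 x : aug_tens (rho2 x) = aug_tens x.
  by rewrite -[LHS](aug_tens_tmap _ ql (ahom_aug q)) qr2 (aug_tens_tmap _ ql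
    (ahom_aug q)).
have rM2 x y : rho2 (lam1 x y) = push Psi eta' (rho2 x) (rho2 y).
  have [[ll lr _] la] := lamd1; have [[pl pr _] pa] := pd.
  apply: (bilin_eq (op1 := fun x y => rho2 (lam1 x y))
                   (op2 := fun x y => push Psi eta' (rho2 x) (rho2 y))).
  - by split=> w a u v; rewrite ?ll ?lr rl2.
  - by split=> w a u v; rewrite rl2 ?pl ?pr.
  have cancel3 (u v w : atens A L) : u + v - u + w - v - w = 0.
    by rewrite [u + v]addrC addrK addrAC addrK subrr.
  move=> l m; apply/eqP; rewrite -subr_eq0; apply/eqP.
  rewrite (equiv_lift (se_annih se) (se_aug se) (deformation_bilin lamd1) la
             (deformation_bilin pd) pa rl2 r2E bl1).
  rewrite (push1 _ eb') bE bE1 !addrA; exact: cancel3.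
exists Psi, (rho2 \o rho1); split.
- by move=> c; rewrite qPsi qPhi.
- split.
  + by move=> a u v; rewrite /= rl1 rl2.
  + exact: bij_comp.
  + by move=> x y /=; rewrite -rM2 /lam1 !gK.
  + by move=> x /=; rewrite ra2 ra1.
- by move=> x /=; rewrite qr2 qr1.
Qed.

End Step.

(** * Truncations *)

Section FiniteDimension.
Variable K : fieldType.

Lemma sum_independent (V : lmodType K) d (e : 'I_d -> V) :
  (forall c : 'I_d -> K, \sum_i c i *: e i = 0 -> forall i, c i = 0) ->
  forall c c' : 'I_d -> K, \sum_i c i *: e i = \sum_i c' i *: e i -> c =1 c'.
Proof.
move=> ind c c' cc' i; apply/eqP; rewrite -subr_eq0; apply/eqP.
apply: (ind (fun i => c i - c' i)).
under eq_bigr => j _ do rewrite scalerBl.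
by rewrite sumrB cc' subrr.
Qed.

(** A spanning family of minimal length is independent, so coordinates with respect to it are
    unique, hence linear. *)
Lemma finite_basis (V : lmodType K) : finite_dim V ->
  exists d (e : 'I_d -> V) (g : 'I_d -> V -> K^o),
    [/\ forall i, linear (g i), forall v, v = \sum_i (g i v : K) *: e i
      & forall i j, g i (e j) = (i == j)%:R].
Proof.
move=> [d0 sp0].
pose P d := `[< exists e : 'I_d -> V,
  forall v, exists c : 'I_d -> K, v = \sum_i c i *: e i >].
have exP : exists d, P d by exists d0; apply/asboolP.
case: (ex_minnP exP) => d /asboolP[e sp] dmin.
have ind c : \sum_i c i *: e i = 0 -> forall i, c i = 0.
  move=> c0 k; apply: contrapT => ck.
  case: d e sp dmin c c0 k ck => [|d] e sp dmin c c0 k ck; first by case: k {ck}.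
  suff /dmin : P d by rewrite ltnn.
  apply/asboolP; exists (fun i => e (fintype.lift k i)) => v.
  have [c' ->] := sp v; exists (fun i => c' (fintype.lift k i) - c' k / c k * c
    (fintype.lift k i)).
  have -> : \sum_i c' i *: e i = \sum_i (c' i - c' k / c k * c i) *: e i.
    under [RHS]eq_bigr => i _ do rewrite scalerBl -scalerA.
    by rewrite sumrB -scaler_sumr c0 scaler0 subr0.
  rewrite (bigD1_ord k) //= divfK; last by apply/eqP.
  by rewrite subrr scale0r add0r.
have [g gE] := choice sp.
exists d, e, (fun i v => g v i); split=> [i k u v|v|i j]; last 1 first.
- apply: (sum_independent ind (c' := fun i => (i == j)%:R)).
  rewrite -gE (bigD1 j) //= big1 => [|l lj].
    by rewrite eqxx scale1r addr0.
  by rewrite (negbTE lj) scale0r.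
- apply: (sum_independent ind (c' := fun i => k * g u i + g v i)).
  rewrite -gE; under eq_bigr => j _ do rewrite scalerDl -scalerA.
  by rewrite big_split /= -scaler_sumr -!gE.
- exact: gE.
Qed.

Lemma finite_dim_span (V : lmodType K) (d1 d2 : nat) (e1 : 'I_d1 -> V) (e2 : 'I_d2
  -> V) :
  (forall v, exists c1 c2, v = \sum_i c1 i *: e1 i + \sum_i c2 i *: e2 i) ->
  finite_dim V.
Proof.
move=> sp; exists (d1 + d2)%N.
exists (fun i => match fintype.split i with inl j => e1 j | inr j => e2 j end) => v.
have [c1 [c2 ->]] := sp v.
exists (fun i => match fintype.split i with inl j => c1 j | inr j => c2 j end).
rewrite big_split_ord /=; congr (_ + _); apply: eq_bigr => i _.
  by case: fintype.splitP => j /= e; [congr (c1 _ *: e1 _); apply/val_inj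
    | have := ltn_ord i; rewrite e ltnNge leq_addr].
case: fintype.splitP => j /= e; first by have := ltn_ord j; rewrite -e ltnNge
  leq_addr.
by move/eqP: e; rewrite eqn_add2l => /eqP e; congr (c2 _ *: e2 _); apply/val_inj.
Qed.

Lemma finite_dim_surj (U V : lmodType K) (f : U -> V) : linear f ->
  (forall v, exists u, f u = v) -> finite_dim U -> finite_dim V.
Proof.
move=> fl fs [d [e sp]]; exists d, (fun i => f (e i)) => v.
have [u <-] := fs v; have [c ->] := sp u; exists c.
by rewrite (lin_sum fl); apply: eq_bigr => i _; rewrite (linZ fl).
Qed.

End FiniteDimension.

Section KernelSubmod.
Variables (K : fieldType) (A A0 : augalg K) (q : aughom A A0).

Lemma ker_mem0 : q 0 = 0. Proof. exact: rmorph0. Qed.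
Lemma ker_memP a u v : q u = 0 -> q v = 0 -> q (a *: u + v) = 0.
Proof. by move=> u0 v0; rewrite (ahom_linear q) u0 v0 scaler0 addr0. Qed.
Definition kersub : submod A := Submod ker_mem0 ker_memP.

(** [s] lifts a basis of [A0], and the [chi i] are the kernel coordinates of a - s(q a). *)
Lemma small_ext_exists : (forall a, exists b, q b = a) -> finite_dim A0 ->
  finite_dim (subm kersub) -> (forall a x, q x = 0 -> a * x = aug a *: x) ->
  exists r (n : 'I_r -> A) chi s, small_ext q n chi s.
Proof.
move=> qs fd0 fdk ann.
have [d [e [g [gl gE _]]]] := finite_basis fd0.
have [r [n [f [fl fE fn]]]] := finite_basis fdk.
have [e' e'E] := choice (fun i => qs (e i)).
pose s a := \sum_i (g i a : K) *: e' i.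
have sl : linear s.
  apply: linear_bigsum => i; exact: linear_scalel.
have sK a : q (s a) = a.
  rewrite /s (lin_sum (ahom_linear q)) [RHS]gE; apply: eq_bigr => i _.
  by rewrite (linZ (ahom_linear q)) e'E.
have dP a : kersub (a - s (q a)) by rewrite /= ahomB sK subrr.
pose chi i a : K^o := f i (mksub (dP a)).
exists r, (fun i => subm_val (n i)), chi, s; split=> //.
- move=> a i; apply: ann; exact: (submP (n i)).
- move=> i; exact: (submP (n i)).
- move=> i k x y; rewrite /chi -fl; congr (f i _); apply/val_inj => /=.
  by rewrite (ahom_linear q) sl scalerBr opprD addrACA.
- move=> i j; rewrite /chi -fn; congr (f i _); apply/val_inj => /=.
  by rewrite (submP (n j) : q _ = 0) (lin0 sl) subr0.
- move=> a; have vl : linear (fun w : subm kersub => subm_val w) by [].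
  have := congr1 (fun w : subm kersub => subm_val w) (fE (mksub (dP a))).
  rewrite (lin_sum vl) /= => <-; by rewrite addrC subrK.
Qed.

End KernelSubmod.

Section Truncations.
Variables (K : fieldType) (A : augalg K).
Hypothesis base : is_base A.

Lemma apow_layer k : exists d (u : 'I_d -> A), (forall i, apow A k (u i)) /\
  forall a, apow A k a -> exists c : 'I_d -> K, apow A k.+1 (a - \sum_i c i *: u i).
Proof.
have [d [e sp]] := base k.
exists d, (fun i => subm_val (repr (e i))); split=> [i|a ka]; first exact: submP.
have [c cE] := sp (subpi _ (mksub ka)); exists c.
have vl : linear (fun w : subm (apow A k) => subm_val w) by [].
have : subpi (apow A k.+1) (mksub ka) = subpi (apow A k.+1) (\sum_i c i *: repr (e
  i)).
  rewrite cE /subpi linear_sum; apply: eq_bigr => i _.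
  by rewrite linearZ /= qreprK.
move/qpiP => h.
have <- : subm_val (\sum_i c i *: repr (e i)) = \sum_i c i *: subm_val (repr (e i)).
  by rewrite (lin_sum vl).
exact: h.
Qed.

Lemma trunc_finite_dim k : finite_dim (trunc A k).
Proof.
elim: k => [|k [d1 [e1 sp1]]].
  have [d [u [_ uE]]] := apow_layer 0; exists d, (fun i => tpi 0 (u i)).
  elim/tpi_ind => a; have [c cE] := uE a I; exists c.
  transitivity (tpi 0 (\sum_i c i *: u i)); first exact/tpiP.
  rewrite (lin_sum (@tpi_linear K A 0)); apply: eq_bigr => i _.
  exact: linZ (@tpi_linear K A 0) _ _.
have [d [u [_ uE]]] := apow_layer k.+1.
apply: (finite_dim_span (e1 := fun i => tpi k.+1 (repr (e1 i) : A)) (e2 := fun i =>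
  tpi k.+1 (u i))).
elim/tpi_ind => a; have [c1 c1E] := sp1 (tpi k a).
have /tpiP/uE[c2 c2E] : tpi k a = tpi k (\sum_i c1 i *: (repr (e1 i) : A)).
  rewrite c1E (lin_sum (@tpi_linear K A k)); apply: eq_bigr => i _.
  by rewrite (linZ (@tpi_linear K A k)); congr (_ *: _); rewrite [RHS]qreprK.
exists c1, c2; have tl := @tpi_linear K A k.+1.
transitivity (tpi k.+1 (\sum_i c1 i *: (repr (e1 i) : A) + \sum_i c2 i *: u i)).
  by apply/tpiP; rewrite opprD addrA.
rewrite (linD tl) !(lin_sum tl).
by congr (_ + _); apply: eq_bigr => i _; rewrite (linZ tl).
Qed.

Lemma tstep1 k : trunc_step (1 : trunc A k.+1) = 1.
Proof. exact: trunc_stepE. Qed.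

Lemma tstep_aug k (x : trunc A k.+1) : aug (trunc_step x : trunc A k) = aug x.
Proof.
elim/tpi_ind: x => a; rewrite trunc_stepE.
by rewrite [LHS]trunc_augE [RHS]trunc_augE.
Qed.

Definition tstep k : aughom (trunc A k.+1) (trunc A k) :=
  mkahom (@trunc_step_linear K A k) (tstep1 k) (@trunc_stepM K A k) (@tstep_aug k).

Lemma tstepE k a : tstep k (tpi k.+1 a) = tpi k a.
Proof. exact: trunc_stepE. Qed.

(** The kernel is M^(k+1)/M^(k+2), one of the layers whose dimension [is_base] makes finite. *)
Lemma tstep_small k : exists r (n : 'I_r -> trunc A k.+1) chi s,
  small_ext (tstep k) n chi s.
Proof.
apply: small_ext_exists.
- by elim/tpi_ind => a; exists (tpi k.+1 a); apply: tstepE.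
- exact: trunc_finite_dim.
- have [d [u [uk uE]]] := apow_layer k.+1.
  have uk' i : kersub (tstep k) (tpi k.+1 (u i)).
    by rewrite /= trunc_stepE -(lin0 (@tpi_linear K A k)); apply/tpiP; rewrite subr0.
  exists d, (fun i => mksub (uk' i)) => w.
  case: w (submP w) => /= x xP; elim/tpi_ind: x xP => a aP.
  rewrite trunc_stepE -(lin0 (@tpi_linear K A k)) => /tpiP.
  rewrite subr0 => /uE[c cE]; exists c; apply/val_inj => /=.
  have vl : linear (fun w : subm (kersub (tstep k)) => subm_val w) by [].
  have tl := @tpi_linear K A k.+1.
  rewrite (lin_sum vl) /=.
  transitivity (tpi k.+1 (\sum_i c i *: u i)); first exact/tpiP.
  by rewrite (lin_sum tl); apply: eq_bigr => i _; rewrite (linZ tl).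
elim/tpi_ind => b; elim/tpi_ind => a; rewrite tstepE.
rewrite -(lin0 (@tpi_linear K A k)) => /tpiP; rewrite subr0 => ka.
have -> : aug (tpi k.+1 b : trunc A k.+1) = aug b by exact: trunc_augE.
rewrite -(linZ (@tpi_linear K A k.+1)).
transitivity (tpi k.+1 (b * a)); first by rewrite -rmorphM.
(* [b] differs from its augmentation by an element of M, which sends M^(k+1) into M^(k+2). *)
apply/tpiP; apply: span_sub; exists (b - (aug b)%:A), a; split=> //.
- by rewrite rmorphB augZ rmorph1 mulr1 subrr.
- by rewrite mulrBl -scalerAl mul1r.
Qed.

End Truncations.

(** * Existence *)

Lemma dependent_choice (T : nat -> Type) (P : forall k, T k -> Prop)
    (R : forall k, T k -> T k.+1 -> Prop) :
  (exists x, P 0%N x) -> (forall k x, P k x -> exists y, P k.+1 y /\ R k x y) ->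
  exists f : forall k, T k, (forall k, P k (f k)) /\ forall k, R k (f k) (f k.+1).
Proof.
move=> ex0 exS.
pose U k := {x : T k | P k x}.
pose next k (u : U k) : U k.+1 :=
  let: exist x Px := u in
  let: exist y Py := cid (exS k x Px) in exist _ y (proj1 Py).
have nextR k u : R k (sval u) (sval (next k u)).
  by case: u => x Px /=; case: cid => y [].
have [x0 Px0] := cid ex0.
pose f := nat_rect U (exist _ x0 Px0) next.
exists (fun k => sval (f k)); split=> k; first exact: svalP.
exact: nextR.
Qed.

(** Homomorphisms preserve augmentations, so a preimage of an element of the augmentation ideal lies
    in the augmentation ideal, and products lift factor by factor. *)
Lemma apow_surj (K : fieldType) (A A' : augalg K) (f : aughom A A') k (z : A') :
  (forall y, exists x, f x = y) -> apow A' k z -> exists2 x, apow A k x & f x = z.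
Proof.
move=> fs; elim: k z => [|k IHk] z; first by have [x] := fs z; exists x.
have W0 : exists2 x, apow A k.+1 x & f x = 0.
  by exists 0; [apply: smem0 | apply: rmorph0].
have WP a u v : (exists2 x, apow A k.+1 x & f x = u) ->
    (exists2 x, apow A k.+1 x & f x = v) ->
    exists2 x, apow A k.+1 x & f x = a *: u + v.
  move=> [x xk <-] [y yk <-]; exists (a *: x + y); first exact: smemP.
  exact: ahom_linear.
apply: (span_min (W := Submod W0 WP)) => _ [m [y [m0 /IHk[y' ky <-] ->]]].
have [x xm] := fs m; exists (x * y'); last by rewrite ahomM xm.
by apply: span_sub; exists x, y'; split=> //; rewrite -(ahom_aug f) xm.
Qed.

Definition tpi_hom (K : fieldType) (A : augalg K) n : aughom A (trunc A n) :=
  @mkahom K A (trunc A n) (@tpi K A n) (@tpi_linear K A n) erefl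
    (fun x y => rmorphM (@tpi K A n) x y) (@trunc_augE K A n).

Lemma trunc_nilpotent (K : fieldType) (A : augalg K) n (z : trunc A n) :
  apow (trunc A n) n.+1 z -> z = 0.
Proof.
move=> /(@apow_surj K A (trunc A n) (tpi_hom A n))[]; first by elim/tpi_ind=> a;
  exists a.
move=> a ka <-; rewrite -(lin0 (@tpi_linear K A n)); apply/tpiP.
by rewrite subr0.
Qed.

Section Tower.
Variables (K : fieldType) (L : leibniz_algebra K).
Variables (C : nat -> augalg K) (p : forall k, aughom (C k.+1) (C k)).
Variable etak : forall k, bracket L (C k).
Arguments etak : clear implicits.
Hypothesis constr : is_construction p etak.

Lemma tower_deformation k : is_deformation (etak k).
Proof.
case: constr => [[d [h [g [mu [iota [_ _ _ + _]]]]]] next]; case: k => // k _.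
by have [_ [_ [_ [_ [_ _ _ _ []]]]]] := next k.
Qed.

Lemma tower_pushout k : is_pushout (p k) (etak k.+1) (etak k).
Proof. by case: constr => _ /(_ k) [_ [_ [_ [_ [_ _ _ _ []]]]]]. Qed.

Fixpoint tower_proj k : aughom (C k) (C 0%N) :=
  if k is k'.+1 then ahom_comp (tower_proj k') (p k') else ahom_id (C 0%N).

Lemma tower_proj_pushout k : is_pushout (tower_proj k) (etak k) (etak 0%N).
Proof.
elim: k => [|k IHk] l m; first by rewrite tmap_id.
rewrite IHk tower_pushout.
by rewrite (tmap_comp (ahom_linear (tower_proj k)) (ahom_linear (p k))).
Qed.

Section Existence.
Variables (A : augalg K) (lam : cbracket L A).
Hypotheses (base : is_base A) (Acomplete : complete_local A).
Variable lamn : forall n, bracket L (trunc A n).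
Arguments lamn : clear implicits.
Hypothesis lamnd : forall n, is_deformation (lamn n).
Hypothesis lamE : forall x y n, lam x y n = lamn n (x n) (y n).

Lemma cpure_level n (l : L) : cpure (1 : A) l n = apure 1 l.
Proof. by rewrite /= (tmapE (@tpi_linear K A n)) rmorph1. Qed.

Lemma lamn_step n x y : tmap (tstep A n) (lamn n.+1 x y) =
  lamn n (tmap (tstep A n) x) (tmap (tstep A n) y).
Proof.
apply: pushout_tmap; try exact: deformation_bilin.
move=> l m; rewrite -!cpure_level -!lamE.
by rewrite (level_step (lam (cpure 1 l) (cpure 1 m))).
Qed.

Lemma trunc0_tens (t : atens (trunc A 0) L) : t = apure 1 (aug_tens t).
Proof.
have x1 (x : trunc A 0) : x = (aug x)%:A.
  elim/tpi_ind: x => a; rewrite [aug _]trunc_augE.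
  rewrite -[1]/(tpi 0 1) -(linZ (@tpi_linear K A 0)); apply/tpiP.
  apply: span_sub; exists (a - (aug a)%:A), 1; split=> //; last by rewrite mulr1.
  by rewrite rmorphB augZ rmorph1 mulr1 subrr.
elim/(@atens_ind K (trunc A 0) L): t => [l|a u v Iu Iv]; first by rewrite aug_tens1.
rewrite aug_tensD aug_tensZ {1}Iu {1}Iv apure1P.
by rewrite -x1.
Qed.

(** [C k] is C_(k+1) and [trunc A k] is A/M^(k+1), so the two towers are matched index by index,
    starting from C_1 -> A/M. *)
Lemma tower_lift : exists F : forall k, aughom (C k) (trunc A k) *
    (atens (trunc A k) L -> atens (trunc A k) L),
  (forall k, equivalence (lamn k) (push (F k).1 (etak k)) (F k).2) /\
  (forall k, (forall c, tstep A k ((F k.+1).1 c) = (F k).1 (p k c)) /\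
     (forall x, tmap (tstep A k) ((F k.+1).2 x) = (F k).2 (tmap (tstep A k) x))).
Proof.
apply: dependent_choice (fun k F => equivalence (lamn k) (push F.1 (etak k)) F.2)
  (fun k (F : _ * (_ -> _)) (F' : _ * (_ -> _)) =>
    (forall c, tstep A k (F'.1 c) = F.1 (p k c)) /\
     (forall x, tmap (tstep A k) (F'.2 x) = F.2 (tmap (tstep A k) x))) _ _.
(* Over A/M = K a deformation is [L] itself, so the augmentation and the identity map start the
   induction. *)
- pose f (c : C 0%N) : trunc A 0 := (aug c)%:A.
  have fl : linear f by move=> k x y; rewrite /f (aug_linear k) scalerDl scalerA.
  have f1 : f 1 = 1 by rewrite /f rmorph1 scale1r.
  have fM : {morph f : x y / x * y}.
    by move=> x y; rewrite /f rmorphM -scalerAl mul1r scalerA.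
  have fa x : aug (f x) = aug x by rewrite /f augZ rmorph1 mulr1.
  exists (mkahom fl f1 fM fa, id); split=> //=; first by exists id.
  move=> x y; rewrite [LHS]trunc0_tens [RHS]trunc0_tens.
  have [_ ->] := lamnd 0.
  by have [_ ->] := push_deformation (mkahom fl f1 fM fa) (tower_deformation 0).
move=> k [F rho] /= eq.
have [r [n [chi [s se]]]] := tstep_small base k.
have [Phi [rho' [Phip eq' rhop]]] := versal_step se (tower_deformation k) (proj2
  constr k)
  (proj1 constr) (tower_proj_pushout k.+1) (lamnd k.+1) (@lamn_step k) eq.
by exists (Phi, rho').
Qed.

Lemma tpi_inj (a b : A) : (forall n, tpi n a = tpi n b) -> a = b.
Proof.
move=> ab; have [_ /(_ (fun n => tpi n a))] := Acomplete.
by case=> [n|c [_ uc]]; rewrite ?trunc_stepE // -(uc a) // -(uc b).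
Qed.

Lemma existence eta : is_limit_deformation etak eta ->
  exists f : aughom (plim p) A, induces eta lam f.
Proof.
move=> [etad limE].
have [F [Feq FS]] := tower_lift.
have ex (x : plim p) : exists a, forall n, tpi n a = (F n).1 (x n).
  have [_ /(_ (fun n => (F n).1 (x n)))] := Acomplete.
  case=> [n|a [aE _]]; last by exists a.
  by have [+ _] := FS n => /(_ (x n.+1)) /= ->; rewrite coord_step.
have [f fE] := choice ex.
have fl : linear f.
  move=> k x y; apply: tpi_inj => n; rewrite (@tpi_linear K A n) !fE.
  exact: (ahom_linear (F n).1).
have f1 : f 1 = 1 by apply: tpi_inj => n; rewrite fE [LHS]ahom1.
have fM : {morph f : x y / x * y}.
  move=> x y; apply: tpi_inj => n; rewrite fE.
  transitivity ((tpi n (f x) : trunc A n) * tpi n (f y)); last by rewrite -rmorphM.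
  rewrite !fE; exact: (ahomM (F n).1).
have fa x : aug (f x) = aug x.
  have := congr1 (fun y : trunc A 0 => aug y) (fE x 0%N).
  by rewrite ahom_aug /= trunc_augE.
pose ff : aughom (plim p) A := mkahom fl f1 fM fa.
have pb n := push_bilin (F n).1 (deformation_bilin (tower_deformation n)).
have pS n x y : tmap (tstep A n) (push (F n.+1).1 (etak n.+1) x y) =
    push (F n).1 (etak n) (tmap (tstep A n) x) (tmap (tstep A n) y).
  apply: pushout_tmap => // l m; rewrite !push1; try exact: (deformation_bilin
    (tower_deformation _)).
  rewrite -[RHS]/((tmap _ \o tmap _) _) tower_pushout.
  rewrite -[LHS]/((tmap _ \o tmap _) _) -!tmap_comp; try exact: ahom_linear.
  by apply: eq_tmap => c /=; have [+ _] := FS n => /(_ c) /= ->.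
(* The push-out is built level by level from the [etak n]; its agreement with the push-out of [eta]
   is checked afterwards on generators. *)
pose lam' (x y : ctens A L) : ctens A L :=
  @CTens _ _ _ (fun n => push (F n).1 (etak n) (x n) (y n))
   (fun n => etrans (pS n _ _) (f_equal2 (push (F n).1 (etak n)) (level_step x n)
     (level_step y n))).
have lamd' : is_formal_deformation lam'.
  have pd n := push_deformation (F n).1 (tower_deformation n).
  split.
  - split=> [y a u v|x a u v|x y z]; apply: ctens_eq => n.
    + exact: (leibniz_linl (proj1 (pd n))).
    + exact: (leibniz_linr (proj1 (pd n))).
    + exact: (leibnizE (proj1 (pd n))).
  - by exists (fun n => push (F n).1 (etak n)).
  - by move=> x y; apply: (proj2 (pd 0%N)).
exists ff, lam'; split.
  split=> // l m; apply: ctens_eq => n.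
  change (push (F n).1 (etak n) (cpure 1 l n) (cpure 1 m n) =
    tmap (trunc_map ff (n := n)) (eta (cpure 1 l) (cpure 1 m) n)).
  rewrite !cpure_level push1; last exact: (deformation_bilin (tower_deformation n)).
  have := congr1 (fun t : ctens (C n) L => t n) (limE n l m).
  change (tmap (trunc_map (plim_proj p n) (n := n)) (eta (cpure 1 l) (cpure 1 m) n) =
    tmap (tpi n) (etak n (apure 1 l) (apure 1 m)) ->
    tmap (F n).1 (etak n (apure 1 l) (apure 1 m)) =
    tmap (trunc_map ff (n := n)) (eta (cpure 1 l) (cpure 1 m) n)).
  (* The hypothesis on [eta] concerns the completion of [C n], hence only its truncations. This
     suffices: the (n+1)-st power of the augmentation ideal of [trunc A n] is zero, so [(F n).1]
     factors through [trunc (C n) n]. *)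
  pose G (y : trunc (C n) n) : trunc A n := (F n).1 (repr y : C n).
  have GE c : G (tpi n c) = (F n).1 c.
    apply/eqP; rewrite -subr_eq0 /G -(ahomB (F n).1); apply/eqP.
    by apply/trunc_nilpotent/ahom_apow/repr_qpi.
  have Gl : linear G.
    move=> k; elim/tpi_ind=> a; elim/tpi_ind=> b.
    by rewrite -(@tpi_linear K (C n) n) !GE (ahom_linear (F n).1).
  have -> : tmap (F n).1 (etak n (apure 1 l) (apure 1 m)) =
      tmap G (tmap (tpi n) (etak n (apure 1 l) (apure 1 m)) : tens (trunc (C n) n) L).
    rewrite -[RHS]/((tmap _ \o tmap _) _) -(tmap_comp Gl (@tpi_linear K (C n) n)).
    by apply: eq_tmap => c; rewrite /= GE.
  move=> <-; rewrite -[LHS]/((tmap _ \o tmap _) _).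
  rewrite -(tmap_comp Gl (@trunc_map_linear _ _ _ (plim_proj p n) n)).
  by apply: eq_tmap; elim/tpi_ind=> x; rewrite /= !trunc_mapE GE fE.
have eqn n := Feq n.
have rP (x : ctens A L) n : tmap (@trunc_step K A n) ((F n.+1).2 (x n.+1)) = (F
  n).2 (x n).
  by have [_ ->] := FS n; rewrite (level_step x n).
pose rho (x : ctens A L) : ctens A L := CTens (rP x).
exists rho; split.
- move=> a x y; apply: ctens_eq => n; exact: (equiv_lin (eqn n)).
- apply: bij_inj_surj => [x y xy|y].
    apply: ctens_eq => n; apply: (bij_inj (equiv_bij (eqn n))).
    exact: (congr1 (fun t : ctens A L => t n) xy).
  have gex n : exists x, (F n).2 x = y n.
    by case: (equiv_bij (eqn n)) => g _ Kg; exists (g (y n)).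
  pose g n := projT1 (cid (gex n)).
  have gE n : (F n).2 (g n) = y n by rewrite /g; case: cid.
  (* Preimages chosen separately at each level are coherent by injectivity. *)
  have gP n : tmap (@trunc_step K A n) (g n.+1) = g n.
    apply: (bij_inj (equiv_bij (eqn n))); have [_ e] := FS n.
    by rewrite -[tmap _ _]/(tmap (tstep A n) _) -e !gE; apply: level_step.
  by exists (CTens gP); apply: ctens_eq => n; apply: gE.
- move=> x y; apply: ctens_eq => n.
  change ((F n).2 (lam x y n) = push (F n).1 (etak n) ((F n).2 (x n)) ((F n).2 (y
    n))).
  by rewrite lamE; apply: (equivM (eqn n)).
- move=> x; exact: (equiv_aug (eqn 0%N)).
Qed.

End Existence.
End Tower.

(** * The square of the augmentation ideal *)

Section SeparatingFunctionals.
Variables (K : fieldType) (V : lmodType K).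

(** Induction on the number of functionals: a vector of [W] on which the first one is nonzero is
    split off, and [W] is cut down to the zero set of that functional. This is why a submodule is
    carried along. *)
Lemma separated_span m (chi : 'I_m -> V -> K^o) (W : submod V) :
  (forall i, linear (chi i)) ->
  (forall w, W w -> (forall i, chi i w = 0) -> w = 0) ->
  exists d (e : 'I_d -> V), (forall i, W (e i)) /\
    forall w, W w -> exists c : 'I_d -> K, w = \sum_i c i *: e i.
Proof.
elim: m chi W => [|m IHm] chi W cl sep.
  exists 0%N, (fun=> 0); split=> [[]//|w Ww]; exists (fun=> 0).
  by rewrite big_ord0; apply: sep => // -[].
pose chi' i := chi (fintype.lift ord0 i).
have cl' i : linear (chi' i) by apply: cl.
have sep0 w : W w -> chi ord0 w = 0 -> (forall i, chi' i w = 0) -> w = 0.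
  move=> Ww w0 w1; apply: sep => // i.
  by have [j ->|->] := unliftP ord0 i; first exact: w1.
have [[v [Wv v0]]|no] := pselect (exists v, W v /\ chi ord0 v <> 0); last first.
  apply: (IHm chi') => // w Ww; apply: sep0 => //.
  by apply: contrapT => w0; apply: no; exists w.
have W0 : W 0 /\ chi ord0 0 = 0 by split; [apply: smem0 | apply: lin0 (cl _)].
have WP a u w : W u /\ chi ord0 u = 0 -> W w /\ chi ord0 w = 0 ->
    W (a *: u + w) /\ chi ord0 (a *: u + w) = 0.
  move=> [Wu u0] [Ww w0]; split; first exact: smemP.
  by rewrite (cl ord0) u0 w0 scaler0 addr0.
have [//||d [e [eW sp]]] := IHm chi' (Submod W0 WP); first by move=> w [Ww w0];
  apply: sep0.
exists d.+1, (fun i => if unlift ord0 i is Some j then e j else v); split=> [i|w Ww].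
  by case: unliftP => [j _|_ //]; case: (eW j).
pose t : K := (chi ord0 w : K) / chi ord0 v.
have [|c cE] := sp (w - t *: v).
  split; first by rewrite -scaleNr addrC; apply: smemP.
  rewrite (linB (cl _)) (linZ (cl _)) /t.
  by rewrite [_ *: _]divfK ?subrr //; apply/eqP.
exists (fun i => if unlift ord0 i is Some j then c j else t).
rewrite big_ord_recl unlift_none.
under eq_bigr => i _ do rewrite liftK.
by rewrite -cE addrC subrK.
Qed.

Lemma separated_finite_dim m (chi : 'I_m -> V -> K^o) :
  (forall i, linear (chi i)) -> (forall v, (forall i, chi i v = 0) -> v = 0) ->
  finite_dim V.
Proof.
move=> cl sep; have [|d [e [_ sp]]] := @separated_span m chi (full_submod V) cl.
  by move=> w _; apply: sep.
by exists d, e => v; apply: sp.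
Qed.

(** Some coordinate functional of the quotient by [W] is nonzero on the class of [v]. *)
Lemma separating_functional (W : submod V) v : finite_dim V -> ~ W v ->
  exists Psi : V -> K^o,
    [/\ linear Psi, forall w, W w -> Psi w = 0 & Psi v <> 0].
Proof.
move=> fV Wv.
have ql : linear (@qpi _ _ W) := linearP _.
have fQ : finite_dim (quot W).
  by apply: (finite_dim_surj ql) => // x; exists (repr x); apply: qreprK.
have [d [e [g [gl gE _]]]] := finite_basis fQ.
have [i gi] : exists i, g i (qpi W v) <> 0.
  apply: contrapT => no; apply: Wv.
  rewrite -[v]subr0; apply/qpiP; rewrite (lin0 ql) [LHS]gE big1 // => i _.
  suff -> : g i (qpi W v) = 0 by rewrite scale0r.
  by apply: contrapT => gi; apply: no; exists i.
exists (g i \o @qpi _ _ W); split=> //; first exact: linear_comp.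
move=> w Ww /=; have -> : qpi W w = 0; last exact: lin0 (gl i).
by rewrite -(lin0 ql); apply/qpiP; rewrite subr0.
Qed.

End SeparatingFunctionals.

Section Duals.
Variable K : fieldType.

Lemma dual_finite_dim (V : lmodType K) : finite_dim V -> finite_dim (dual V).
Proof.
move=> [d [e sp]].
apply: (@separated_finite_dim K (dual V) d (fun i f => dapp f (e i))) => // f f0.
apply: dual_eq => v; have [c ->] := sp v.
have fl : linear (subm_val f : V -> K^o) := submP f.
rewrite /dapp (lin_sum fl) big1 // => i _.
by rewrite (linZ fl); have := f0 i; rewrite /dapp => ->; rewrite scaler0.
Qed.

Lemma dual_reflexive (V : lmodType K) (psi : dual V -> K^o) : finite_dim V ->
  linear psi -> exists v, forall f, psi f = dapp f v.
Proof.
move=> /finite_basis[d [e [g [gl gE _]]]] pl.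
exists (\sum_i (psi (mkdual (gl i)) : K) *: e i) => f.
have fE : f = \sum_i dapp f (e i) *: mkdual (gl i).
  apply: dual_eq => v; have fl : linear (subm_val f : V -> K^o) := submP f.
  have evl : linear (fun w : dual V => dapp w v : K^o) by [].
  rewrite (lin_sum evl) {1}/dapp [in LHS](gE v) (lin_sum fl).
  apply: eq_bigr => i _; rewrite (linZ fl) (linZ evl); exact: mulrC.
have fl : linear (subm_val f : V -> K^o) := submP f.
rewrite [in LHS]fE (lin_sum pl) /dapp (lin_sum fl); apply: eq_bigr => i _.
rewrite (linZ pl) (linZ fl); exact: mulrC.
Qed.

End Duals.

Lemma aug_apow1 (K : fieldType) (A : augalg K) (a : A) : aug a = 0 -> apow A 1 a.
Proof. by move=> a0; apply: span_sub; exists a, 1; split=> //; rewrite mulr1. Qed.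

Lemma apow2M (K : fieldType) (A : augalg K) (a b : A) :
  aug a = 0 -> aug b = 0 -> apow A 2 (a * b).
Proof.
move=> a0 b0; apply: span_sub; exists a, b; split=> //; exact: aug_apow1.
Qed.

(** * The universal extension *)

Section UniversalExtension.
Variables (K : fieldType) (A : augalg K).
Hypothesis fA : finite_dim A.
Variable sigma : {linear harrH2 A K^o -> subm (harr_cocycles A K^o)}.
Hypothesis sigmaK : forall h, harr_class (sigma h) = h.

(** The section [sigma] embeds the cohomology in the bilinear forms on A, which are separated by
    their values on pairs of spanning vectors. *)
Lemma harrH2_finite_dim : finite_dim (harrH2 A K^o).
Proof.
have [d [e sp]] := fA.
pose I := ('I_d * 'I_d)%type.
pose chi (k : 'I_#|{: I}|) (h : harrH2 A K^o) : K^o :=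
  subm_val (sigma h) (e (enum_val k).1) (e (enum_val k).2).
have sl a b : linear (fun h => subm_val (sigma h) a b : K^o).
  exact: (submP (subm_val (dual_harr sigma) a b)).
apply: (@separated_finite_dim _ _ _ chi) => [k|h h0]; first exact: sl.
have s0 i j : subm_val (sigma h) (e i) (e j) = 0.
  by have := h0 (enum_rank (i, j)); rewrite /chi enum_rankK.
have sP : is_harr_cocycle (subm_val (sigma h)) := submP (sigma h).
have ll b : linear ((subm_val (sigma h))^~ b) := harr_lin sP b.
have lr a : linear (subm_val (sigma h) a).
  by move=> k x y; rewrite !(harr_sym sP a) ll.
have -> : h = harr_class 0.
  rewrite -[LHS]sigmaK; congr harr_class; apply/val_inj/funext => a; apply/funext
    => b /=.
  have [c ->] := sp a; have [c' ->] := sp b.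
  rewrite (lin_sum (ll _)) big1 // => i _; rewrite (linZ (ll _)).
  rewrite (lin_sum (lr _)) big1 ?scaler0 // => j _; rewrite (linZ (lr _)).
  by rewrite s0 scaler0.
by rewrite /harr_class /subpi linear0.
Qed.

Lemma ext_finite_dim (M : lmodType K) (f : subm (harr_cocycles A M)) :
  finite_dim M -> finite_dim (ext f).
Proof.
move=> [d' [e' sp']]; have [d [e sp]] := fA.
pose i1 (a : A) : ext f := (a, 0); pose i2 (m : M) : ext f := (0, m).
have l1 : linear i1.
  move=> k x y; congr (_, _); apply/esym; exact: (etrans (addr0 _) (scaler0 _ _)).
have l2 : linear i2.
  move=> k x y; congr (_, _); apply/esym; exact: (etrans (addr0 _) (scaler0 _ _)).
apply: (finite_dim_span (e1 := i1 \o e) (e2 := i2 \o e')) => -[a m].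
have [c ->] := sp a; have [c' ->] := sp' m; exists c, c'.
transitivity (i1 (\sum_i c i *: e i) + i2 (\sum_i c' i *: e' i)).
  by congr (_, _); [exact/esym/addr0 | exact/esym/add0r].
rewrite (lin_sum l1) (lin_sum l2).
by congr (_ + _); apply: eq_bigr => i _; [exact: (linZ l1) | exact: (linZ l2)].
Qed.

(* A functional on the extension vanishing on the square of the augmentation
   ideal is, by reflexivity, evaluation at a class, and splits its cocycle. *)
Lemma ext_incl_apow2 m : apow (ext (dual_harr sigma)) 2 (ext_incl (dual_harr sigma)
  m).
Proof.
set B := ext (dual_harr sigma); set i := ext_incl _.
apply: contrapT => no.
have fH := harrH2_finite_dim.
have [Psi [Pl PW Pm]] := separating_functional
  (ext_finite_dim (dual_harr sigma) (dual_finite_dim fH)) no.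
have il : linear i.
  move=> k x y; congr (_, _); apply/esym; exact: (etrans (addr0 _) (scaler0 _ _)).
have [h hE] := dual_reflexive fH (linear_comp Pl il).
apply: Pm; change ((Psi \o i) m = 0); rewrite hE.
pose i1 (a : A) : B := (a, 0).
have l1 : linear i1.
  move=> k x y; congr (_, _); apply/esym; exact: (etrans (addr0 _) (scaler0 _ _)).
pose s := subm_val (sigma h) : A -> A -> K.
have sP : is_harr_cocycle (s : A -> A -> K^o) := submP (sigma h).
pose g a : K := Psi (i1 a).
have gl : linear (g : A -> K^o) := linear_comp Pl l1.
(* The product of (a, 0) and (b, 0) is (ab, f(a,b)). [Psi] kills it, and its value on the second
   component is [s a b]. *)
have key a b : aug a = 0 -> aug b = 0 -> s a b = - g (a * b).
  move=> a0 b0.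
  have := PW _ (@apow2M _ B (i1 a) (i1 b) a0 b0).
  have -> : i1 a * i1 b = i1 (a * b) + i (subm_val (dual_harr sigma) a b).
    transitivity ((a * b, aug a *: 0 + aug b *: 0 + subm_val (dual_harr sigma) a b)
      : B) => //.
    rewrite a0 b0 !scale0r !add0r.
    by congr (_, _); [exact/esym/addr0 | exact/esym/add0r].
  rewrite (linD Pl); have := hE (subm_val (dual_harr sigma) a b).
  rewrite /= => ->; change (g (a * b) + s a b = 0 -> s a b = - g (a * b)).
  by move/eqP; rewrite addrC addr_eq0 => /eqP.
(* The cocycle need not be normalised. A coboundary takes at (1,1) the value of its cochain at 1, so
   [g'] is [s 1 1] at 1 and agrees with [g] on the augmentation ideal. *)
pose g' a : K := g (a - (aug a)%:A) + aug a * s 1 1.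
have gl' : linear (g' : A -> K^o).
  apply: linear_add.
    apply: (linear_comp (f := g : A -> K^o)) => // k x y.
    by rewrite (aug_linear k) scalerDl -scalerA scalerBr opprD addrACA.
  by move=> k x y; rewrite (aug_linear k) mulrDl scalerAl.
suff : h = 0 by move=> ->; apply: (lin0 (submP m : linear (subm_val m : _ -> K^o))).
rewrite -(sigmaK h) -[RHS](linear0 (@qpi _ _ (inside (harr_cocycles A K^o)
  (harr_coboundaries A K^o)))).
apply/qpiP; rewrite subr0; exists g' => // a b.
have sl c : linear (s^~ c : A -> K^o) := harr_lin sP c.
have sr c : linear (s c : A -> K^o) by move=> k x y; rewrite !(harr_sym sP c) (sl c).
have s1 c : s 1 c = aug c * s 1 1.
  have := harrE sP 1 1 c.
  by rewrite rmorph1 scale1r !mul1r subrr add0r => /eqP; rewrite subr_eq0 => /eqP.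
change (s a b = aug a * g' b - g' (a * b) + aug b * g' a).
pose a0 := a - (aug a)%:A; pose b0 := b - (aug b)%:A.
have aE : a = (aug a)%:A + a0 by rewrite addrC subrK.
have bE : b = (aug b)%:A + b0 by rewrite addrC subrK.
have a00 : aug a0 = 0 by rewrite /a0 rmorphB augZ rmorph1 mulr1 subrr.
have b00 : aug b0 = 0 by rewrite /b0 rmorphB augZ rmorph1 mulr1 subrr.
have abE : a * b - (aug (a * b))%:A = aug a *: b0 + aug b *: a0 + a0 * b0.
  have -> : (aug (a * b))%:A = (aug a)%:A * (aug b)%:A :> A.
    by rewrite rmorphM -scalerAl mul1r scalerA.
  rewrite -[aug a *: b0]mulr_algl -[aug b *: a0]mulr_algl.
  by rewrite /a0 /b0; ring.
have -> : s a b = aug a * aug b * s 1 1 - g (a0 * b0).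
  have -> : s a b = aug a * s 1 b + s a0 b by rewrite {1}aE; apply: sl.
  have -> : s a0 b = aug b * s a0 1 + s a0 b0 by rewrite {1}bE; apply: sr.
  have -> : s a0 1 = 0 by rewrite [LHS](harr_sym sP) s1 a00 mul0r.
  by rewrite mulr0 add0r s1 mulrA (key _ _ a00 b00).
have gZ k x : g (k *: x) = k * g x := linZ gl k x.
have gD x y : g (x + y) = g x + g y := linD gl x y.
have -> : g' a = g a0 + aug a * s 1 1 by [].
have -> : g' b = g b0 + aug b * s 1 1 by [].
have -> : g' (a * b) = aug a * g b0 + aug b * g a0 + g (a0 * b0) + aug a * aug b *
  s 1 1.
  by rewrite /g' abE (gD _ (a0 * b0)) (gD (aug a *: b0)) !gZ rmorphM.
by ring.
Qed.

End UniversalExtension.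

(** * Mittag-Leffler for affine sets *)

Section MittagLeffler.
Variable K : fieldType.

Definition affine (V : lmodType K) (T : V -> Prop) : Prop :=
  forall a x y z, T x -> T y -> T z -> T (x + a *: (y - z)).

(** Induction on the number of separating functionals. If the first is constant on some [T j0], the
    sequence is shifted to start there. Otherwise it takes two values on every [T j], hence by
    affinity the value 0, and the sets are restricted to its zero set. *)
Lemma affine_inter (V : lmodType K) m (chi : 'I_m -> V -> K^o) (T : nat -> V ->
  Prop) :
  (forall i, linear (chi i)) -> (forall j v, T j.+1 v -> T j v) ->
  (forall j, exists v, T j v) -> (forall j, affine (T j)) ->
  (forall x y, T 0%N x -> T 0%N y -> (forall i, chi i x = chi i y) -> x = y) ->
  exists v, forall j, T j v.
Proof.
elim: m chi T => [|m IHm] chi T cl dec ne aff sep;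
  have T0 j v : T j v -> T 0%N v by elim: j => // j IHj /dec.
  have [v Tv] := ne 0%N; exists v => j; have [w Tw] := ne j.
  by rewrite (sep v w Tv (T0 j w Tw)) // => -[].
pose chi' i := chi (fintype.lift ord0 i).
have cl' i : linear (chi' i) by apply: cl.
have sep0 x y : T 0%N x -> T 0%N y -> chi ord0 x = chi ord0 y ->
    (forall i, chi' i x = chi' i y) -> x = y.
  move=> Tx Ty e0 e1; apply: sep => // i.
  by have [j ->|->] := unliftP ord0 i; first exact: e1.
have [[j0 cst]|no] := pselect
    (exists j0, forall x y, T j0 x -> T j0 y -> chi ord0 x = chi ord0 y).
  have decn k j v : T (k + j)%N v -> T j v by elim: k => // k IHk /dec.
  have [|||||v Tv] := IHm chi' (fun j => T (j + j0)%N) => //.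
  - by move=> j v /dec.
  - by move=> x y Tx Ty; apply: sep0; [exact: T0 Tx| exact: T0 Ty| exact: cst].
  by exists v => j; apply: (decn j0); rewrite addnC.
have two j : exists x y, [/\ T j x, T j y & chi ord0 x <> chi ord0 y].
  apply: contrapT => h; apply: no; exists j => x y Tx Ty.
  by apply: contrapT => xy; apply: h; exists x, y.
have [|||||v Tv] := IHm chi' (fun j v => T j v /\ chi ord0 v = 0) => //.
- by move=> j v [/dec].
- move=> j; have [x [y [Tx Ty xy]]] := two j.
  pose u : K := chi ord0 x; pose w : K := chi ord0 y.
  (* The point on the line through [x] and [y] where the functional vanishes. *)
  exists (x + (- u / (w - u)) *: (y - x)); split; first exact: aff.
  rewrite (linD (cl _)) (linZ (cl _)) (linB (cl _)).
  change (u + (- u / (w - u)) * (w - u) = 0).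
  rewrite divfK ?subrr //; apply/eqP => /eqP.
  by rewrite subr_eq0 => /eqP e; apply: xy.
- move=> j a x y z [Tx x0] [Ty y0] [Tz z0]; split; first exact: aff.
  by rewrite (linD (cl _)) (linZ (cl _)) (linB (cl _)) x0 y0 z0 subrr scaler0 addr0.
- by move=> x y [Tx x0] [Ty y0]; apply: sep0 => //; rewrite x0 y0.
by exists v => j; case: (Tv j).
Qed.

Section Limit.
Variables (V : nat -> lmodType K) (p : forall k, V k.+1 -> V k).
Hypothesis pl : forall k, linear (@p k).
Variable S : forall k, V k -> Prop.
Hypothesis Saff : forall k, affine (@S k).
Hypothesis Sp : forall k s, S s -> S (@p k s).
Hypothesis Sne : forall k, exists s : V k, S s.
Hypothesis sep : forall k, exists m (chi : 'I_m -> V k -> K^o),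
  (forall i, linear (chi i)) /\ forall x y, (forall i, chi i x = chi i y) -> x = y.

Fixpoint lifts j k (s : V k) : Prop :=
  S s /\ if j is j'.+1 then exists s', @p k s' = s /\ @lifts j' k.+1 s' else True.

Lemma lifts_S j k (s : V k) : lifts j s -> S s.
Proof. by case: j => [|j] []. Qed.

Lemma lifts_dec j k (s : V k) : lifts j.+1 s -> lifts j s.
Proof.
elim: j k s => [|j IHj] k s; first by case.
by case=> Ss [s' [ps' /IHj ls']]; split=> //; exists s'.
Qed.

Lemma lifts_ne j k : exists s : V k, lifts j s.
Proof.
elim: j k => [|j IHj] k; first by have [s] := Sne k; exists s.
have [s ls] := IHj k.+1; exists (p s); split; first by apply: Sp; apply: lifts_S ls.
by exists s.
Qed.

Lemma lifts_aff j k : affine (@lifts j k).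
Proof.
elim: j k => [|j IHj] k a x y z.
  by move=> [Sx _] [Sy _] [Sz _]; split=> //; apply: Saff.
move=> [Sx [x' [ex lx]]] [Sy [y' [ey ly]]] [Sz [z' [ez lz]]]; split; first exact:
  Saff.
exists (x' + a *: (y' - z')); split; last exact: IHj.
by rewrite (linD (@pl k)) (linZ (@pl k)) (linB (@pl k)) ex ey ez.
Qed.

(** Some element at level 0 lifts arbitrarily far, and each element that does has another such above
    it. Both follow from [affine_inter], the second by applying it inside a fibre. *)
Lemma mittag_leffler : exists y : forall k, V k,
  (forall k, S (y k)) /\ forall k, p (y k.+1) = y k.
Proof.
have [||y [yP yR]] := @dependent_choice V (fun k s => forall j, lifts j s)
    (fun k s s' => p s' = s).
- have [m [chi [cl csep]]] := sep 0%N.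
  apply: (affine_inter cl) => [j v|j|j|x y _ _].
  + exact: lifts_dec.
  + exact: lifts_ne.
  + exact: lifts_aff.
  + exact: csep.
- move=> k s ls; have [m [chi [cl csep]]] := sep k.+1.
  have [j v|j|j|x y _ _|v Tv] := affine_inter (T := fun j (s' : V k.+1) => p s' = s
    /\ lifts j s') cl.
  + by move=> [-> /lifts_dec].
  + by case: (ls j.+1) => _ [s' []]; exists s'.
  + move=> a x y z [px lx] [py ly] [pz lz]; split; last exact: lifts_aff.
    rewrite (linD (@pl k)) (linZ (@pl k)) (linB (@pl k)) px py pz.
    by rewrite subrr scaler0 addr0.
  + exact: csep.
  by exists v; split=> [j|]; [case: (Tv j) | case: (Tv 0%N)].
by exists y; split=> // k; apply: (lifts_S (yP k 0%N)).
Qed.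

End Limit.
End MittagLeffler.

(** * Generators of the augmentation ideals, and the limit *)

Section Limit.
Variables (K : fieldType) (L : leibniz_algebra K).
Variables (C : nat -> augalg K) (p : forall k, aughom (C k.+1) (C k)).
Variable etak : forall k, bracket L (C k).
Arguments etak : clear implicits.
Hypothesis constr : is_construction p etak.
Hypothesis finHL2 : finite_dim (HL L 2).

Lemma triv_finite_dim : finite_dim (triv K).
Proof.
exists 1%N, (fun=> 1 : triv K) => v; exists (fun=> v).
by rewrite big_ord1; apply/esym/mulr1.
Qed.

Lemma tower_finite_dim k : finite_dim (C k).
Proof.
elim: k => [|k IHk].
  have [d [h [g [mu [iota [_ _ [j _ Kj] _ _]]]]]] := proj1 constr.
  apply: (finite_dim_surj (ahom_linear iota)) => [c|]; first by exists (j c).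
  exact: (ext_finite_dim triv_finite_dim 0 (dual_finite_dim finHL2)).
have [sigma [phib [omega [pi [sigmaK _ _ [pis _ _] _]]]]] := proj2 constr k.
apply: (finite_dim_surj (ahom_linear pi) pis).
exact: (ext_finite_dim IHk (dual_harr sigma) (dual_finite_dim (harrH2_finite_dim
  IHk sigmaK))).
Qed.

Lemma tower_surj k c : exists c', p k c' = c.
Proof.
have [sigma [phib [omega [pi [_ _ _ [_ _ ppi] _]]]]] := proj2 constr k.
by exists (pi (c, 0)); rewrite ppi.
Qed.

(** The kernel comes from the kernel of the universal extension, which lies in the square of the
    augmentation ideal by [ext_incl_apow2] and is annihilated by that ideal. *)
Lemma tower_ker k c : p k c = 0 ->
  apow (C k.+1) 2 c /\ forall z, aug z = 0 -> c * z = 0.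
Proof.
have [sigma [phib [omega [pi [sigmaK _ _ [pis pik ppi] _]]]]] := proj2 constr k.
have [b <-] := pis c; rewrite ppi => b0.
have -> : b = ext_incl (dual_harr sigma) b.2 by case: b b0 => [a m] /= ->.
split; first exact/ahom_apow/(ext_incl_apow2 (tower_finite_dim k) sigmaK).
move=> z; have [b' <-] := pis z; rewrite ahom_aug => z0.
rewrite -ahomM.
have -> : ext_incl (dual_harr sigma) b.2 * b' = 0.
  transitivity ((0 * b'.1, aug (0 : C k) *: b'.2 + aug b'.1 *: b.2
     + subm_val (dual_harr sigma) 0 b'.1) : ext (dual_harr sigma)) => //.
  have fl := harr_lin (submP (dual_harr sigma)) b'.1.
  have z0' : aug b'.1 = 0 := z0.
  rewrite (lin0 fl) mul0r rmorph0 scale0r z0' scale0r.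
  by congr (_, _); rewrite !addr0.
exact: rmorph0.
Qed.

Lemma plim_surj (c : C 0%N) : exists x : plim p, x 0%N = c.
Proof.
have [||x [xP xR]] := @dependent_choice C (fun k y => tower_proj p k y = c)
  (fun k y y' => p k y' = y).
- by exists c.
- move=> k y yc; have [y' py'] := tower_surj y.
  by exists y'; split=> //=; rewrite py'.
by exists (PLim xR); apply: (xP 0%N).
Qed.

(** A lift of [x k] into the square differs from [x k.+1] by a kernel element, itself in the square.
    The number of products is not yet bounded uniformly in [k]. *)
Lemma plim_apow2_coord (x : plim p) : x 0%N = 0 -> forall k, apow (C k) 2 (x k).
Proof.
move=> x0; elim=> [|k IHk]; first by rewrite x0; apply: smem0.
have [y y2 py] := apow_surj (@tower_surj k) IHk.
have [|d2 _] := @tower_ker k (x k.+1 - y).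
  by rewrite ahomB py coord_step subrr.
by rewrite -[x k.+1](subrK y); apply: smemD.
Qed.

Section Generators.
Variables (d : nat) (h : 'I_d -> HL L 2) (g : 'I_d -> dual (HL L 2)).
Variable iota : aughom (first_base L) (C 0%N).
Hypothesis hg : dual_bases h g.
Hypothesis iotab : bijective iota.
Variable t : 'I_d -> plim p.
Hypothesis t0 : forall i, t i 0%N = iota (ext_incl _ (g i)).

Lemma first_base_span (b : first_base L) : aug b = 0 ->
  b = \sum_i dapp b.2 (h i) *: ext_incl _ (g i).
Proof.
case: b => [a m] /= a0; have il : linear (ext_incl _ : _ -> first_base L).
  move=> k x y; congr (_, _); apply/esym; exact: (etrans (addr0 _) (scaler0 _ _)).
rewrite -(eq_bigr _ (fun i _ => linZ il _ _)) -(lin_sum il).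
congr (_, _); first exact: a0.
apply: dual_eq => v; have ml : linear (subm_val m : _ -> K^o) := submP m.
have evl : linear (fun w : dual (HL L 2) => dapp w v : K^o) by [].
rewrite (lin_sum evl) {1}/dapp [in LHS](proj1 hg v) (lin_sum ml).
apply: eq_bigr => i _; rewrite (linZ ml) (linZ evl); exact: mulrC.
Qed.

Lemma aug_t i k : aug (t i k) = 0.
Proof.
rewrite -[t i k]/(plim_proj p k (t i)) ahom_aug -(ahom_aug (plim_proj p 0)).
by rewrite /= t0 ahom_aug; apply: (rmorph0 aug).
Qed.

(** An argument in the style of Nakayama: the [t i] generate modulo the kernel of [p k], and that
    kernel lies in the square of the ideal and is annihilated by it. *)
Lemma tower_generators k y : aug y = 0 ->
  exists c : 'I_d -> C k, y = \sum_i t i k * c i.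
Proof.
elim: k y => [|k IHk] y y0.
  have [j [jK Kj]] := first_stage_inv iotab.
  have b0 : aug (j y) = 0 by rewrite ahom_aug.
  exists (fun i => (dapp (j y).2 (h i))%:A).
  rewrite -{1}[y]Kj {1}(first_base_span b0) (lin_sum (ahom_linear iota)).
  apply: eq_bigr => i _; rewrite (linZ (ahom_linear iota)) -t0.
  by rewrite -scalerAr mulr1.
have lift z : aug z = 0 -> exists (c : 'I_d -> C k.+1) w,
    z = \sum_i t i k.+1 * c i + w /\ p k w = 0.
  move=> z0; have [|c cE] := IHk (p k z); first by rewrite ahom_aug.
  have [c' cc'] := choice (fun i => tower_surj (c i)).
  exists c', (z - \sum_i t i k.+1 * c' i); split; first by rewrite addrC subrK.
  rewrite ahomB (lin_sum (ahom_linear (p k))) cE.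
  apply/eqP; rewrite subr_eq0; apply/eqP/eq_bigr => i _.
  by rewrite ahomM cc' coord_step.
have W0 : exists c : 'I_d -> C k.+1, 0 = \sum_i t i k.+1 * c i.
  by exists (fun=> 0); rewrite big1 // => i _; rewrite mulr0.
have WP a u v : (exists c : 'I_d -> C k.+1, u = \sum_i t i k.+1 * c i) ->
    (exists c : 'I_d -> C k.+1, v = \sum_i t i k.+1 * c i) ->
    exists c : 'I_d -> C k.+1, a *: u + v = \sum_i t i k.+1 * c i.
  move=> [c ->] [c' ->]; exists (fun i => a *: c i + c' i).
  rewrite scaler_sumr -big_split; apply: eq_bigr => i _.
  by rewrite mulrDr scalerAr.
have [c [w [-> /tower_ker[w2 _]]]] := lift y y0.
suff [c' ->] : exists c' : 'I_d -> C k.+1, w = \sum_i t i k.+1 * c' i.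
  exists (fun i => c i + c' i); rewrite -big_split; apply: eq_bigr => i _.
  by rewrite mulrDr.
apply: (span_min (W := Submod W0 WP) _ w2) => _ [m [z [m0 /(@apowS_aug _ _ 0) z0
  ->]]].
(* The factor [m] is written with the generators up to a kernel term [w'], which multiplication by
   [z] kills. *)
have [c' [w' [-> /tower_ker[_ /(_ z z0) wz]]]] := lift m m0.
exists (fun i => c' i * z); rewrite mulrDl wz addr0 mulr_suml.
by apply: eq_bigr => i _; rewrite mulrA.
Qed.

Lemma tower_apow2 k y : apow (C k) 2 y ->
  exists c : 'I_d -> C k, (forall i, aug (c i) = 0) /\ y = \sum_i t i k * c i.
Proof.
pose Q y := exists c : 'I_d -> C k, (forall i, aug (c i) = 0) /\ y = \sum_i t i k *
  c i.
have W0 : Q 0.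
  exists (fun=> 0); split=> [i|]; first exact: rmorph0.
  by rewrite big1 // => i _; rewrite mulr0.
have WP a u v : Q u -> Q v -> Q (a *: u + v).
  move=> [c [c0 ->]] [c' [c0' ->]]; exists (fun i => a *: c i + c' i); split=> [i|].
    by rewrite rmorphD augZ c0 c0' mulr0 addr0.
  rewrite scaler_sumr -big_split; apply: eq_bigr => i _.
  by rewrite mulrDr scalerAr.
apply: (span_min (W := Submod W0 WP)) => _ [m [z [m0 /(@apowS_aug _ _ 0) z0 ->]]].
have [c ->] := tower_generators m0; exists (fun i => c i * z); split=> [i|].
  by rewrite rmorphM z0 mulr0.
by rewrite mulr_suml; apply: eq_bigr => i _; rewrite mulrA.
Qed.

(* The coordinatewise decompositions form affine sets in finite-dimensional
   spaces, so that a coherent choice exists. *)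
Lemma plim_apow2 (x : plim p) : x 0%N = 0 -> apow (plim p) 2 x.
Proof.
move=> x0; have x2 := plim_apow2_coord x0.
pose V k : lmodType K := 'I_d -> C k.
pose P k (y : V k.+1) : V k := fun i => p k (y i).
(* Coefficients in the augmentation ideal expressing [x k]; a coherent family of them writes [x] as
   a sum of [d] products in the limit algebra. *)
pose S k (y : V k) := (forall i, aug (y i) = 0) /\ \sum_i t i k * y i = x k.
have Pl k : linear (@P k).
  by move=> a u v; apply/funext => i; apply: (ahom_linear (p k)).
have Saff k : affine (@S k).
  move=> a u v w [u0 uE] [v0 vE] [w0 wE]; split=> [i|].
    change (aug (u i + a *: (v i - w i)) = 0).
    by rewrite rmorphD augZ rmorphB u0 v0 w0 subrr mulr0 addr0.
  change (\sum_i t i k * (u i + a *: (v i - w i)) = x k).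
  transitivity (\sum_i t i k * u i + a *: (\sum_i t i k * v i - \sum_i t i k * w i)).
    rewrite -sumrB scaler_sumr -big_split; apply: eq_bigr => i _ /=.
    by rewrite mulrDr -scalerAr mulrBr.
  by rewrite uE vE wE subrr scaler0 addr0.
have Sp k (y : V k.+1) : S k.+1 y -> S k (P k y).
  move=> [y0 yE]; split=> [i|]; first by rewrite /P ahom_aug.
  rewrite -(coord_step x k) -yE (lin_sum (ahom_linear (p k))).
  by apply: eq_bigr => i _; rewrite ahomM coord_step.
have Sne k : exists y, S k y.
  by have [c [c0 cE]] := tower_apow2 (x2 k); exists c.
have sep k : exists m (chi : 'I_m -> V k -> K^o), (forall i, linear (chi i)) /\
    forall u v, (forall i, chi i u = chi i v) -> u = v.
  have [e [b [f [fl fE _]]]] := finite_basis (tower_finite_dim k).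
  exists #|{: 'I_d * 'I_e}|, (fun j u => f (enum_val j).2 (u (enum_val j).1)).
  split=> [j a u v|u v uv]; first exact: fl.
  apply/funext => i; rewrite [LHS]fE [RHS]fE; apply: eq_bigr => l _.
  by have := uv (enum_rank (i, l)); rewrite enum_rankK /= => ->.
have [y [yS yP]] := mittag_leffler Pl Saff Sp Sne sep.
have yP' i k : p k (y k.+1 i) = y k i by rewrite -(yP k).
pose z i : plim p := PLim (yP' i).
have -> : x = \sum_i t i * z i.
  apply: plim_eq => k; rewrite -(proj2 (yS k)).
  rewrite -[RHS]/(plim_proj p k _) (lin_sum (ahom_linear (plim_proj p k))).
  by apply: eq_bigr => i _; rewrite ahomM.
elim/big_ind: _ => [|u v|i _]; [exact: smem0 | exact: smemD |].
apply: apow2M; last exact: (proj1 (yS 0%N)).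
by rewrite -(ahom_aug (plim_proj p 0)); apply: aug_t.
Qed.

End Generators.
End Limit.

(** * Uniqueness *)

Section SquareZeroBase.
Variables (K : fieldType) (L : leibniz_algebra K) (A : augalg K).
Hypothesis sq0 : forall a : A, apow A 2 a -> a = 0.

Lemma apow_ge2 n (a : A) : apow A n.+2 a -> a = 0.
Proof. by elim: n => [|n IHn]; [apply: sq0 | move=> /apowSS]. Qed.

(** Powers of the ideal from the second on vanish, so A -> A/M^(n+2) is injective and [repr] inverts
    it. *)
Lemma repr_tpi n (a : A) : repr (tpi n.+1 a) = a.
Proof. by apply/eqP; rewrite -subr_eq0; apply/eqP/(@apow_ge2 n)/repr_qpi. Qed.

Lemma repr_linear n : linear (fun x : trunc A n.+1 => repr x : A).
Proof.
move=> k; elim/tpi_ind=> a; elim/tpi_ind=> b.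
by rewrite -(@tpi_linear K A n.+1) !repr_tpi.
Qed.

Lemma complete_linear a (t u : atens A L) :
  complete (a *: t + u) = a *: complete t + complete u.
Proof.
apply: ctens_eq => n; rewrite [LHS](tmapD _ _ (@tpi_linear K A n)).
by rewrite (tmap_ahomZ (tpi_hom A n)).
Qed.

(** The transition maps above level 1 are isomorphisms, so level 1 determines the element. *)
Lemma ctens_complete (x : ctens A L) :
  x = complete (tmap (fun y : trunc A 1 => repr y : A) (x 1%N)).
Proof.
pose t : atens A L := tmap (fun y : trunc A 1 => repr y : A) (x 1%N).
have tl n := @tpi_linear K A n.
have e1 : x 1%N = tmap (@tpi K A 1) t.
  rewrite /t -[RHS]/((tmap _ \o tmap _) _) -(tmap_comp (tl 1%N) (@repr_linear 0)).
  by rewrite tmap_id // => y; apply: qreprK.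
rewrite -/t; clearbody t; apply: ctens_eq => -[|n].
  rewrite -(level_step x 0) e1 -[LHS]/((tmap _ \o tmap _) _).
  rewrite -(tmap_comp (@trunc_step_linear K A 0) (tl 1%N)).
  by apply: eq_tmap => a; apply: trunc_stepE.
elim: n => [|n IHn]; first exact: e1.
pose back (y : trunc A n.+1) : trunc A n.+2 := tpi n.+2 (repr y : A).
have bl : linear back := linear_comp (tl n.+2) (@repr_linear n).
have -> : x n.+2 = tmap back (x n.+1).
  rewrite -(level_step x n.+1) -[RHS]/((tmap _ \o tmap _) _).
  rewrite -(tmap_comp bl (@trunc_step_linear K A n.+1)) tmap_id //.
  by elim/tpi_ind=> a; rewrite /= trunc_stepE /back repr_tpi.
rewrite IHn /= -[LHS]/((tmap _ \o tmap _) _) -(tmap_comp bl (tl n.+1)).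
by apply: eq_tmap => a; rewrite /= /back repr_tpi.
Qed.

(** A formal equivalence is not assumed to act level by level. Here every element of the completion
    comes from A (x) L, so A-linearity determines [rho] by its values on the 1 (x) l. *)
Lemma rho_level1 (rho : ctens A L -> ctens A L) : linear rho ->
  let r (l : L) : atens (trunc A 1) L := rho (cpure 1 l) 1%N in
  linear (r : L -> tens (trunc A 1) L) /\
  forall x, rho x 1%N = alin r (x 1%N).
Proof.
move=> rl r.
have rr : linear (r : L -> tens (trunc A 1) L).
  move=> k l m; transitivity ((k%:A : trunc A 1) *: r l + r m); last first.
    by rewrite atens_scaleK.
  rewrite /r /cpure apure1P complete_linear rl.
  change (tpi 1 (k%:A : A) *: r l + r m = (k%:A : trunc A 1) *: r l + r m).
  by rewrite (linZ (@tpi_linear K A 1)).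
split=> // x; rewrite (ctens_complete x).
elim/(@atens_ind K A L): (tmap _ _) => [l|a u v Iu Iv].
  rewrite -[complete _]/(cpure 1 l) cpure_level alinE // scale1r //.
rewrite complete_linear rl.
change (tpi 1 a *: rho (complete u) 1%N + rho (complete v) 1%N =
  alin r (tpi 1 a *: complete u 1%N + complete v 1%N)).
by rewrite Iu Iv (alin_linear rr).
Qed.

End SquareZeroBase.

Section Uniqueness.
Variables (K : fieldType) (L : leibniz_algebra K).
Variables (C : nat -> augalg K) (p : forall k, aughom (C k.+1) (C k)).
Variable etak : forall k, bracket L (C k).
Arguments etak : clear implicits.
Hypothesis constr : is_construction p etak.
Hypothesis finHL2 : finite_dim (HL L 2).
Variable eta : cbracket L (plim p).
Hypothesis limit : is_limit_deformation etak eta.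
Variables (A : augalg K) (lam : cbracket L A).
Hypothesis base : is_base A.
Hypothesis sq0 : forall a : A, apow A 2 a -> a = 0.

Lemma equiv_compare (lf lg : cbracket L A) :
  formal_equiv lam lf -> formal_equiv lam lg -> formal_equiv lf lg.
Proof.
move=> [rf [fl fb fM fa]] [rg [gl gb gM ga]]; case: (fb) => k fK kF.
have kl : linear k by move=> a x y; rewrite -[RHS]fK fl !kF.
exists (rg \o k); split.
- by move=> a x y; rewrite /= kl gl.
- by apply: bij_comp => //; exists rf.
- by move=> x y /=; rewrite -gM -[in RHS](fK (lam _ _)) fM !kF.
- by move=> x /=; rewrite ga -fa kF.
Qed.

(** Level 0 is [L] itself, so preserving the augmentation makes the equivalence trivial there. At
    level 1 it is 1 + b on generators, and the left-hand side of [equiv_lift] vanishes. *)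
Lemma equiv_coboundary (lf lg : cbracket L A) r (n : 'I_r -> trunc A 1) chi s :
  small_ext (tstep A 0) n chi s ->
  is_formal_deformation lf -> is_formal_deformation lg -> formal_equiv lf lg ->
  exists b : 'I_r -> L -> L, (forall i, linear (b i)) /\
    forall l m, lf (cpure 1 l) (cpure 1 m) 1%N - lg (cpure 1 l) (cpure 1 m) 1%N
      = inc n (fun i => del1 (b i) l m).
Proof.
move=> se [_ [lfn [lfd lfE]] _] [_ [lgn [lgd lgE]] _] [rho [rl _ rM ra]].
have [rr rE] := rho_level1 sq0 rl; set r0 := (fun l => _) in rr rE.
have ql := ahom_linear (tstep A 0).
pose b i l := contr (chi i) (r0 l - apure 1 l).
have bl i : linear (b i).
  apply: (linear_comp (contr_linear (se_chi_lin se i))).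
  apply: (@linear_sub _ _ (tens (trunc A 1) L)) => // k l m.
  exact: pure_linr.
have r1 l : alin r0 (apure 1 l) = apure 1 l + inc n (fun i => b i l).
  have q0 : tmap (tstep A 0) (r0 l - apure 1 l : tens (trunc A 1) L) = 0.
    rewrite (tmapB _ _ ql) (tmapE ql) ahom1.
    have -> : tmap (tstep A 0) (r0 l) = rho (cpure 1 l) 0%N by apply: level_step.
    rewrite (trunc0_tens (rho (cpure 1 l) 0%N)).
    have -> : aug_tens (rho (cpure 1 l) 0%N) = l.
      by rewrite -[LHS]/(aug_ctens _) ra /aug_ctens cpure_level aug_tens1.
    exact: subrr.
  by rewrite alinE // scale1r /b -(se_tker se q0) addrC subrK.
exists b; split=> // l m.
have [lfb lfa] := (deformation_bilin (lfd 1%N), proj2 (lfd 1%N)).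
have [lgb lga] := (deformation_bilin (lgd 1%N), proj2 (lgd 1%N)).
have := equiv_lift (se_annih se) (se_aug se) lfb lfa lgb lga (alin_linear rr) r1 bl
  l m.
rewrite !lfE !lgE !cpure_level.
have -> : alin r0 (lfn 1%N (apure 1 l) (apure 1 m)) =
    lgn 1%N (alin r0 (apure 1 l)) (alin r0 (apure 1 m)).
  by rewrite -!cpure_level -lfE -!rE rM lgE.
by rewrite subrr => /esym/eqP; rewrite subr_eq0 => /eqP.
Qed.

Lemma uniqueness (f g : aughom (plim p) A) :
  induces eta lam f -> induces eta lam g -> f =1 g.
Proof.
move=> [lf [[lfd lfP] lfe]] [lg [[lgd lgP] lge]].
have [d [h [gg [mu [iota [hg muK iotab _ eta0E]]]]]] := proj1 constr.
have [t t0] := choice (fun i => plim_surj constr (iota (ext_incl _ (gg i)))).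
have fgl : linear (fun x => f x - g x).
  by apply: linear_sub; apply: ahom_linear.
have kill2 x : apow (plim p) 2 x -> f x - g x = 0.
  by move=> x2; rewrite !(sq0 (ahom_apow _ x2)) subrr.
have kill0 (x : plim p) : x 0%N = 0 -> f x - g x = 0.
  by move=> x0; apply/kill2/(plim_apow2 constr finHL2 hg iotab t0).
(* The difference of [f] and [g] kills the square of the ideal, hence the kernel of C -> C_1, and
   descends to [C 0]. *)
have [e eE] : exists e : C 0%N -> A, forall x : plim p, e (x 0%N) = f x - g x.
  have [sec secE] := choice (plim_surj constr).
  exists (fun c => f (sec c) - g (sec c)) => x.
  apply/eqP; rewrite -subr_eq0 -(linB fgl); apply/eqP/kill0.
  by rewrite -[LHS]/(plim_proj p 0 _) ahomB; apply/eqP; rewrite subr_eq0 /= secE.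
have el : linear e.
  move=> k a b; have [x <-] := plim_surj constr a; have [y <-] := plim_surj constr b.
  by rewrite -[k *: _ + _]/((k *: x + y : plim p) 0%N) !eE fgl.
have e1 : e 1 = 0 by rewrite -[1]/((1 : plim p) 0%N) eE !ahom1 subrr.
have e2 c : apow (C 0%N) 2 c -> e c = 0.
  move=> /(apow_surj (f := plim_proj p 0))[|x x2 <-]; first exact: (plim_surj constr).
  by rewrite eE kill2.
(* [limit] describes [eta] through truncations of [C 0]; since [e] kills the square of the ideal,
   level 1 carries it. *)
pose e' (y : trunc (C 0%N) 1) : trunc A 1 := tpi 1 (e (repr y)).
have e'E c : e' (tpi 1 c) = tpi 1 (e c).
  congr (tpi 1 _); apply/eqP; rewrite -subr_eq0 -(linB el).
  by apply/eqP/e2/repr_qpi.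
have el' : linear e'.
  move=> k; elim/tpi_ind=> a; elim/tpi_ind=> b.
  by rewrite -(@tpi_linear K (C 0%N) 1) !e'E el (@tpi_linear K A 1).
pose T i := tpi 1 (e (iota (ext_incl _ (gg i)))).
have diff l m : lf (cpure 1 l) (cpure 1 m) 1%N - lg (cpure 1 l) (cpure 1 m) 1%N =
    \sum_i pure (T i) (subm_val (mu (h i)) (pair2 l m)).
  rewrite lfP lgP.
  have := congr1 (fun t : ctens (C 0%N) L => t 1%N) (proj2 limit 0%N l m).
  move: (eta (cpure 1 l) (cpure 1 m)) => E /= EE.
  transitivity (tmap e' (tmap (trunc_map (plim_proj p 0) (n := 1)) (E 1%N))).
    rewrite -[RHS]/((tmap _ \o tmap _) _).
    rewrite -(tmap_comp el' (@trunc_map_linear _ _ _ (plim_proj p 0) 1)).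
    have fl := @trunc_map_linear _ _ _ f 1; have gl := @trunc_map_linear _ _ _ g 1.
    have -> : e' \o trunc_map (plim_proj p 0) (n := 1) =
        (fun y => trunc_map f y + - trunc_map g y).
      apply/funext; elim/tpi_ind=> x; rewrite /= !trunc_mapE e'E eE.
      exact: (linB (@tpi_linear K A 1)).
    rewrite (tmap_add _ fl (linear_opp gl)); congr (_ + _).
    elim/tens_ind: (E 1%N) => [y k|k u v Iu Iv].
      by rewrite !tmapE //; [rewrite -(linN (pure_linl k)) | exact: linear_opp].
    rewrite (tmap_linear gl) (tmap_linear (linear_opp gl)) -Iu -Iv.
    by rewrite opprD scalerN.
  rewrite EE -[LHS]/((tmap _ \o tmap _) _) -(tmap_comp el' (@tpi_linear K (C 0%N) 1)).
  have tel := linear_comp (@tpi_linear K A 1) el.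
  have -> : e' \o tpi 1 (A := C 0%N) = tpi 1 (A := A) \o e.
    by apply/funext => c /=; apply: e'E.
  rewrite eta0E (tmapD _ _ tel) (tmapE tel) /= e1 (lin0 (@tpi_linear K A 1)) pure0l
    add0r.
  rewrite (lin_sum (tmap_linear tel)); apply: eq_bigr => i _.
  by rewrite (tmapE tel) pair2E.
have [r [n [chi [s se]]]] := tstep_small base 0.
have [b [bl bE]] := equiv_coboundary se lfd lgd (equiv_compare lfe lge).
(* The i-th coordinate of the difference is the cocycle [mu v], with [v] the combination of the
   [h j] with coefficients [chi i (T j)]. It is a coboundary, so [v] is zero, and the [h j] are
   independent. *)
have u0 i k : chi i (T k) = 0.
  pose v := \sum_j (chi i (T j) : K) *: h j.
  have v0 : v = 0.
    rewrite -(muK v); apply: HLclass_eq0.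
    exists (coc1 (b i)); first exact: coc1_multilinear.
    apply/funext => x; rewrite delta_coc1.
    have cl := contr_linear (L := L) (se_chi_lin se i).
    have := bE (x ord0) (x ord_max); rewrite diff => /(congr1 (contr (chi i))).
    rewrite (contr_inc se) (lin_sum cl) => <-.
    rewrite /v linear_sum.
    have -> : x = pair2 (x ord0) (x ord_max).
      by apply/funext => -[[|[|//]]] H; rewrite /pair2 /=; congr x; apply/val_inj.
    have subl : linear (fun w : subm (cocycles L 2) => subm_val w (pair2 (x ord0)
      (x ord_max))) by [].
    rewrite (lin_sum subl); apply: eq_bigr => j _.
    rewrite linearZ contr_pure //; exact: (se_chi_lin se).
  have gl : linear (subm_val (gg k) : _ -> K^o) := submP (gg k).
  have := congr1 (fun w => dapp (gg k) w) v0.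
  rewrite /dapp (lin0 gl) /v (lin_sum gl) (bigD1 k) //= big1 => [|j jk].
    rewrite (linZ gl) -/(dapp _ _) (proj2 hg) eqxx addr0 => <-.
    by apply/esym/mulr1.
  by rewrite (linZ gl) -/(dapp _ _) (proj2 hg) eq_sym (negbTE jk) scaler0.
(* [T k] vanishes in A/M and all its kernel coordinates are zero; moreover A -> A/M^2 is
   injective. *)
have eg k : e (iota (ext_incl _ (gg k))) = 0.
  have a0 : aug (e (iota (ext_incl _ (gg k)))) = 0.
    by rewrite -t0 eE rmorphB !ahom_aug subrr.
  apply: sq0; rewrite -[e _]subr0; apply/(@tpiP K A 1); rewrite -/(T k).
  rewrite (se_dec se (T k)) big1 => [|i _]; last by rewrite u0 scale0r.
  have -> : tstep A 0 (T k) = 0.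
    rewrite /T tstepE -(lin0 (@tpi_linear K A 0)); apply/tpiP.
    by rewrite subr0; apply: aug_apow1.
  by rewrite (lin0 (se_sec_lin se)) addr0 (lin0 (@tpi_linear K A 1)).
have [j [jK Kj]] := first_stage_inv iotab.
(* [C 0] is spanned by 1 and the images of the dual basis [gg]. *)
have e0 c : e c = 0.
  have b0 : aug (j c - (aug c)%:A) = 0.
    by rewrite rmorphB augZ rmorph1 mulr1 ahom_aug subrr.
  have := congr1 iota (first_base_span hg b0).
  rewrite (lin_sum (ahom_linear iota)) ahomB Kj (linZ (ahom_linear iota)) ahom1.
  move=> cE; rewrite -[c](subrK (aug c)%:A) cE (linD el) (linZ el) e1 scaler0 addr0.
  rewrite (lin_sum el) big1 // => i _.
  by rewrite (linZ (ahom_linear iota)) (linZ el) eg scaler0.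
by move=> x; apply/eqP; rewrite -subr_eq0 -eE e0.
Qed.

End Uniqueness.

Theorem theorem6p8 (K : fieldType) (L : leibniz_algebra K)
    (C : nat -> augalg K) (p : forall k, aughom (C k.+1) (C k))
    (etak : forall k, bracket L (C k)) (eta : cbracket L (plim p))
    (charK : [pchar K] =i pred0)
    (finHL2 : finite_dim (HL L 2))
    (constr : is_construction p etak)
    (limit : is_limit_deformation etak eta) :
  versal eta.
Proof.
move=> A lam base Acomplete lamd; split.
  have [_ [lamn [lamnd lamE]] _] := lamd.
  exact: (existence constr base Acomplete lamnd lamE limit).
move=> sq0 f g; exact: (uniqueness constr finHL2 limit base sq0).
Qed.
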